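(* Let $\rho\in(-\infty,0]$, $\alpha\in(-1,\infty)$, $\beta\in\mathbb{R}$ with $2\beta>\alpha+1$, let $x_0\ge0$ and let $X$ be the solution of $$dX_t=dB_t+\rho\,\mathrm{sgn}(X_t)\frac{|X_t|^\alpha}{t^\beta}\,dt,\qquad t\ge1,\quad X_1=x_0.$$ Then $X$ is recurrent in $\mathbb{R}$, $X_t/\sqrt t$ converges in distribution to $\mathcal N(0,1)$ as $t\to\infty$, and $$\limsup_{t\to\infty}\frac{X_t}{(2t\ln\ln t)^{1/2}}=1\quad\text{a.s.}$$
   Context: $B$ is a standard Brownian motion; $\mathrm{sgn}$ is the sign function. $X$ is recurrent in $E\subset\mathbb R$ if for every $x\in E$ the set $\{t\ge1:X_t=x\}$ is a.s. unbounded. *)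

(* Defs.v *)
From HB Require Import structures.
From mathcomp Require Import all_boot all_order all_algebra.
From mathcomp Require Import all_classical all_reals all_analysis.
Set Implicit Arguments. Unset Strict Implicit. Unset Printing Implicit Defensive.
Import Order.TTheory GRing.Theory Num.Theory.
Import numFieldNormedType.Exports.
Local Open Scope classical_set_scope.
Local Open Scope ring_scope.

Section defs.
Context (d : measure_display) (Omega : measurableType d) (R : realType)
  (P : probability Omega R).

Definition is_filtration (F : R -> set (set Omega)) : Prop :=
  (forall t, sigma_algebra setT (F t)) /\
  (forall t, F t `<=` measurable) /\
  (forall s t, s <= t -> F s `<=` F t).

Definition rv_measurable_wrt (G : set (set Omega)) (Y : Omega -> R) : Prop :=
  forall C : set R, measurable C -> G (Y @^-1` C).

Definition indep_of (G : set (set Omega)) (Y : Omega -> R) : Prop :=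
  forall (A : set Omega) (C : set R), G A -> measurable C ->
    P (A `&` Y @^-1` C) = (P A * P (Y @^-1` C))%E.

Definition is_F_brownian (F : R -> set (set Omega)) (B : R -> Omega -> R) : Prop :=
  (forall t, 0 <= t -> rv_measurable_wrt (F t) (B t)) /\
  {ae P, forall w, B 0 w = 0} /\
  {ae P, forall w, {within `[0, +oo[, continuous (fun t => B t w)}} /\
  (forall s t, 0 <= s -> s < t ->
     indep_of (F s) (fun w => B t w - B s w) /\
     forall C : set R, measurable C ->
       P ((fun w => B t w - B s w) @^-1` C) = normal_prob 0 (Num.sqrt (t - s)) C).

Definition drift (rho alpha beta s x : R) : R :=
  rho * Num.sg x * (`|x| `^ alpha) / (s `^ beta).

Definition is_solution (F : R -> set (set Omega)) (B X : R -> Omega -> R)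
  (rho alpha beta x0 : R) : Prop :=
  (forall t, 1 <= t -> rv_measurable_wrt (F t) (X t)) /\
  {ae P, forall w,
     {within `[1, +oo[, continuous (fun t => X t w)} /\
     X 1 w = x0 /\
     forall t, 1 <= t ->
       (lebesgue_measure).-integrable `[1, t]
          (fun s => (drift rho alpha beta s (X s w))%:E) /\
       X t w = x0 + (B t w - B 1 w)
               + Rintegral lebesgue_measure `[1, t]
                   (fun s => drift rho alpha beta s (X s w))}.

End defs.

(* Main.v *)
Require Import Defs.
From HB Require Import structures.
From mathcomp Require Import all_boot all_order all_algebra.
From mathcomp Require Import all_classical all_reals all_analysis.
From mathcomp Require Import measurable_realfun ring lra.
Set Implicit Arguments. Unset Strict Implicit. Unset Printing Implicit Defensive.
Import Order.TTheory GRing.Theory Num.Theory.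
Import numFieldNormedType.Exports.
Local Open Scope classical_set_scope.
Local Open Scope ring_scope.

(** The three claims are inherited from B as soon as X_t - B_t = o(sqrt t) almost surely: the law of
    the iterated logarithm and the central limit theorem are insensitive to such a perturbation,
    and recurrence follows from the oscillation of X between -oo and +oo.  Put
    kap = beta - (alpha + 1) / 2 > 0.  It is enough to bound the total variation of the drift over
    the blocks [2^n, 2^(n+1)] by a constant times (2^n)^(1/2 - kap') for some kap' > 0.

    If alpha >= 0, the drift points towards 0, so that |X_t| <= |x0| + 2 sup_{s <= t} |B_s - B_1|,
    and the iterated logarithm bound for B is inserted in the drift.

    If -1 < alpha < 0, the drift is singular at 0.  For T = 2^n one shows that the integral of
    |X_s / sqrt T|^alpha over [T, 2T] has expectation O(T).  Apply Ito's formula to f (X / sqrt T), where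
    f = 1 - exp (- |z|^(alpha + 2)) is bounded, f'' >= c1 |z|^alpha - c2, and |f'| |z|^alpha <= 2 |z|^alpha,
    so that the drift term is negligible for T large.  The stochastic integral is avoided: |z| is replaced
    by sqrt (z^2 + eta), the formula is a telescoping sum with a Taylor expansion over a grid, and the
    limits in the mesh and in eta are taken on events.  Markov's inequality and the Borel-Cantelli
    lemma then give the bound on the blocks. *)

(** * Gaussian laws *)

Section gaussian.
Variable R : realType.
Implicit Types (C : set R).

(** The exponent on the blocks comes from scaling: where |X_t| is of order sqrt t the drift is of
    order t^(-1/2 - kap), so a block of length T contributes T^(1/2 - kap). For alpha < 0 this fails
    pointwise, because the drift explodes near 0, and only the time spent there can be controlled.
    The drift is absorbed because, once space is divided by sqrt T, the second derivative carries a
    factor 1/T and the drift term a factor T^(-1 - kap). The condition alpha > -1 makes (alpha +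
    2)(alpha + 1)|z|^alpha, the second derivative of |z|^(alpha + 2), positive. Measurability shapes
    the rest: [is_solution] gives each X_t as a random variable but continuity in t only almost
    surely. Expectations are therefore taken of finite grid sums alone, and integrals over time are
    reached through liminf events built from such sums. This requires bounds uniform in the mesh and
    in eta. The constant L of the regularized test function blows up as eta tends to 0, but it only
    decides how fine the mesh has to be. *)

Lemma lebesgue_measure_scale (s : R) (A : set R) : 0 < s -> measurable A ->
  (@lebesgue_measure R) A = (s%:E * pushforward (@lebesgue_measure R)
    (fun z : R => (s * z)%R : measurableTypeR R) A)%E.
Proof.
move=> s0 mA.
pose sn : {nonneg R} := NngNum (ltW s0).
have mf : measurable_fun [set: R] (fun z : R => s * z : measurableTypeR R).
  exact: measurable_funM.
have E := @lebesgue_measure_unique R (mscale sn (pushforward (@lebesgue_measure R)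
  (fun z : R => s * z : measurableTypeR R))).
rewrite (E mf)// => _ [[a b]/= _ <-].
rewrite /mscale /= /pushforward.
have -> : (fun z : R => s * z) @^-1` `]a, b]%classic = `]s^-1 * a, s^-1 * b]%classic.
  apply/seteqP; split => x /=; rewrite !in_itv/= ![s^-1 * _]mulrC ltr_pdivrMr// ler_pdivlMr//
    ![x * s]mulrC//.
rewrite !lebesgue_measure_itv/= !lte_fin ltr_pM2l ?invr_gt0//.
case: ifPn => ab; last by rewrite mule0.
rewrite -!EFinD -EFinM; congr EFin; field; exact: lt0r_neq0.
Qed.

Lemma normal_prob_scale (s : R) C : 0 < s -> measurable C ->
  normal_prob 0 s C = normal_prob 0 1 ((fun z : R => s * z) @^-1` C).
Proof.
move=> s0 mC.
have mf : measurable_fun [set: R] (fun z : R => s * z : measurableTypeR R).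
  exact: measurable_funM.
pose sn : {nonneg R} := NngNum (ltW s0).
have mp A u : measurable_fun A (EFin \o (normal_pdf 0 u) : R -> \bar R).
  by apply/measurable_EFinP; apply: measurable_funTS; exact: measurable_normal_pdf.
have p0 m u x : (0 <= ((normal_pdf m u x : R)%:E))%E by rewrite lee_fin normal_pdf_ge0.
rewrite /normal_prob (eq_measure_integral (mscale sn (pushforward (@lebesgue_measure R)
  (fun z : R => s * z : measurableTypeR R)))); last first.
  by move=> A mA _; exact: lebesgue_measure_scale.
rewrite ge0_integral_mscale//=; last exact: mp.
rewrite ge0_integral_pushforward//; last exact: mp.
have mpre : measurable ((fun z : R => s * z) @^-1` C : set (measurableTypeR R)).
  by rewrite -[X in measurable X]setTI; exact: mf.
rewrite -ge0_integralZl//; last 3 first.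
- by apply: measurable_funTS; exact: (measurableT_comp (mp setT s)).
- by move=> x _; exact: p0.
- by rewrite lee_fin ltW.
apply: eq_integral => x _ /=; rewrite -EFinM; congr EFin.
rewrite !normal_pdfE ?oner_neq0 ?gt_eqF// /normal_peak /normal_fun !subr0.
rewrite expr1n mul1r -mulrnAr sqrtrM ?sqr_ge0// sqrtr_sqr gtr0_norm// invfM !mulrA divff ?gt_eqF// mul1r.
congr (_ * expR _).
field; exact: lt0r_neq0.
Qed.

Lemma normal_probN (s : R) C : s != 0 -> measurable C ->
  normal_prob 0 s ((@GRing.opp R) @^-1` C) = normal_prob 0 s C.
Proof.
move=> s0 mC; rewrite /normal_prob.
have mf : measurable_fun [set: R] (-%R : R -> measurableTypeR R) by [].
have mp A u : measurable_fun A (EFin \o (normal_pdf 0 u) : R -> \bar R).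
  by apply/measurable_EFinP; apply: measurable_funTS; exact: measurable_normal_pdf.
rewrite [RHS](eq_measure_integral (pushforward lebesgue_measure (-%R : R -> measurableTypeR R)));
  last first.
  by move=> A mA _; exact: (esym (lebesgue_measureN mA)).
rewrite ge0_integral_pushforward//; [|exact: mp|by move=> x _; rewrite lee_fin normal_pdf_ge0].
apply: eq_integral => x _ /=; congr EFin.
by rewrite !normal_pdfE// /normal_fun !subr0 sqrrN.
Qed.

(** For x > a >= 0 one has x^2 >= a^2 + (x - a)^2, so the density is at most the claimed exponential
    times the density of the same law centred at a, whose mass is 1. *)
Lemma normal_tail_ub (s a : R) : 0 < s -> 0 <= a ->
  (normal_prob 0 s `]a, +oo[ <= (expR (- a ^+ 2 / (s ^+ 2 *+ 2)))%:E)%E.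
Proof.
move=> s0 a0; rewrite /normal_prob.
have H x : x \in `]a, +oo[ -> normal_pdf 0 s x <= expR (- a ^+ 2 / (s ^+ 2 *+ 2))
  * normal_pdf a s x.
  rewrite in_itv/= andbT => ax.
  rewrite !normal_pdfE ?gt_eqF// mulrCA; apply: ler_wpM2l; first exact: normal_peak_ge0.
  rewrite /normal_fun subr0 -expRD ler_expR -mulrDl.
  apply: ler_wpM2r; first by rewrite invr_ge0 mulrn_wge0// sqr_ge0.
  nra.
have mp A m : measurable_fun A (EFin \o (normal_pdf m s) : R -> \bar R).
  by apply/measurable_EFinP; apply: measurable_funTS; exact: measurable_normal_pdf.
have p0 m x : (0 <= (normal_pdf m s x)%:E)%E by rewrite lee_fin normal_pdf_ge0.
apply: (@le_trans _ _ (\int[lebesgue_measure]_(x in `]a, +oo[)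
  ((expR (- a ^+ 2 / (s ^+ 2 *+ 2)))%:E * (normal_pdf a s x)%:E)))%E.
  apply: ge0_le_integral => //.
  - exact: mp.
  - apply: measurable_funeM; exact: mp.
  rewrite ge0_integralZl//; last exact: mp.
rewrite -[leRHS]mule1; apply: lee_wpmul2l; first by rewrite lee_fin expR_ge0.
rewrite -(integral_normal_pdf a s).
apply: ge0_subset_integral => //; exact: mp.
Qed.

(** The mass of the unit interval ]a, a + 1] alone, on which the density is smallest at the right
    end. *)
Lemma normal_tail_lb (a : R) : 0 <= a ->
  ((normal_peak 1 * expR (- (a + 1) ^+ 2 / 2))%:E <= normal_prob 0 1 (`]a, +oo[ : set R))%E.
Proof.
move=> a0; rewrite /normal_prob.
have mp A m : measurable_fun A (EFin \o (normal_pdf m 1) : R -> \bar R).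
  by apply/measurable_EFinP; apply: measurable_funTS; exact: measurable_normal_pdf.
have p0 m x : (0 <= ((normal_pdf m 1 x : R)%:E))%E by rewrite lee_fin normal_pdf_ge0.
apply: (@le_trans _ _ (\int[lebesgue_measure]_(x in `]a, (a+1)%R])
  (cst (normal_peak 1 * expR (- (a + 1) ^+ 2 / 2))%:E x)))%E.
  rewrite integral_cst//= lebesgue_measure_itv/= lte_fin ltrDl ltr01 -EFinD addrAC subrr add0r mule1//.
apply: (@le_trans _ _ (\int[lebesgue_measure]_(x in `]a, (a+1)%R]) (normal_pdf 0 1 x)%:E))%E.
  apply: ge0_le_integral => //.
  - by move=> x _; rewrite /= lee_fin mulr_ge0 ?expR_ge0 ?normal_peak_ge0.
  - exact: mp.
  move=> x /=; rewrite in_itv/= => /andP[ax xa]; rewrite lee_fin normal_pdfE ?oner_neq0//.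
  rewrite ler_wpM2l ?normal_peak_ge0// /normal_fun subr0 expr1n ler_expR; nra.
apply: ge0_subset_integral => //; first exact: mp.
by move=> x /=; rewrite !in_itv/= => /andP[->].
Qed.
End gaussian.

(** * Independence, and measurability with respect to a sub-sigma-algebra *)

Section indep.
Context d (Omega : measurableType d) (R : realType) (P : probability Omega R).

(** The joint law of (U, V) agrees with the product of the marginals on rectangles, hence
    everywhere; Fubini for the function (x, y) |-> x y on the product gives both claims. *)
Lemma indep_mul (U V : Omega -> R) :
  measurable_fun setT U -> measurable_fun setT V ->
  (forall A C : set R, measurable A -> measurable C ->
    P (U @^-1` A `&` V @^-1` C) = (P (U @^-1` A) * P (V @^-1` C))%E) ->
  P.-integrable setT (EFin \o U) -> P.-integrable setT (EFin \o V) ->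
  P.-integrable setT (EFin \o (U \* V)) /\
  (\int[P]_w (U w * V w) = (\int[P]_w U w) * \int[P]_w V w).
Proof.
move=> mU mV UV iU iV.
pose U' : {RV P >-> R} := HB.pack U (isMeasurableFun.Build _ _ _ _ U mU).
pose V' : {RV P >-> R} := HB.pack V (isMeasurableFun.Build _ _ _ _ V mV).
pose m1 := distribution P U'; pose m2 := distribution P V'.
have mW : measurable_fun setT (fun w => (U w, V w)) by exact: measurable_fun_pair.
pose W' : {RV P >-> (R * R)%type} := HB.pack (fun w => (U w, V w))
  (isMeasurableFun.Build _ _ _ _ (fun w => (U w, V w)) mW).
have E : forall X : set (R * R), measurable X -> (m1 \x m2)%E X = distribution P W' X.
  apply: product_measure_unique => A C mA mC.
  rewrite /m1 /m2 /distribution /= /pushforward /= -UV//.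
pose f := fun p : R * R => (p.1 * p.2)%:E.
have mf : measurable_fun setT f.
  by apply/measurable_EFinP; apply: measurable_funM; [exact: measurable_fst|exact: measurable_snd].
have iU1 : (\int[m1]_x (`|x|)%:E < +oo)%E.
  rewrite /m1 ge0_integral_distribution//=; last by apply/measurable_EFinP; exact: normr_measurable.
  by case/integrableP: iU.
have iV1 : (\int[m2]_x (`|x|)%:E < +oo)%E.
  rewrite /m2 ge0_integral_distribution//=; last by apply/measurable_EFinP; exact: normr_measurable.
  by case/integrableP: iV.
have mabs : measurable_fun [set: R] (fun y : R => (`|y|)%:E).
  by apply/measurable_EFinP; exact: normr_measurable.
have iv2 : (\int[m2]_y (`|y|)%:E)%E \is a fin_num.
  by rewrite ge0_fin_numE// integral_ge0.
have intf : (m1 \x m2)%E.-integrable setT f.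
  apply/integrable12ltyP => //.
  rewrite (eq_integral (fun x : R => (`|x|)%:E * \int[m2]_y (`|y|)%:E)%E); last first.
    move=> x _; rewrite -ge0_integralZl//; apply: eq_integral => y _.
    by rewrite /f /= normrM EFinM.
  rewrite /= ge0_integralZr//; last by rewrite integral_ge0.
  by rewrite lte_mul_pinfty ?integral_ge0// ge0_fin_numE// integral_ge0.
have iP : P.-integrable setT (f \o W').
  apply/integrableP; split; first exact: measurableT_comp.
  case/integrableP: intf => _.
  rewrite (eq_measure_integral (distribution P W')); last by move=> A mA _; exact: E.
  by rewrite ge0_integral_distribution//; exact: measurableT_comp.
split; first exact: iP.
have := integral12_prod_meas1 intf.
rewrite [X in _ = X -> _](eq_measure_integral (distribution P W')); last by move=> A mA _; exact: E.
rewrite [X in _ = X -> _]integral_distribution// => E1.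
rewrite /Rintegral; rewrite [X in fine X = _](_ : _ = \int[P]_x (f \o W') x)%E// -E1.
rewrite /fubini_F /f /=.
have mid : measurable_fun [set: R] (fun y : R => y%:E) by exact/measurable_EFinP.
have im2 : m2.-integrable setT (fun y : R => y%:E) by apply/integrableP.
have im1 : m1.-integrable setT (fun y : R => y%:E) by apply/integrableP.
have -> : (\int[P]_x (U x)%:E)%E = (\int[m1]_x x%:E)%E by rewrite /m1 integral_distribution.
have -> : (\int[P]_x (V x)%:E)%E = (\int[m2]_x x%:E)%E by rewrite /m2 integral_distribution.
rewrite -fineM; [|exact: integrable_fin_num..].
congr fine.
rewrite -[X in (_ * X)%E]fineK; last exact: integrable_fin_num.
rewrite -integralZr//; apply: eq_integral => x _.
rewrite fineK; last exact: integrable_fin_num.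
under eq_integral do rewrite EFinM.
by rewrite integralZl.
Qed.

Lemma rvm_measurable (F : R -> set (set Omega)) t (U : Omega -> R) :
  is_filtration F -> rv_measurable_wrt (F t) U -> measurable_fun setT U.
Proof.
move=> [_ [Fm _]] mU _ C mC; rewrite setTI; apply: Fm (mU _ mC).
Qed.

Lemma rvm_comp (G : set (set Omega)) (U : Omega -> R) (h : R -> R) :
  measurable_fun setT h -> rv_measurable_wrt G U -> rv_measurable_wrt G (h \o U).
Proof.
move=> mh mU C mC; rewrite comp_preimage; apply: mU.
by rewrite -[X in measurable X]setTI; exact: mh.
Qed.

(** Since [G] is a bare family of sets and not a measurable structure on [Omega], the pair is
    handled by hand: the sets whose preimage lies in [G] form a sigma-algebra containing the
    rectangles. *)
Lemma rvm_comp2 (G : set (set Omega)) (U V : Omega -> R) (h : R * R -> R) :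
  sigma_algebra setT G -> measurable_fun setT h ->
  rv_measurable_wrt G U -> rv_measurable_wrt G V ->
  rv_measurable_wrt G (fun w => h (U w, V w)).
Proof.
move=> sG mh mU mV C mC.
have mS : measurable (h @^-1` C) by rewrite -[X in measurable X]setTI; exact: mh.
rewrite -/(_ @^-1` _).
suff H S : measurable S -> G ((fun w => (U w, V w)) @^-1` S) by apply: (H _ mS).
rewrite measurable_prod_measurableType => /(_ [set S | G ((fun w => (U w, V w)) @^-1` S)]); apply.
split.
- case: sG => G0 GC GU; split.
  + by rewrite /= preimage_set0.
  + move=> A /= GA; rewrite setTD preimage_setC -setTD; exact: GC.
  + by move=> A /= GA; rewrite preimage_bigcup; exact: GU.
- move=> _ [A mA [B mB <-]] /=.
  have GI X Y : G X -> G Y -> G (X `&` Y).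
    by have /sigma_algebraP := sG; move=> /(_ (fun _ _ => @subsetT _ _))[] _ _ _; exact.
  exact: GI (mU _ mA) (mV _ mB).
Qed.
End indep.

(** * Moments of centred Gaussian variables *)

Section gauss_density.
Variable R : realType.

(** The Radon-Nikodym derivative of the normal law has the same integral as [normal_pdf] on every
    measurable set, so the two agree almost everywhere and the change of variables applies with the
    explicit density. *)
Lemma ge0_integral_normal_prob (s : R) (h : R -> \bar R) :
  measurable_fun [set: R] h -> (forall x, 0 <= h x)%E ->
  (\int[normal_prob 0 s]_x h x = \int[lebesgue_measure]_x (h x * (normal_pdf 0 s x)%:E))%E.
Proof.
move=> mh h0.
have dom := normal_prob_dominates (R:=R) 0 s.
have -> : (\int[normal_prob 0 s]_x h x)%E =
   (\int[lebesgue_measure]_x (h x * Radon_Nikodym_SigmaFinite.f (normal_prob 0 s)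
     (@lebesgue_measure R) x))%E.
  by rewrite Radon_Nikodym_SigmaFinite.change_of_variables.
apply: ae_eq_integral => //.
- apply: emeasurable_funM => //.
  exact: (measurable_int _ (Radon_Nikodym_SigmaFinite.f_integrable dom)).
- apply: emeasurable_funM => //; apply/measurable_EFinP; exact: measurable_normal_pdf.
- apply: ae_eqe_mul2l; apply: integral_ae_eq => //.
  + exact: Radon_Nikodym_SigmaFinite.f_integrable.
  + apply/measurable_EFinP; exact: measurable_normal_pdf.
  + by move=> E _ mE; rewrite -Radon_Nikodym_SigmaFinite.f_integral.
Qed.

(** Half of the Gaussian exponent pays for the polynomial. With u = x^2 / (4 s^2), the bound
    exp(u/2) >= 1 + u/2 gives u^2 exp(-u) <= 4, and the remaining factor exp(-u) is, up to sqrt 2,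
    the density with deviation sqrt 2 * s. The constant is 16 * 2 * 4, with sqrt 2 <= 2. *)
Lemma normal_prob_moment4 (s : R) : 0 < s ->
  (\int[normal_prob 0 s]_x (x ^+ 4)%:E <= (128 * s ^+ 4)%:E)%E.
Proof.
move=> s0; rewrite ge0_integral_normal_prob; last 2 first.
- by apply/measurable_EFinP; exact: measurable_funX.
- by move=> x; rewrite lee_fin -[4%N]/(2 * 2)%N exprM sqr_ge0.
pose s2 := Num.sqrt 2 * s.
have s20 : 0 < s2 by rewrite mulr_gt0// sqrtr_gt0.
have r2 : Num.sqrt 2 <= 2 :> R.
  by rewrite -[leRHS](ger0_norm (ler0n R 2)) -sqrtr_sqr ler_sqrt//; lra.
have H x : x ^+ 4 * normal_pdf 0 s x <= 128 * s ^+ 4 * normal_pdf 0 s2 x.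
  rewrite !normal_pdfE ?gt_eqF// /normal_fun !subr0.
  have -> : normal_peak s = Num.sqrt 2 * normal_peak s2.
    rewrite /normal_peak (_ : s2 ^+ 2 * pi *+ 2 = 2 * (s ^+ 2 * pi *+ 2)); last first.
      by rewrite /s2 exprMn sqr_sqrtr// -mulrA mulrnAr.
    by rewrite [in RHS]sqrtrM// invfM mulrA divff ?mul1r// gt_eqF// sqrtr_gt0.
  set u := x ^+ 2 / (s ^+ 2 *+ 4).
  have u0 : 0 <= u by rewrite divr_ge0 ?sqr_ge0// mulrn_wge0// sqr_ge0.
  have -> : - x ^+ 2 / (s ^+ 2 *+ 2) = - u - u by rewrite /u; field; rewrite gt_eqF.
  have -> : - x ^+ 2 / (s2 ^+ 2 *+ 2) = - u.
    rewrite /u /s2 exprMn sqr_sqrtr//; field; rewrite gt_eqF//.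
  have -> : x ^+ 4 = 16 * s ^+ 4 * u ^+ 2 by rewrite /u; field; rewrite gt_eqF.
  have eu : u ^+ 2 <= 4 * expR u.
    have -> : u = u / 2 + u / 2 by field.
    rewrite expRD; have := expR_ge1Dx (u / 2); nra.
  have eu2 : u ^+ 2 * expR (- u) <= 4.
    by rewrite expRN ler_pdivrMr ?expR_gt0.
  rewrite expRD.
  have p0 := normal_peak_ge0 s2.
  have e0 := expR_ge0 (- u).
  have -> : 16 * s ^+ 4 * u ^+ 2 * (Num.sqrt 2 * normal_peak s2 * (expR (- u) * expR (- u))) =
    (16 * s ^+ 4 * (normal_peak s2 * expR (- u))) * (Num.sqrt 2 * (u ^+ 2 * expR (- u))) by ring.
  have -> : 128 * s ^+ 4 * (normal_peak s2 * expR (- u))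
    = (16 * s ^+ 4 * (normal_peak s2 * expR (- u))) * (2 * 4) by ring.
  apply: ler_wpM2l; first by rewrite !mulr_ge0// ltW// exprn_gt0.
  by apply: (ler_pM _ _ r2 eu2); [exact: sqrtr_ge0|rewrite mulr_ge0// sqr_ge0].
have mp A u : measurable_fun A (EFin \o (normal_pdf 0 u) : R -> \bar R).
  by apply/measurable_EFinP; apply: measurable_funTS; exact: measurable_normal_pdf.
apply: (@le_trans _ _ (\int[lebesgue_measure]_x ((128 * s ^+ 4)%:E * (normal_pdf 0 s2 x)%:E))%E).
  apply: ge0_le_integral => //.
  - by move=> x _; rewrite -EFinM lee_fin mulr_ge0 ?normal_pdf_ge0// -[4%N]/(2 * 2)%N exprM sqr_ge0.
  - apply: emeasurable_funM; last exact: mp.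
    by apply/measurable_EFinP; exact: measurable_funX.
  - by apply: measurable_funeM; exact: mp.
  - by move=> x _; rewrite -!EFinM lee_fin.
rewrite integralZl//; last exact: integrable_normal_pdf.
by rewrite integral_normal_pdf mule1.
Qed.
End gauss_density.

Section gauss_moments.
Context d (Omega : measurableType d) (R : realType) (P : probability Omega R).
Implicit Types Y : Omega -> R.

(** The parameter s is the standard deviation, as in [normal_prob], not the variance. *)
Definition gaussian Y (s : R) := measurable_fun setT Y /\
  forall C : set R, measurable C -> P (Y @^-1` C) = normal_prob 0 s C.

Lemma gaussian_ge0_integral Y s (h : R -> \bar R) : gaussian Y s ->
  measurable_fun setT h -> (forall x, 0 <= h x)%E ->
  (\int[P]_w h (Y w) = \int[normal_prob 0 s]_x h x)%E.
Proof.
move=> [mY lY] mh h0.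
have mY' : measurable_fun setT (Y : Omega -> measurableTypeR R) by exact: mY.
pose Y' : {RV P >-> measurableTypeR R} := HB.pack (Y : Omega -> measurableTypeR R)
  (isMeasurableFun.Build _ _ _ _ (Y : Omega -> measurableTypeR R) mY').
rewrite -(ge0_integral_distribution Y')//.
by apply: eq_measure_integral => A mA _; exact: (lY A mA).
Qed.

Lemma bounded_integrable Y (M : R) : measurable_fun setT Y ->
  (forall w, `|Y w| <= M) -> P.-integrable setT (EFin \o Y).
Proof.
move=> mY YM; apply: (@le_integrable _ _ _ _ _ _ _ (cst M%:E)) => //.
- exact/measurable_EFinP.
- by move=> w _; rewrite /= lee_fin (le_trans (YM w)) ?ler_norm.
- exact: finite_measure_integrable_cst.
Qed.

Lemma dominated_integrable Y (Z : Omega -> R) : measurable_fun setT Y ->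
  (forall w, `|Y w| <= Z w) -> P.-integrable setT (EFin \o Z) ->
  P.-integrable setT (EFin \o Y).
Proof.
move=> mY YM; apply: le_integrable => //; first exact/measurable_EFinP.
by move=> w _; rewrite /= lee_fin (le_trans (YM w)) ?ler_norm.
Qed.

Lemma integrable_realcst (k : R) : P.-integrable setT (EFin \o (fun=> k)).
Proof. exact: finite_measure_integrable_cst. Qed.

Lemma integrable_realD (f g : Omega -> R) : P.-integrable setT (EFin \o f) ->
  P.-integrable setT (EFin \o g) -> P.-integrable setT (EFin \o (fun w => f w + g w)).
Proof. by move=> iF ig; exact: (integrableD _ iF ig). Qed.

Lemma integrable_realB (f g : Omega -> R) : P.-integrable setT (EFin \o f) ->
  P.-integrable setT (EFin \o g) -> P.-integrable setT (EFin \o (fun w => f w - g w)).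
Proof. by move=> iF ig; exact: (integrableB _ iF ig). Qed.

Lemma integrable_realZ (k : R) (f : Omega -> R) : P.-integrable setT (EFin \o f) ->
  P.-integrable setT (EFin \o (fun w => k * f w)).
Proof. by move=> iF; exact: (integrableZl _ k iF). Qed.

Lemma integrable_realsum (n : nat) (f : nat -> Omega -> R) :
  (forall i, (i < n)%N -> P.-integrable setT (EFin \o f i)) ->
  P.-integrable setT (EFin \o (fun w => \sum_(i < n) f i w)).
Proof.
elim: n => [|n IH] H.
  by under [X in EFin \o X]eq_fun do rewrite big_ord0; exact: integrable_realcst.
under [X in EFin \o X]eq_fun do rewrite big_ord_recr.
by apply: integrable_realD; [apply: IH => i ni; apply: H; exact: ltnW|exact: H].
Qed.

Lemma Rintegral_realsum (n : nat) (f : nat -> Omega -> R) :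
  (forall i, (i < n)%N -> P.-integrable setT (EFin \o f i)) ->
  \int[P]_w (\sum_(i < n) f i w) = \sum_(i < n) \int[P]_w (f i w).
Proof.
elim: n => [|n IH] H.
  rewrite big_ord0; under eq_Rintegral do rewrite big_ord0.
  by rewrite Rintegral_cst// mul0r.
under eq_Rintegral do rewrite big_ord_recr.
rewrite RintegralD//=; first by rewrite big_ord_recr/= IH// => i ni; apply: H; exact: ltnW.
- by apply: integrable_realsum => i ni; apply: H; exact: ltnW.
- exact: H.
Qed.

Lemma Rintegral_realcst (k : R) : \int[P]_w k = k.
Proof. by rewrite Rintegral_cst//= (_ : P _ = 1%E) ?mulr1// probability_setT. Qed.

Lemma gaussian_moment4 Y s : 0 < s -> gaussian Y s ->
  P.-integrable setT (EFin \o (fun w => Y w ^+ 4)) /\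
  \int[P]_w (Y w ^+ 4) <= 128 * s ^+ 4.
Proof.
move=> s0 gY; have := normal_prob_moment4 s0.
have x4 (x : R) : 0 <= x ^+ 4 by rewrite -[4%N]/(2 * 2)%N exprM sqr_ge0.
rewrite -(gaussian_ge0_integral gY); last 2 first.
- by apply/measurable_EFinP; exact: measurable_funX.
- by move=> x; rewrite lee_fin.
move=> H.
have iY : P.-integrable setT (EFin \o (fun w => Y w ^+ 4)).
  apply/integrableP; split.
    by apply/measurable_EFinP; apply: measurable_funX; case: gY.
  under eq_integral do rewrite /= ger0_norm//.
  by apply: le_lt_trans H _; rewrite ltry.
split=> //; rewrite /Rintegral -lee_fin fineK//.
exact: integrable_fin_num iY.
Qed.

(** Y and -Y have the same law, so the mean equals its opposite. *)
Lemma gaussian_mean Y s : 0 < s -> gaussian Y s ->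
  P.-integrable setT (EFin \o Y) -> \int[P]_w Y w = 0.
Proof.
move=> s0 [mY lY] iY.
pose Y' : {RV P >-> R} := HB.pack Y (isMeasurableFun.Build _ _ _ _ Y mY).
have mZ : measurable_fun setT (fun w => - Y w) by exact: measurableT_comp.
pose Z' : {RV P >-> R} := HB.pack (fun w => - Y w) (isMeasurableFun.Build _ _ _ _ (fun w => - Y w) mZ).
have mid : measurable_fun [set: R] (fun y : R => y%:E) by exact/measurable_EFinP.
have E : (\int[P]_w (Y w)%:E = \int[P]_w (- Y w)%:E)%E.
  rewrite -[LHS](integral_distribution (X := Y') (f := fun y => y%:E))//.
  have -> : (\int[P]_w (- Y w)%:E)%E = (\int[distribution P Z']_y y%:E)%E.
    rewrite (integral_distribution (X := Z') (f := fun y => y%:E))//.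
    exact: (integrableN iY).
  apply: eq_measure_integral => A mA _ /=.
  rewrite /distribution /pushforward /=.
  have mA' : measurable ((-%R : R -> R) @^-1` A).
    by rewrite -[X in measurable X]setTI; exact: (@measurable_funN _ _ R setT id).
  rewrite [LHS]lY// -[LHS]normal_probN ?gt_eqF// -lY//.
have := E; rewrite /Rintegral => /(congr1 fine).
rewrite (_ : (\int[P]_w (- Y w)%:E)%E = - (\int[P]_w (Y w)%:E))%E; last first.
  by rewrite -[RHS]integralN// integrable_add_def.
rewrite fineN; lra.
Qed.


(** Only the event Y > s is used: there Y^2 >= s^2, and after scaling its probability is that of a
    standard normal exceeding 1. The witness is the value of [normal_tail_lb] at a = 1, the same for
    all Y and s. *)
Lemma gaussian_moment2_lb : exists2 c : R, 0 < c & forall Y s, 0 < s -> gaussian Y s ->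
  c * s ^+ 2 <= \int[P]_w (Y w ^+ 2).
Proof.
exists (normal_peak 1 * expR (- 2 ^+ 2 / 2)).
  by rewrite mulr_gt0 ?expR_gt0 ?normal_peak_gt0.
move=> Y s s0 gY; have [i4 _] := gaussian_moment4 s0 gY.
have [mY lY] := gY.
have i2 : P.-integrable setT (EFin \o (fun w => Y w ^+ 2)).
  apply: (@dominated_integrable _ (fun w => 1 + Y w ^+ 4)).
  - exact: measurable_funX.
  - by move=> w; rewrite ger0_norm ?sqr_ge0//; nra.
  - by apply: integrable_realD => //; exact: integrable_realcst.
rewrite -lee_fin /Rintegral fineK; last exact: (integrable_fin_num _ i2).
have mA : measurable ((Y @^-1` `]s, +oo[%classic) : set Omega).
  by rewrite -[X in measurable X]setTI; exact: mY.
apply: (@le_trans _ _ (\int[P]_(w in Y @^-1` `]s, +oo[%classic) (s ^+ 2)%:E)%E).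
  rewrite integral_cst//= lY// normal_prob_scale//.
  rewrite (_ : _ @^-1` _ = `]1, +oo[%classic); last first.
    by apply/seteqP; split => x /=; rewrite !in_itv/= !andbT; nra.
  rewrite mulrC EFinM; apply: lee_wpmul2l; first by rewrite lee_fin sqr_ge0.
  by rewrite (le_trans _ (normal_tail_lb ler01)).
apply: (@le_trans _ _ (\int[P]_(w in Y @^-1` `]s, +oo[%classic) (Y w ^+ 2)%:E)%E).
  apply: ge0_le_integral => //.
  - by move=> w _; rewrite lee_fin sqr_ge0.
  - by apply: measurable_funTS; case/integrableP: i2.
  - move=> w /=; rewrite in_itv/= andbT lee_fin => sY; nra.
apply: ge0_subset_integral => //; first by case/integrableP: i2.
by move=> w _; rewrite lee_fin sqr_ge0.
Qed.
End gauss_moments.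

(** * Brownian motion: maximal inequality and law of the iterated logarithm *)

Section path_continuity.
Variable R : realType.
Implicit Types (f : R -> R) (A : set R).

Lemma within_continuous_dist A f : {within A, continuous f} -> forall x, A x ->
  forall e, 0 < e -> exists2 d, 0 < d & forall y, A y -> `|y - x| < d -> `|f y - f x| < e.
Proof.
move=> /subspace_continuousP cf x Ax e e0.
have /cvgrPdist_lt/(_ _ e0) := cf x Ax.
rewrite near_withinE => /nbhs_ballP[d /= d0 H]; exists d => // y Ay yx.
by rewrite distrC; apply: H => //; rewrite /ball /= distrC.
Qed.

(** Heine's theorem, from compactness in its near-covering form: the radius runs along the filter at
    0 from the right, and the covering property yields one radius for all base points. *)
Lemma segment_unif_continuous (a b : R) f : {within `[a, b], continuous f} ->
  forall e, 0 < e -> exists2 d, 0 < d & forall x y, a <= x <= b -> a <= y <= b ->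
    `|y - x| < d -> `|f y - f x| < e.
Proof.
move=> cf e e0.
have /compact_near_coveringP := @segment_compact R a b.
move=> /(_ R (0^'+) (fun (d x : R) => forall y,
  a <= x <= b -> a <= y <= b -> `|y - x| < d -> `|f y - f x| < e)).
case.
  move=> x xab; have e2 : 0 < e / 2 by rewrite divr_gt0.
  have [d d0 H] := within_continuous_dist cf xab e2.
  have d2 : 0 < d / 2 by rewrite divr_gt0.
  near=> x' u => y x'ab yab yx'.
  have x'x : `|x' - x| < d / 2.
    by near: x'; apply/nbhs_ballP; exists (d / 2) => //= z; rewrite /ball/= distrC.
  have ud : u < d / 2 by near: u; apply: nbhs_right_lt.
  have H1 := H x' _ (lt_trans x'x _); have H2 := H y _ _.
  have -> : f y - f x' = (f y - f x) - (f x' - f x) by ring.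
  rewrite (le_lt_trans (ler_normB _ _))//.
  rewrite [e]splitr ltrD//; [apply: H2; rewrite /= ?in_itv//|apply: H1; rewrite /= ?in_itv//; lra].
  have -> : y - x = (y - x') + (x' - x) by ring.
  by rewrite (le_lt_trans (ler_normD _ _))// [d]splitr ltrD// (lt_trans yx').
move=> d /= d0 H; exists (d / 2); first by rewrite divr_gt0.
move=> x y xab yab yx; apply: (H (d / 2)) => //=.
- by rewrite sub0r normrN gtr0_norm ?divr_gt0//; lra.
- by rewrite divr_gt0.
Unshelve. all: by end_near. Qed.
End path_continuity.

Section sigma_algebra_closure.
Context (T : Type) (G : set (set T)).
Hypothesis sG : sigma_algebra setT G.

Lemma sigma_algebraC A : G A -> G (~` A).
Proof. by case: sG => _ h _ /h; rewrite setTD. Qed.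

Lemma sigma_algebraU A B : G A -> G B -> G (A `|` B).
Proof.
case: sG => _ _ h GA GB; rewrite -bigcup2E; apply: h => -[|[|n]]//=.
by case: sG.
Qed.

Lemma sigma_algebraI A B : G A -> G B -> G (A `&` B).
Proof.
by move=> GA GB; rewrite -[A `&` B]setCK setCI; apply: sigma_algebraC; apply: sigma_algebraU;
  exact: sigma_algebraC.
Qed.
End sigma_algebra_closure.

(** * The two Borel-Cantelli lemmas, in almost sure form *)

Section borel_cantelli.
Context d (Omega : measurableType d) (R : realType) (P : probability Omega R).
Implicit Types E : nat -> set Omega.

Lemma probability_fineK A : measurable A -> (fine (P A))%:E = P A.
Proof. by move=> mA; rewrite fineK// fin_num_measure. Qed.

Lemma fine_probability_ge0 A : 0 <= fine (P A).
Proof. by rewrite fine_ge0. Qed.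

Lemma fine_probabilityC A : measurable A -> fine (P (~` A)) = 1 - fine (P A).
Proof.
by move=> mA; rewrite probability_setC// fineB// fin_num_measure.
Qed.

Lemma le_fine_probability A C : measurable A -> measurable C -> A `<=` C ->
  fine (P A) <= fine (P C).
Proof.
by move=> mA mC AC; rewrite -lee_fin !probability_fineK// le_measure ?inE.
Qed.

(** The limsup set of the events shifted by [n0] is null, since their probabilities have bounded
    partial sums; the shift is there because the bound holds only from [n0] on. *)
Lemma borel_cantelli_ae E (u : nat -> R) (K : R) n0 : (forall n, measurable (E n)) ->
  (forall n, 0 <= u n) ->
  (forall n, (n0 <= n)%N -> (P (E n) <= (u n)%:E)%E) ->
  (forall N, \sum_(n < N) u n <= K) ->
  {ae P, forall w, exists n1, forall n, (n1 <= n)%N -> ~ E n w}.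
Proof.
move=> mE u0 PE uK.
have mEs k : measurable (E (k + n0)%N) by [].
have : P (lim_sup_set (fun k => E (k + n0)%N)) = 0%E.
  apply: lim_sup_set_cvg0 => //.
  apply: (@le_lt_trans _ _ K%:E); last by rewrite ltry.
  apply: lime_le; first exact: is_cvg_nneseries.
  apply: nearW => N /=.
  apply: (@le_trans _ _ (\sum_(0 <= k < N) (u (k + n0)%N)%:E)%E).
    by apply: lee_sum => k _; apply: PE; rewrite leq_addl.
  rewrite sumEFin lee_fin (le_trans _ (uK (N + n0)%N))//.
  rewrite -(big_mkord xpredT u).
  have -> : \sum_(0 <= i < N + n0) u i = \sum_(0 <= i < n0) u i + \sum_(n0 <= i < N + n0) u i.
    by rewrite -big_cat_nat ?leq_addl.
  rewrite -[X in \sum_(X <= _ < _ + _) u _]add0n big_addn addnK lerDr.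
  by apply: sumr_ge0.
move=> PS0; exists (lim_sup_set (fun k => E (k + n0)%N)); split => //.
  by apply: bigcap_measurable; [by exists 0%N|move=> k _; apply: bigcup_measurable].
move=> w /= nH n _ /=; apply: contrapT => nE; apply: nH.
exists (n + n0)%N => m nm Em; apply: nE; exists (m - n0)%N => /=;
  first by rewrite leq_subRL ?(leq_trans (leq_addl _ _) nm)// addnC.
by rewrite subnK// (leq_trans (leq_addl _ _) nm).
Qed.

(** Independence enters only as the factorization of one more complement from the previous ones,
    which is what adaptedness supplies for increments. It turns the probability that none of the
    events from m to N - 1 occurs into a product of factors 1 - P (E n) <= exp(- u n), which tends
    to 0. *)
Lemma borel_cantelli2_ae E (u : nat -> R) n0 : (forall n, measurable (E n)) ->
  (forall n, (n0 <= n)%N -> 0 <= u n) ->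
  (forall n, (n0 <= n)%N -> ((u n)%:E <= P (E n))%E) ->
  (forall m n, (n0 <= m)%N -> (m <= n)%N -> P ((\big[setI/setT]_(m <= k < n) ~` E k) `&` ~` E n) =
     (P (\big[setI/setT]_(m <= k < n) ~` E k) * P (~` E n))%E) ->
  (forall m K, exists N, K <= \sum_(m <= n < N) u n) ->
  {ae P, forall w, forall m, exists2 n, (m <= n)%N & E n w}.
Proof.
move=> mE u0 PE ind uoo.
suff H m : (n0 <= m)%N -> P (\bigcap_(k >= m) ~` E k) = 0%E.
  have mB m : measurable (\bigcap_(k >= m) ~` E k).
    by apply: bigcap_measurable; [by exists m => /=|move=> k _; exact: measurableC].
  exists (\bigcup_m \bigcap_(k in [set k | (m + n0 <= k)%N]) ~` E k); split.
  - by apply: bigcup_measurable => m _; exact: mB.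
  - apply/negligibleP; first by apply: bigcup_measurable => m _; exact: mB.
    apply: negligible_bigcup => m; apply/negligibleP; first exact: mB.
    by apply: H; rewrite leq_addl.
  - move=> w /= /existsNP[m nH]; exists m => // k /= mk Ek; apply: nH; exists k => //.
    by rewrite (leq_trans _ mk)// leq_addr.
move=> n0m.
have mI N : measurable (\big[setI/setT]_(m <= k < N) ~` E k).
  by apply: big_ind => //; [move=> A C; exact: measurableI|move=> i _; exact: measurableC].
have bound N : (m <= N)%N -> fine (P (\big[setI/setT]_(m <= k < N) ~` E k))
  <= expR (- \sum_(m <= n < N) u n).
  elim: N => [|N IH].
    by rewrite leqn0 => /eqP ->; rewrite !big_geq// probability_setT oppr0 expR0.
  rewrite leq_eqVlt => /predU1P[->|].
    by rewrite !big_geq// probability_setT oppr0 expR0.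
  rewrite ltnS => mN; rewrite !big_nat_recr//= ind// fineM ?fin_num_measure//;
    [|exact: measurableC]; rewrite opprD expRD.
  apply: ler_pM; rewrite ?fine_probability_ge0//; first exact: IH.
  rewrite fine_probabilityC// (le_trans _ (expR_ge1Dx _))// lerD2l lerN2.
  by rewrite -lee_fin probability_fineK// PE// (leq_trans n0m).
apply/eqP; rewrite eq_le measure_ge0 andbT; apply/lee_addgt0Pr => e e0; rewrite add0e.
have [N HN] := uoo m (- ln e).
have [Nm|mN] := leqP N m.
  rewrite big_geq// in HN.
  apply: (@le_trans _ _ 1%E); first by apply: probability_le1; apply: bigcap_measurable;
    [by exists m => /=|move=> k _; exact: measurableC].
  by rewrite lee_fin leNgt; apply/negP => e1; have := ln_lt0 (introT andP (conj e0 e1)); lra.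
apply: (@le_trans _ _ (P (\big[setI/setT]_(m <= k < N) ~` E k))).
  apply: le_measure; rewrite ?inE//.
    by apply: bigcap_measurable; [by exists m => /=|move=> k _; exact: measurableC].
  rewrite -bigcap_seq => w Hw k /=; rewrite mem_index_iota => /andP[mk kN]; exact: Hw.
rewrite -probability_fineK// lee_fin (le_trans (bound _ (ltnW mN)))//.
by rewrite -[leRHS]lnK ?posrE// ler_expR; lra.
Qed.
End borel_cantelli.

Section brownian.
Context d (Omega : measurableType d) (R : realType) (P : probability Omega R)
  (F : R -> set (set Omega)) (B : R -> Omega -> R).
Hypotheses (hF : is_filtration F) (hB : is_F_brownian P F B).

Let sF t : sigma_algebra setT (F t). Proof. by case: hF. Qed.
Let mF t A : F t A -> measurable A. Proof. by case: hF => _ [h _]; exact: h. Qed.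
Let leF s t A : s <= t -> F s A -> F t A. Proof. by case: hF => _ [_ h] st; exact: h. Qed.
Let adB t : 0 <= t -> rv_measurable_wrt (F t) (B t). Proof. by case: hB => h _; exact: h. Qed.

Lemma brownian_measurable t : 0 <= t -> measurable_fun setT (B t).
Proof. by move=> t0; apply: (rvm_measurable hF (adB t0)). Qed.

Lemma rvm_le s t (Y : Omega -> R) : s <= t -> rv_measurable_wrt (F s) Y -> rv_measurable_wrt (F t) Y.
Proof. by move=> st mY C mC; apply: leF st (mY _ mC). Qed.

Lemma rvm_sub t (Y Z : Omega -> R) : rv_measurable_wrt (F t) Y -> rv_measurable_wrt (F t) Z ->
  rv_measurable_wrt (F t) (fun w => Y w - Z w).
Proof.
move=> mY mZ; apply: (@rvm_comp2 _ _ _ _ _ _ (fun p => p.1 - p.2)) => //.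
by apply: measurable_funB; [exact: measurable_fst|exact: measurable_snd].
Qed.

Lemma brownian_increment s t : 0 <= s -> s < t ->
  gaussian P (fun w => B t w - B s w) (Num.sqrt (t - s)).
Proof.
move=> s0 st; split; last by case: hB => _ [_ [_ /(_ s t s0 st)[]]].
by apply: measurable_funB; apply: brownian_measurable => //; rewrite (le_trans s0)// ltW.
Qed.

Lemma brownian_indep s t : 0 <= s -> s < t -> indep_of P (F s) (fun w => B t w - B s w).
Proof. by move=> s0 st; case: hB => _ [_ [_ /(_ s t s0 st)[]]]. Qed.

(** The definition prescribes the law of B t - B 0, and B 0 = 0 holds only almost surely; the two
    preimages differ inside a null set. *)
Lemma brownian_gaussian t : 0 < t -> gaussian P (B t) (Num.sqrt t).
Proof.
move=> t0; have [m0 l0] := brownian_increment (lexx 0) t0.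
split; first by apply: brownian_measurable; exact: ltW.
move=> C mC; rewrite -[X in Num.sqrt X]subr0 -l0//.
have [_ [[N [mN PN HN]] _]] := hB.
have mA : measurable (B t @^-1` C) by apply: mF (adB (ltW t0) mC).
have mA' : measurable ((fun w => B t w - B 0 w) @^-1` C).
  by rewrite -[X in measurable X]setTI; exact: m0.
have H A A' : measurable A -> measurable A' -> A `<=` A' `|` N -> (P A <= P A')%E.
  move=> mA1 mA2 AA; apply: (@le_trans _ _ (P (A' `|` N))).
    by apply: le_measure; rewrite ?inE//; exact: measurableU.
  apply: le_trans (measureU2 _ mA2 mN) _.
  rewrite -[leRHS]adde0; apply: leeD => //.
  by have -> : (P N <= 0)%E by rewrite PN.
have HN' w : ~ N w -> B 0 w = 0 by move=> nN; apply: contrapT => h; exact: nN (HN _ h).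
apply/eqP; rewrite eq_le; apply/andP; split; apply: H => // w /= Cw.
- have [Nw|nN] := pselect (N w); first by right.
  by left; rewrite HN'// subr0.
- have [Nw|nN] := pselect (N w); first by right.
  by left; rewrite HN'// subr0 in Cw.
Qed.

Lemma gaussian_ge0_half (Y : Omega -> R) s : 0 < s -> gaussian P Y s ->
  2^-1 <= fine (P (Y @^-1` `[0, +oo[)).
Proof.
move=> s0 [mY lY].
have E : P (Y @^-1` `[0, +oo[) = P (Y @^-1` `]-oo, 0]).
  rewrite !lY// -[LHS]normal_probN ?gt_eqF//; congr (normal_prob _ _ _).
  by apply/seteqP; split => x /=; rewrite !in_itv/= andbT; lra.
have mS (C : set R) : measurable C -> measurable (Y @^-1` C).
  by move=> mC; rewrite -[X in measurable X]setTI; exact: mY.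
have : 1 <= fine (P (Y @^-1` `[0, +oo[)) + fine (P (Y @^-1` `]-oo, 0])).
  rewrite -lee_fin EFinD !probability_fineK; [|exact: mS..].
  rewrite -(probability_setT P) (le_trans _ (measureU2 _ _ _))//; [|exact: mS..].
  apply: le_measure; rewrite ?inE//; first by apply: measurableU; exact: mS.
  by move=> w _ /=; rewrite !in_itv/= andbT; case: (leP 0 (Y w)) => [|/ltW]; [left|right].
rewrite E; lra.
Qed.

(* Reflection principle on a finite grid: after the first grid time at which B exceeds a, the
   independent increment up to T is nonnegative with probability at least 1/2. *)
Lemma max_grid (T a : R) (t : nat -> R) n : (forall i, 0 <= t i <= T) ->
  {homo t : i j / (i <= j)%N >-> i <= j} ->
  fine (P (\big[setU/set0]_(i < n) (B (t i) @^-1` `]a, +oo[))) <=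
  2 * fine (P (B T @^-1` `]a, +oo[)).
Proof.
move=> t0T tmono.
have tT i : t i <= T by have /andP[] := t0T i.
have t0 i : 0 <= t i by have /andP[] := t0T i.
have T0 : 0 <= T := le_trans (t0 0%N) (tT 0%N).
set D := B T @^-1` _.
have FA i : F (t i) (B (t i) @^-1` `]a, +oo[) by exact: (adB (t0 i)).
have mD : measurable D by apply: (mF (t := T)); exact: (adB T0).
pose A n := \big[setU/set0]_(i < n) (B (t i) @^-1` `]a, +oo[).
have FAn m k : (forall i, (i < m)%N -> (i <= k)%N) -> F (t k) (A m).
  elim: m => [|m IH] H; first by rewrite /A big_ord0; case: (sF (t k)).
  rewrite /A big_ord_recr; apply: sigma_algebraU => //.
    by apply: IH => i im; apply: H; rewrite ltnW.
  by apply: leF (FA m); apply: tmono; exact: H.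
have mA m : measurable (A m) by apply: (mF (t := t m)); apply: FAn => i /ltnW.
(* Intersecting with D makes the inequality additive over first-passage times, so it can be proved
   by induction on the number of grid points. *)
suff : fine (P (A n)) <= 2 * fine (P (A n `&` D)).
  move=> h; apply: (le_trans h); rewrite ler_pM2l//; apply: le_fine_probability => //.
  exact: measurableI.
elim: n => [|n IH].
  by rewrite /A big_ord0 set0I measure0 mulr0.
have -> : A n.+1 = A n `|` (~` A n `&` (B (t n) @^-1` `]a, +oo[)).
  rewrite /A big_ord_recr -/(A n) setUIr setUCr setTI//.
(* E says that the grid time of index n is the first passage above a; it belongs to F (t n), hence
   is independent of the increment up to T. *)
set E := ~` A n `&` _.
have FE : F (t n) E.
  apply: (sigma_algebraI (sF _)); last exact: FA.
  by apply: (sigma_algebraC (sF _)); apply: FAn => i /ltnW.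
have mE := mF FE.
have mAD := measurableI _ _ (mA n) mD; have mED := measurableI _ _ mE mD.
have AE0 : A n `&` E = set0 by rewrite /E setIA setICr set0I.
rewrite setIUl measureU// [X in _ <= 2 * fine X]measureU//; last first.
  by rewrite setIACA AE0 set0I.
rewrite !fineD ?fin_num_measure// mulrDr lerD//.
have [tn|tn] := eqVneq (t n) T.
  have -> : E `&` D = E by rewrite setIidl// => w [_]; rewrite tn.
  by have := fine_probability_ge0 P E; lra.
have tnT : t n < T by rewrite lt_neqAle tn tT.
set Y := fun w => B T w - B (t n) w.
have gY := brownian_increment (t0 n) tnT.
have s0 : 0 < Num.sqrt (T - t n) by rewrite sqrtr_gt0 subr_gt0.
have h2 := gaussian_ge0_half s0 gY.
have mY : measurable (Y @^-1` `[0, +oo[).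
  by rewrite -[X in measurable X]setTI; case: gY => + _; apply.
have := le_fine_probability P (measurableI _ _ mE mY) mED.
rewrite (brownian_indep (t0 n) tnT FE)// fineM ?fin_num_measure// => H.
have {}H := H _.
have e0 := fine_probability_ge0 P E.
suff : fine (P E) * fine (P (Y @^-1` `[0, +oo[)) <= fine (P (E `&` D)) by nra.
apply: H => w [Ew] /=; rewrite in_itv/= andbT /Y => Yw; split => //.
by case: Ew => _ /=; rewrite /D /= !in_itv/= !andbT; lra.
Qed.

Definition cont_path w := {within `[0, +oo[, continuous (fun t => B t w)}.

Lemma max_ineq (T a : R) : 0 < T -> 0 <= a -> exists G : set Omega,
  [/\ measurable G, (P G <= (2 * expR (- a ^+ 2 / (2 * T)))%:E)%E &
   forall w, cont_path w -> (exists2 s, 0 <= s <= T & a < B s w) -> G w].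
Proof.
move=> T0 a0.
(* The minimum freezes the grid at T beyond the index 2^k, so that [max_grid], stated for infinite
   sequences of times in [0, T], applies. *)
pose t k i : R := (minn i (2 ^ k))%:R / (2 ^ k)%:R * T.
have e2 k : 0 < (2 ^ k)%:R :> R by rewrite ltr0n expn_gt0.
have t0T k i : 0 <= t k i <= T.
  rewrite /t; apply/andP; split; first by rewrite mulr_ge0 ?divr_ge0// ltW.
  rewrite -[leRHS]mul1r ler_pM2r// ler_pdivrMr// mul1r ler_nat geq_minr//.
have tmono k : {homo t k : i j / (i <= j)%N >-> i <= j}.
  move=> i j ij; rewrite /t ler_pM2r// ler_pM2r ?invr_gt0// ler_nat.
  by rewrite leq_min geq_minr andbT (leq_trans (geq_minl _ _)).
pose A k := \big[setU/set0]_(i < (2 ^ k).+1) (B (t k i) @^-1` `]a, +oo[).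
have mA k : measurable (A k).
  apply: bigsetU_measurable => i _; apply: (mF (t := t k i)); apply: adB => //.
  by have /andP[] := t0T k i.
have PA k : fine (P (A k)) <= 2 * fine (P (B T @^-1` `]a, +oo[)).
  exact: max_grid.
have AP k w : A k w <-> exists2 i, (i <= 2 ^ k)%N & a < B (t k i) w.
  have -> : A k = \bigcup_(i in `I_(2 ^ k).+1) (B (t k i) @^-1` `]a, +oo[).
    by rewrite bigcup_mkord.
  split.
  - by move=> [i /=]; rewrite ltnS in_itv/= andbT => ik ai; exists i.
  - by move=> [i ik ai]; exists i => //=; rewrite in_itv/= andbT.
exists (\bigcup_k A k); split.
- exact: bigcup_measurable.
- have ndA : {homo A : n m / (n <= m)%N >-> (n <= m)%O}.
    apply: homo_leq; [move=> x|move=> x y z|]; [exact: lexx|exact: le_trans|].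
    move=> k; apply/subsetPset => w /AP[i ik ai]; apply/AP; exists (2 * i)%N.
      by rewrite expnS leq_mul2l.
    have <- : t k i = t k.+1 (2 * i)%N; last by [].
    rewrite /t expnS -minnMr !natrM; field.
    by rewrite natrX expf_neq0// pnatr_eq0.
  have cv := nondecreasing_cvg_mu (mu := P) mA (bigcup_measurable (fun k _ => mA k)) ndA.
  rewrite -(cvg_lim _ cv)//; apply: lime_le; first by apply/cvg_ex; exists (P (\bigcup_k A k)).
  apply: nearW => k /=; rewrite -probability_fineK// lee_fin (le_trans (PA k))// ler_pM2l//.
  rewrite -lee_fin probability_fineK; last by apply: (mF (t := T)); apply: adB => //; exact: ltW.
  have [_ ->//] := brownian_gaussian T0.
  rewrite (le_trans (normal_tail_ub _ a0)) ?sqrtr_gt0//.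
  by rewrite (sqr_sqrtr (ltW T0)) lee_fin ler_expR -mulr_natl.
- move=> w cw [s /andP[s0 sT] as_].
  have e0 : 0 < B s w - a by rewrite subr_gt0.
  have [d0 d00 H] := within_continuous_dist cw (x := s) (ltac:(by rewrite /= in_itv/= s0)) e0.
  have [k Hk] : exists k, T / d0 < (2 ^ k)%:R.
    exists (Num.truncn (T / d0)).+1; rewrite (lt_le_trans (truncnS_gt _))// ler_nat ltnW//
      ltn_expl//.
  exists k => //; apply/AP.
  have q0 : 0 <= s / T * (2 ^ k)%:R by rewrite mulr_ge0 ?divr_ge0// ltW.
  (* The last grid time not after s; it lies within T / 2^k < d0 of s. *)
  pose i := Num.truncn (s / T * (2 ^ k)%:R).
  have /andP[i1 i2] := truncn_itv q0; rewrite -/i in i1 i2.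
  have ik : (i <= 2 ^ k)%N.
    rewrite -(ler_nat R) (le_trans i1)// -[leRHS]mul1r ler_pM2r// ler_pdivrMr// mul1r//.
  exists i => //.
  have tE : t k i = i%:R / (2 ^ k)%:R * T by rewrite /t (minn_idPl ik).
  have s1 : t k i <= s.
    rewrite tE -ler_pdivlMr// ler_pdivrMr//.
  have s2 : s - t k i < d0.
    have : s < (i.+1)%:R / (2 ^ k)%:R * T by rewrite -ltr_pdivrMr// ltr_pdivlMr//.
    rewrite -natr1 mulrDl mulrDl -tE div1r.
    have : (2 ^ k)%:R^-1 * T < d0.
      by rewrite mulrC ltr_pdivrMr// mulrC -ltr_pdivrMr.
    lra.
  have /andP[t0 _] := t0T k i.
  have : `|t k i - s| < d0 by rewrite distrC ger0_norm ?subr_ge0.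
  move=> /(H _ _); rewrite /= in_itv/= t0 => /(_ isT); rewrite ltr_norml; lra.
Qed.
End brownian.

Section brownian_opp.
Context d (Omega : measurableType d) (R : realType) (P : probability Omega R)
  (F : R -> set (set Omega)) (B : R -> Omega -> R).

Lemma brownian_opp : is_F_brownian P F B -> is_F_brownian P F (fun t w => - B t w).
Proof.
move=> [ad [B0 [cB inc]]]; split; [|split; [|split]].
- move=> t t0; apply: (@rvm_comp _ _ _ _ _ -%R) => //; exact: ad.
- by apply: filterS B0 => w ->; rewrite oppr0.
- apply: filterS cB => w /subspace_continuousP cw; apply/subspace_continuousP => x xA; apply: cvgN; exact: cw.
- move=> s t s0 st; have [ind law] := inc s t s0 st.
  have E : (fun w => - B t w - - B s w) = (fun w => - (B t w - B s w)).
    by apply/funext => w; ring.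
  have mo C : measurable C -> measurable ((-%R : R -> R) @^-1` C).
    by move=> mC; rewrite -[X in measurable X]setTI; exact: (@measurable_funN _ _ R setT id).
  have pe C : (fun w => - B t w - - B s w) @^-1` C = (fun w => B t w - B s w) @^-1` (-%R @^-1` C).
    by rewrite E.
  split.
    by move=> A C FA mC; rewrite pe; apply: ind => //; exact: mo.
  move=> C mC; rewrite pe law; last exact: mo.
  by apply: normal_probN => //; rewrite gt_eqF// sqrtr_gt0 subr_gt0.
Qed.
End brownian_opp.

(** * Comparison series and the normalizing function of the iterated logarithm *)

Section series_bound.
Variable R : realType.

(** The terms are n^(-p) for n >= 1, and the term n = 0 equals 1 because [ln 0 = 0]. Each term from
    n = 2 on is dominated by a difference of the telescoping sequence v n = (n + 1)^(-(p - 1)),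
    divided by p - 1; the terms n = 0 and n = 1 account for the 2 in the bound. *)
Lemma sum_expR_ln_bounded (p : R) : 1 < p ->
  exists K, forall N, \sum_(n < N) expR (- (p * ln (n%:R : R))) <= K.
Proof.
move=> p1; pose v n := expR (- ((p - 1) * ln ((n.+1)%:R : R))).
have p10 : 0 < p - 1 by rewrite subr_gt0.
have step n : expR (- (p * ln ((n.+2)%:R : R))) <= (v n - v n.+1) / (p - 1).
  rewrite ler_pdivlMr//.
  set x : R := (n.+1)%:R; set y : R := (n.+2)%:R.
  have x0 : 0 < x by rewrite ltr0n.
  have y0 : 0 < y by rewrite ltr0n.
  have yx : y = x + 1 by rewrite /x /y [in LHS]mulrSr.
  have l : ln x - ln y <= - y^-1.
    rewrite -ln_div ?posrE//; have -> : x / y = 1 + (- y^-1) by rewrite (_ : x = y - 1)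
      ?yx ?addrK// -yx; field; exact: lt0r_neq0.
    apply: le_ln1Dx; rewrite ltrN2 invf_lt1// yx; lra.
  have -> : v n = v n.+1 * expR ((p - 1) * (ln y - ln x)).
    by rewrite -expRD; congr expR; rewrite -/x -/y; ring.
  have -> : expR (- (p * ln y)) = v n.+1 / y.
    rewrite -[X in _ / X](lnK (x:=y)) ?posrE// -expRN -expRD; congr expR; rewrite -/y; ring.
  have v0 : 0 < v n.+1 by exact: expR_gt0.
  have := expR_ge1Dx ((p - 1) * (ln y - ln x)).
  have h : (p - 1) * y^-1 <= (p - 1) * (ln y - ln x) by rewrite ler_pM2l// -lerN2 opprB.
  set z := expR _ => h'.
  have -> : v n.+1 * z - v n.+1 = v n.+1 * (z - 1) by ring.
  have -> : v n.+1 / y * (p - 1) = v n.+1 * ((p - 1) / y) by ring.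
  by rewrite ler_pM2l// lerBrDl (le_trans _ h')// lerD2l.
exists (2 + (p - 1)^-1) => N.
have H N' : \sum_(n < N'.+2) expR (- (p * ln (n%:R : R))) <= 2 + (1 - v N') / (p - 1).
  elim: N' => [|n IH].
    by rewrite !big_ord_recr big_ord0/= ln0// ln1 mulr0 oppr0 expR0 /v ln1 mulr0 oppr0 expR0; lra.
  rewrite big_ord_recr/= (le_trans (lerD IH (step n)))// -addrA -mulrDl;
    rewrite lerD2l ler_pM2r ?invr_gt0//; lra.
have H' : \sum_(n < N.+2) expR (- (p * ln (n%:R : R))) <= 2 + (p - 1)^-1.
  apply: (le_trans (H N)); rewrite lerD2l ler_pdivrMr// mulVf ?gt_eqF//.
  by have := expR_ge0 (- ((p - 1) * ln ((N.+1)%:R : R))); rewrite -/(v N); lra.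
apply: le_trans H'; rewrite !big_ord_recr/= -addrA lerDl addr_ge0// expR_ge0.
Qed.

Lemma sum_harmonic_unbounded (c : R) m K : 0 < c -> exists N, K <= \sum_(m <= n < N)
  (c / (n.+1)%:R).
Proof.
move=> c0; apply: contrapT => H.
apply: (@dvg_harmonic R).
apply: (@nondecreasing_is_cvgn R); first by apply: nondecreasing_series => n _ _;
  exact: harmonic_ge0.
exists (K / c + series harmonic m) => _ [n _ <-].
have [nm|mn] := leqP n m.
  apply: (@le_trans _ _ (series harmonic m)).
    by apply: nondecreasing_series => // k _ _; exact: harmonic_ge0.
  rewrite lerDr divr_ge0 ?(ltW c0)//; apply: contrapT => /negP; rewrite -ltNge => K0; apply: H.
  by exists m; rewrite big_geq// ltW.
rewrite /series/= (@big_cat_nat _ _ _ m)//=; last exact: ltnW.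
rewrite addrC lerD2r ler_pdivlMr// mulrC mulr_sumr.
by rewrite leNgt; apply/negP => /ltW h; apply: H; exists n.
Qed.
End series_bound.

Section lil_function.
Variable R : realType.
Implicit Types t q : R.

(** As [Num.sqrt] is 0 on negative numbers, this is nonnegative for every t; it has its usual
    meaning once t >= e, where ln (ln t) >= 0. *)
Definition lil t := Num.sqrt (2 * t * ln (ln t)).

Lemma lil_ge0 t : 0 <= lil t. Proof. exact: sqrtr_ge0. Qed.

Lemma ln_ge1 t : expR 1 <= t -> 1 <= ln t.
Proof.
move=> et; have t0 : 0 < t := lt_le_trans (expR_gt0 1) et.
by rewrite -[leLHS]expRK ler_ln ?posrE// expR_gt0.
Qed.

Lemma lnln_ge t (K : R) : expR (expR K) <= t -> K <= ln (ln t).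
Proof.
move=> et; have t0 : 0 < t := lt_le_trans (expR_gt0 _) et.
have h : expR K <= ln t by rewrite -[leLHS]expRK ler_ln ?posrE// expR_gt0.
by rewrite -[leLHS]expRK ler_ln ?posrE ?expR_gt0// (lt_le_trans (expR_gt0 K)).
Qed.

Lemma lil_le t t' : expR 1 <= t -> t <= t' -> lil t <= lil t'.
Proof.
move=> et tt'; have t0 : 0 < t := lt_le_trans (expR_gt0 1) et.
have t'0 : 0 < t' := lt_le_trans t0 tt'.
have l1 := ln_ge1 et; have l2 := ln_ge1 (le_trans et tt').
have ll : ln (ln t) <= ln (ln t') by rewrite ler_ln ?posrE ?(lt_le_trans ltr01)// ler_ln ?posrE.
have l0 := ln_ge0 l1; apply: ler_wsqrtr; apply: ler_pM => //.
  by rewrite mulr_ge0// ltW.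
by rewrite ler_pM2l.
Qed.

Lemma sqrt_le_lil (M : R) : exists t0, forall t, t0 <= t -> M * Num.sqrt t <= lil t.
Proof.
exists (expR (expR (M ^+ 2 / 2))) => t ht.
have t0 : 0 < t := lt_le_trans (expR_gt0 _) ht.
have [M0|M0] := leP M 0; first by rewrite (le_trans _ (lil_ge0 t))// mulr_le0_ge0.
rewrite -[M in leLHS]gtr0_norm// -sqrtr_sqr -sqrtrM ?sqr_ge0// ler_wsqrtr//.
by have := lnln_ge ht; rewrite ler_pdivrMr//; nra.
Qed.

(** The factor ln ln only grows when t is multiplied by q. This makes the value of a path at q^n a
    small fraction, 1 / sqrt q, of the scale at q^(n+1). *)
Lemma lil_scale q t : 1 <= q -> expR 1 <= t -> lil t <= lil (q * t) / Num.sqrt q.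
Proof.
move=> q1 et; have t0 : 0 < t := lt_le_trans (expR_gt0 1) et.
have q0 : 0 < q := lt_le_trans ltr01 q1.
have tqt : t <= q * t by rewrite ler_peMl// ltW.
have l1 := ln_ge1 et; have l2 := ln_ge1 (le_trans et tqt).
have ll : ln (ln t) <= ln (ln (q * t)) by rewrite ler_ln ?posrE ?(lt_le_trans ltr01)//
  ler_ln ?posrE ?mulr_gt0.
have l0 := ln_ge0 l1.
rewrite ler_pdivlMr ?sqrtr_gt0// /lil -sqrtrM; last by rewrite !mulr_ge0// ltW.
apply: ler_wsqrtr; have := mulr_gt0 q0 t0.
nra.
Qed.

Lemma geometric_bracket q t n0 : 1 < q -> q ^+ n0 <= t ->
  exists2 n, (n0 <= n)%N & q ^+ n <= t < q ^+ n.+1.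
Proof.
move=> q1 qt.
have q0 : 0 < q := lt_trans ltr01 q1.
have ex : exists m, t < q ^+ m.
  exists (Num.truncn (ln t / ln q)).+1.
  have lq : 0 < ln q by rewrite ln_gt0.
  have t0 : 0 < t by rewrite (lt_le_trans _ qt)// exprn_gt0.
  rewrite -ltr_ln ?posrE ?exprn_gt0// lnXn// -mulr_natl -ltr_pdivrMr//.
  exact: truncnS_gt.
have mono : {homo (fun m => q ^+ m) : m n / (m <= n)%N >-> m <= n}.
  by move=> m n mn; rewrite ler_weXn2l// ltW.
case: (ex_minnP ex) => -[|m] qm min.
  by have := le_lt_trans qt qm; rewrite ltNge mono.
exists m; last by rewrite qm andbT leNgt; apply/negP => /min; rewrite ltnn.
rewrite -ltnS ltnNge; apply/negP => mn.
by have := le_lt_trans qt qm; rewrite ltNge mono.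
Qed.
End lil_function.

Section lil_algebra.
Variable R : realType.

(** The exponent of [max_ineq] for the level q * lil Q on [0, q Q], with x = ln ln Q: the
    coefficient q > 1 is what makes the series converge. *)
Lemma lil_upper_exponent (q Q x : R) : 0 < q -> 0 < Q ->
  - (q ^+ 2 * (2 * Q * x)) / (2 * (q * Q)) = - (q * x).
Proof. by move=> q0 Q0; field; rewrite !gt_eqF. Qed.

(** Here the ratio is q = e^(-2), for which 1 / sqrt q = e and 1 - 1 / q = (1 - e)(1 + e), so the
    squared normalized level, times 1 + e, simplifies exactly. *)
Lemma lil_lower_variance (e Q x : R) : 0 < e <= 2^-1 -> 0 < Q ->
  (1 - e) ^+ 2 * (2 * (e ^- 2 * Q) * x) / (e ^- 2 * Q - Q) * (1 + e) = (1 - e) * (2 * x).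
Proof.
move=> /andP[e0 e2] Q0.
have h1 : 0 < 1 - e by lra.
have h2 : 0 < 1 + e by lra.
have -> : e ^- 2 * Q - Q = (1 - e) * (1 + e) * Q / e ^+ 2 by field; rewrite gt_eqF.
by field; rewrite !gt_eqF.
Qed.
End lil_algebra.

Section lil_brownian.
Context d (Omega : measurableType d) (R : realType) (P : probability Omega R)
  (F : R -> set (set Omega)).
Hypotheses (hF : is_filtration F).

(* Borel-Cantelli for the maxima over [0, q^(n+1)] with q = 1 + e. *)
Lemma lil_upper (B : R -> Omega -> R) (e : R) : is_F_brownian P F B -> 0 < e ->
  {ae P, forall w, exists M, forall t, M <= t -> B t w <= (1 + e) * lil t}.
Proof.
move=> hB e0; pose q : R := 1 + e; have q1 : 1 < q by rewrite /q; lra.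
have q0 : 0 < q := lt_trans ltr01 q1.
have lq : 0 < ln q by rewrite ln_gt0.
have qn0 n : 0 < q ^+ n by rewrite exprn_gt0.
have HG n : exists G, [/\ measurable G, (P G <= (2 * expR (- ((1 + e) * lil (q ^+ n))
  ^+ 2 / (2 * q ^+ n.+1)))%:E)%E &
   forall w, cont_path B w -> (exists2 s, 0 <= s <= q ^+ n.+1 & (1 + e) * lil (q ^+ n) < B s w) -> G w].
  by apply: (max_ineq hF hB) => //; rewrite mulr_ge0 ?lil_ge0//; lra.
pose G n := sval (cid (HG n)).
have mG n : measurable (G n) by have [] := svalP (cid (HG n)).
have PG n : (P (G n) <= (2 * expR (- ((1 + e) * lil (q ^+ n))
  ^+ 2 / (2 * q ^+ n.+1)))%:E)%E by have [] := svalP (cid (HG n)).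
have GP n : forall w, cont_path B w -> (exists2 s, 0 <= s <= q ^+ n.+1 & (1 + e) * lil (q ^+ n)
  < B s w) -> G n w.
  by have [] := svalP (cid (HG n)).
(* From this index on q^n >= e, so ln ln is nonnegative and [lil] is monotone; moreover n > 0, so ln
   n is meaningful. *)
pose n0 := (Num.truncn (1 / ln q)).+1.
have n0q n : (n0 <= n)%N -> expR 1 <= q ^+ n.
  move=> nn; rewrite -[leRHS]lnK ?posrE// ler_expR lnXn// -mulr_natl -ler_pdivrMr//.
  by rewrite (le_trans (ltW (truncnS_gt _)))// ler_nat.
have [K HK] := @sum_expR_ln_bounded R q q1.
(* Since ln (ln (q^n)) = ln n + ln (ln q), the tail bound at level n is 2 (n ln q)^(-q). *)
pose u n := 2 * expR (- (q * ln (ln q))) * expR (- (q * ln (n%:R : R))).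
have ae1 : {ae P, forall w, exists n1, forall n, (n1 <= n)%N -> ~ G n w}.
  apply: (@borel_cantelli_ae _ _ _ _ _ u (2 * expR (- (q * ln (ln q))) * K) n0) => //.
  - by move=> n; rewrite !mulr_ge0 ?expR_ge0.
  - move=> n nn; apply: (le_trans (PG n)); rewrite lee_fin /u -mulrA ler_pM2l// -expRD ler_expR.
    have en := n0q _ nn; have l1 := ln_ge1 en; have l0 := ln_ge0 l1.
    have nn0 : 0 < n%:R :> R by rewrite ltr0n (leq_trans _ nn).
    have Lq : ln (ln (q ^+ n)) = ln n%:R + ln (ln q).
      rewrite (_ : ln (q ^+ n) = n%:R * ln q) ?lnM ?posrE//; first by rewrite lnXn// mulr_natl.
    rewrite exprMn /lil sqr_sqrtr ?Lq; last first.
      by rewrite mulr_ge0// -?Lq// mulr_ge0// ltW.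
    rewrite (exprS q n) (_ : 1 + e = q)// lil_upper_exponent// mulrDr opprD addrC//.
  - by move=> N; rewrite -mulr_sumr ler_pM2l// mulr_gt0// expR_gt0.
have cB : {ae P, forall w, cont_path B w} by case: hB => _ [_ []].
apply: filterS2 ae1 cB => w [n1 Hn1] cw.
exists (q ^+ maxn n0 n1) => t qt.
have [n nn /andP[qnt tqn]] := geometric_bracket q1 qt.
have [nn0 nn1] : (n0 <= n)%N /\ (n1 <= n)%N by move: nn; rewrite geq_max => /andP[].
rewrite leNgt; apply/negP => h; apply: (Hn1 n nn1); apply: GP => //.
have t0 : 0 <= t by rewrite (le_trans _ qnt)// ltW.
exists t; first by rewrite t0 ltW.
apply: le_lt_trans h; apply: ler_wpM2l; first exact: ltW q0.
by apply: lil_le => //; exact: n0q.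
Qed.

(* Second Borel-Cantelli lemma for the independent increments over [q^n, q^(n+1)], with q large;
   the value at q^n is controlled by the upper half applied to -B. *)
Lemma lil_lower (B : R -> Omega -> R) (e : R) : is_F_brownian P F B -> 0 < e ->
  {ae P, forall w, forall M, exists2 t, M <= t & (1 - e) * lil t <= B t w}.
Proof.
(* The loss is 3 e1 in total: e1 in the level exceeded by the increment, and 2 e1 for the value at
   q^n, bounded below by -2 lil (q^n) >= -2 e1 lil (q^(n+1)). The cap 1/2 ensures q > 1. *)
move=> hB e00; pose e1 := Num.min (e / 3) 2^-1.
have e10 : 0 < e1 by rewrite lt_min; apply/andP; split; lra.
have e1e3 : e1 <= e / 3 by rewrite ge_min lexx.
have e1e : 3 * e1 <= e by lra.
have e12 : e1 <= 2^-1 by rewrite ge_min lexx orbT.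
pose q : R := e1 ^- 2.
have q1 : 1 < q by rewrite /q invf_gt1 ?exprn_gt0//; nra.
have q0 : 0 < q := lt_trans ltr01 q1.
have lq : 0 < ln q by rewrite ln_gt0.
have qn0 n : 0 < q ^+ n by rewrite exprn_gt0.
have qmono m n : (m <= n)%N -> q ^+ m <= q ^+ n by move=> mn; rewrite ler_weXn2l// ltW.
have qlt n : q ^+ n < q ^+ n.+1 by rewrite exprS ltr_pMl.
pose a n := (1 - e1) * lil (q ^+ n.+1).
have a0 n : 0 <= a n by rewrite mulr_ge0 ?lil_ge0//; lra.
pose Y n w := B (q ^+ n.+1) w - B (q ^+ n) w.
pose E n := Y n @^-1` `]a n, +oo[.
have gY n : gaussian P (Y n) (Num.sqrt (q ^+ n.+1 - q ^+ n)).
  by apply: (brownian_increment hF hB) => //; exact: ltW.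
have mE n : measurable (E n).
  by rewrite -[X in measurable X]setTI; case: (gY n) => + _; apply.
have FE n : F (q ^+ n.+1) (E n).
  have ad t : 0 <= t -> rv_measurable_wrt (F t) (B t) by case: hB => h _; exact: h.
  have := @rvm_sub _ _ _ _ hF (q ^+ n.+1) (B (q ^+ n.+1)) (B (q ^+ n)).
  apply => //; first by apply: ad; exact: ltW.
  by apply: (rvm_le hF (ltW (qlt n))); apply: ad; exact: ltW.
pose n0 := (Num.truncn (1 / ln q)).+1.
have n0q n : (n0 <= n)%N -> expR 1 <= q ^+ n.
  move=> nn; rewrite -[leRHS]lnK ?posrE// ler_expR lnXn// -mulr_natl -ler_pdivrMr//.
  by rewrite (le_trans (ltW (truncnS_gt _)))// ler_nat.
(* The tail of the increment is at least a constant times exp(- ln ln q^(n+1)) = 1 / ((n + 1) ln q);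
   c collects the constants of this harmonic lower bound. *)
pose c := normal_peak 1 * expR (- ((1 + e1^-1) / 2)) / ln q.
have c0 : 0 < c by rewrite divr_gt0// mulr_gt0 ?expR_gt0 ?normal_peak_gt0.
have ae1 : {ae P, forall w, forall m, exists2 n, (m <= n)%N & E n w}.
  apply: (@borel_cantelli2_ae _ _ _ _ _ (fun n => c / (n.+1)%:R) n0) => //.
  - by move=> n _; rewrite divr_ge0// ltW.
  - move=> n nn; have [_ ->//] := gY n.
    have s0 : 0 < Num.sqrt (q ^+ n.+1 - q ^+ n) by rewrite sqrtr_gt0 subr_gt0.
    rewrite normal_prob_scale//.
    set s := Num.sqrt _ in s0 *.
    have -> : (fun z : R => s * z) @^-1` `]a n, +oo[ = `](a n / s), +oo[%classic.
      by apply/seteqP; split => x /=; rewrite !in_itv/= !andbT ltr_pdivrMr// mulrC.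
    have x0 : 0 <= a n / s by rewrite divr_ge0// ltW.
    apply: le_trans (normal_tail_lb x0); rewrite lee_fin.
    set x := a n / s in x0 *.
    have en := n0q _ (leqW nn); have l1 := ln_ge1 en; have l0 := ln_ge0 l1.
    set L := ln (ln (q ^+ n.+1)) in l0.
    have x2 : x ^+ 2 * (1 + e1) = (1 - e1) * (2 * L).
      rewrite /x /a expr_div_n exprMn /lil sqr_sqrtr -/L; last by rewrite mulr_ge0// mulr_ge0// ltW.
      rewrite /s sqr_sqrtr; last by rewrite subr_ge0 ltW.
      by rewrite (exprS q n) lil_lower_variance// e10.
    (* Young's inequality: the shift by 1 in [normal_tail_lb] costs a factor 1 + e1, exactly
       compensated by the level 1 - e1 through [lil_lower_variance]. *)
    have h : (x + 1) ^+ 2 <= x ^+ 2 * (1 + e1) + (1 + e1^-1).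
      have -> : x ^+ 2 * (1 + e1) + (1 + e1^-1) = (x + 1) ^+ 2 + (e1 * x - 1) ^+ 2 / e1 by field;
        rewrite gt_eqF.
      by rewrite lerDl divr_ge0// ?sqr_ge0// ltW.
    have hh : - ((1 + e1^-1) / 2) - L <= - (x + 1) ^+ 2 / 2 by nra.
    have np := @normal_peak_ge0 R 1.
    apply: (@le_trans _ _ (normal_peak 1 * expR (- ((1 + e1^-1) / 2) - L))); last first.
      by rewrite ler_wpM2l// ler_expR.
    rewrite expRD expRN expRN lnK ?posrE ?(lt_le_trans ltr01)// lnXn// -mulr_natl /c expRN.
    rewrite le_eqVlt; apply/orP; left; apply/eqP; field.
    by rewrite !gt_eqF ?expR_gt0//= nat1r ltr0n.
  - move=> m n nm mn.
    have -> : ~` E n = Y n @^-1` `]-oo, a n].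
      by apply/seteqP; split => w; rewrite /E /= !in_itv/= andbT; [move=> /negP;
        rewrite -leNgt|rewrite leNgt => /negP].
    apply: (brownian_indep hB (ltW (qn0 n)) (qlt n)) => //.
    have sF t : sigma_algebra setT (F t) by case: hF.
    elim: n mn => [|n IH].
      by rewrite leqn0 => /eqP ->; rewrite big_geq// -setC0; apply: (sigma_algebraC (sF _));
        case: (sF (q ^+ 0)).
    rewrite leq_eqVlt => /predU1P[->|].
      by rewrite big_geq// -setC0; apply: (sigma_algebraC (sF _)); case: (sF (q ^+ n.+1)).
    rewrite ltnS => mn; rewrite big_nat_recr//=; apply: (sigma_algebraI (sF _)).
      by have [_ [_ h]] := hF; apply: h (IH mn); exact: ltW.
    by apply: (sigma_algebraC (sF _)).
  - by move=> m K; exact: sum_harmonic_unbounded.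
(* The crude bound -B <= 2 lil suffices at q^n, because lil (q^n) is at most e1 lil (q^(n+1)). *)
have hN := lil_upper (brownian_opp hB) ltr01.
apply: filterS2 ae1 hN => w H [M0 HM0] M.
have [n1 Hn1] : exists n1, Num.max M M0 <= q ^+ n1.
  exists (Num.truncn (Num.max M M0 / (q - 1))).+1.
  set z := Num.max M M0.
  have q10 : 0 < q - 1 by rewrite subr_gt0.
  have h1 : z < (Num.truncn (z / (q - 1))).+1%:R * (q - 1) by rewrite -ltr_pdivrMr// truncnS_gt.
  apply: (le_trans (ltW h1)).
  have bern k : k%:R * (q - 1) <= q ^+ k - 1.
    elim: k => [|k IH]; first by rewrite mul0r expr0 subrr.
    rewrite -natr1 exprS mulrDl mul1r; have : 1 <= q ^+ k by rewrite exprn_ege1// ltW.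
    nra.
  by rewrite (le_trans (bern _))// gerBl.
have [n nn] := H (maxn n0 n1); rewrite /E /= in_itv/= andbT /Y => HE.
have [nn0 nn1] : (n0 <= n)%N /\ (n1 <= n)%N by move: nn; rewrite geq_max => /andP[].
have : Num.max M M0 <= q ^+ n by rewrite (le_trans Hn1)// qmono.
rewrite ge_max => /andP[Mq M0q].
exists (q ^+ n.+1); first by rewrite (le_trans Mq)// ltW.
have hu := HM0 _ M0q.
have hs := lil_scale (ltW q1) (n0q _ nn0).
have sq : Num.sqrt q = e1^-1 by rewrite /q -exprVn sqrtr_sqr gtr0_norm// invr_gt0.
rewrite -(exprS q n) sq invrK in hs.
have := lil_ge0 (q ^+ n.+1); rewrite /a in HE.
nra.
Qed.
End lil_brownian.

(** * Solution paths *)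

Section path.
Variables (R : realType) (rho alpha beta : R).
Implicit Types (x b : R -> R).

(** The almost sure part of [is_solution] for one outcome, so that the estimates on the drift become
    deterministic. *)
Definition path_solution (x b : R -> R) (x0 : R) :=
  {within `[1, +oo[, continuous x} /\ x 1 = x0 /\
  forall t, 1 <= t ->
   (@lebesgue_measure R).-integrable `[1, t] (fun s => (drift rho alpha beta s (x s))%:E) /\
   x t = x0 + (b t - b 1) + \int[lebesgue_measure]_(s in `[1, t]) drift rho alpha beta s (x s).

Variables (x b : R -> R) (x0 : R).
Hypothesis hx : path_solution x b x0.
Notation mu s := (drift rho alpha beta s (x s)).

Lemma drift_integrable s t : 1 <= s ->
  (@lebesgue_measure R).-integrable `]s, t] (EFin \o (fun s => mu s)).
Proof.
move=> s1; have [ts|st] := leP t s.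
  by rewrite set_itv_ge ?bnd_simp -?leNgt//; exact: integrable_set0.
have [_ [_ /(_ t (le_trans s1 (ltW st)))[i _]]] := hx.
apply: integrableS i => // u /=; rewrite !in_itv/= => /andP[su ->]; rewrite andbT.
by rewrite (le_trans s1)// ltW.
Qed.

Lemma drift_norm_integrable s t : 1 <= s ->
  (@lebesgue_measure R).-integrable `]s, t] (EFin \o (fun s => `|mu s|)).
Proof. by move=> s1; have := integrable_norm (drift_integrable t s1). Qed.

Lemma path_increment s t : 1 <= s -> s <= t ->
  x t - x s = (b t - b s) + \int[lebesgue_measure]_(u in `]s, t]) mu u.
Proof.
move=> s1 st; have [_ [_ h]] := hx.
have [i ->] := h t (le_trans s1 st); have [_ ->] := h s s1.
rewrite -(Rintegral_itvB i) ?bnd_simp//; ring.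
Qed.

Lemma path_increment_norm s t : 1 <= s -> s <= t ->
  `|x t - x s - (b t - b s)| <= \int[lebesgue_measure]_(u in `]s, t]) `|mu u|.
Proof.
move=> s1 st; rewrite path_increment// addrAC subrr add0r.
by apply: le_normr_Rintegral => //; exact: drift_integrable.
Qed.

Lemma drift_norm_split s t u : 1 <= s -> s <= t -> t <= u ->
  \int[lebesgue_measure]_(r in `]s, u]) `|mu r| =
  \int[lebesgue_measure]_(r in `]s, t]) `|mu r| + \int[lebesgue_measure]_(r in `]t, u]) `|mu r|.
Proof.
move=> s1 st tu; rewrite -(@Rintegral_itvB _ _ (BRight s) (BRight u) t) ?bnd_simp//;
  last exact: drift_norm_integrable.
by rewrite addrC subrK.
Qed.

(* After the last time before t at which x <= |x0|, the drift points downwards. *)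
Lemma excursion_ub t (M : R) : rho <= 0 -> 1 <= t ->
  (forall s, 1 <= s <= t -> `|b s - b 1| <= M) -> x t <= `|x0| + 2 * M.
Proof.
move=> rho0 t1 bM; rewrite leNgt; apply/negP => xt.
have M0 : 0 <= M by rewrite (le_trans _ (bM 1 _))// lexx.
pose S := [set s | 1 <= s <= t /\ x s <= `|x0|].
have S1 : S 1 by split; [rewrite lexx|have [_ [-> _]] := hx; exact: ler_norm].
have Sub : has_ubound S by exists t => s [/andP[]].
have hS : has_sup S by split => //; exists 1.
pose g := sup S.
have g1 : 1 <= g by exact: ub_le_sup.
have gt : g <= t by apply: ge_sup => [|s [/andP[]]//]; exists 1.
have [cx _] := hx.
have xg : x g <= `|x0|.
  rewrite leNgt; apply/negP => h.
  have e0 : 0 < x g - `|x0| by rewrite subr_gt0.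
  have [d d0 H] := within_continuous_dist cx (x := g) (ltac:(by rewrite /= in_itv/= g1)) e0.
  have [s [/andP[s1 st] xs] gs] := sup_adherent d0 hS.
  have sg : s <= g by apply: ub_le_sup => //; split => //; rewrite s1.
  have : `|s - g| < d by rewrite distrC ger0_norm ?subr_ge0//; rewrite -/g in gs; lra.
  move=> /(H _ _); rewrite /= in_itv/= s1 => /(_ isT); rewrite ltr_norml => /andP[]; lra.
have := path_increment g1 gt.
have neg : \int[lebesgue_measure]_(u in `]g, t]) mu u <= 0.
  have -> : 0 = \int[lebesgue_measure]_(u in `]g, t]) (0 : R) by rewrite Rintegral_cst ?mul0r.
  apply: le_Rintegral => //; first exact: drift_integrable.
    exact: (integrable0 (@lebesgue_measure R) `]g, t]).
  move=> u /=; rewrite in_itv/= => /andP[gu ut].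
  have xu : `|x0| < x u.
    rewrite ltNge; apply/negP => xu; have : u <= g.
      by apply: ub_le_sup => //; split => //; rewrite ut andbT (le_trans g1)// ltW.
    by rewrite leNgt gu.
  have xu0 : 0 < x u by rewrite (le_lt_trans _ xu).
  rewrite /drift gtr0_sg// mulr1 mulr_le0_ge0 ?invr_ge0 ?powR_ge0//.
  by rewrite mulr_le0_ge0// powR_ge0.
(* b t - b g is the difference of two increments from time 1, each at most M in absolute value; this
   is the 2 M of the bound. *)
have b1 := bM t (ltac:(by rewrite t1 lexx)).
have b2 := bM g (ltac:(by rewrite g1 gt)).
move: b1 b2; rewrite !ler_norml => /andP[? ?] /andP[? ?].
move: neg; set J := Rintegral _ _ _; clearbody J => neg hJ; lra.
Qed.
End path.

Section path_bounds.
Variables (R : realType) (rho alpha beta : R).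
Implicit Types (x b : R -> R).

Lemma driftN s y : drift rho alpha beta s (- y) = - drift rho alpha beta s y.
Proof. by rewrite /drift sgrN normrN mulrN !mulNr. Qed.

Lemma path_solutionN x b (x0 : R) : path_solution rho alpha beta x b x0 ->
  path_solution rho alpha beta (fun t => - x t) (fun t => - b t) (- x0).
Proof.
move=> [cx [x1 h]]; split; [|split].
- move/subspace_continuousP: cx => cx; apply/subspace_continuousP => t tA; apply: cvgN; exact: cx.
- by rewrite x1.
- move=> t t1; have [i ->] := h t t1.
  have E : (fun s => (drift rho alpha beta s (- x s))) = (fun s => (-1)
    * drift rho alpha beta s (x s)).
    by apply/funext => s; rewrite driftN mulN1r.
  split.
    have -> : (fun s => (drift rho alpha beta s (- x s))%:E)
      = (\- (fun s => (drift rho alpha beta s (x s))%:E))%E.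
      by apply/funext => s; rewrite driftN EFinN.
    exact: integrableN.
  by rewrite E RintegralZl//; ring.
Qed.

Lemma excursion_bound x b (x0 t M : R) : rho <= 0 -> path_solution rho alpha beta x b x0 -> 1 <= t ->
  (forall s, 1 <= s <= t -> `|b s - b 1| <= M) -> `|x t| <= `|x0| + 2 * M.
Proof.
move=> rho0 hx t1 bM; rewrite ler_norml; apply/andP; split.
  rewrite lerNl -(normrN x0); apply: (excursion_ub (path_solutionN hx) rho0 t1) => s st.
  by rewrite -opprD normrN; exact: bM.
exact: (excursion_ub hx rho0 t1).
Qed.

(** The variation on the block of index n is o(sqrt (2^n)), and a geometric sum of such terms is
    still o(sqrt (2^n)); the finitely many early blocks and the starting values are absorbed by
    taking t large. *)
Lemma blocks_little_o x b (x0 C kap : R) n0 : path_solution rho alpha beta x b x0 -> 0 < kap ->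
  (forall n, (n0 <= n)%N ->
     \int[lebesgue_measure]_(u in `](2 ^+ n), (2 ^+ n.+1)]) `|drift rho alpha beta u (x u)|
       <= C * (2 ^+ n) `^ (2^-1 - kap)) ->
  forall e, 0 < e -> exists M, forall t, M <= t -> `|x t - b t| <= e * Num.sqrt t.
Proof.
move=> hx kap0 HC e e0.
pose I N := \int[lebesgue_measure]_(u in `]1, (2 ^+ N)]) `|drift rho alpha beta u (x u)|.
have p1 n : 1 <= 2 ^+ n :> R by rewrite exprn_ege1// ler1n.
have pn n : 2 ^+ n <= 2 ^+ n.+1 :> R by rewrite ler_weXn2l// ler1n.
have I0 n : 0 <= I n by apply: Rintegral_ge0.
have IS n : I n.+1 = I n + \int[lebesgue_measure]_(u in `](2 ^+ n), (2 ^+ n.+1)])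
  `|drift rho alpha beta u (x u)|.
  by rewrite /I (drift_norm_split hx (lexx 1) (p1 n) (pn n)).
have s2 : 4 / 3 <= Num.sqrt 2 :> R.
  by rewrite -[leLHS]ger0_norm// -sqrtr_sqr ler_wsqrtr//; lra.
(* One half of e is spent on the blocks, 3 e1 sqrt (2^(n+1)) <= 6 e1 sqrt t, and the other half on
   the constant A. *)
pose e1 := e / 12; have e10 : 0 < e1 by rewrite divr_gt0.
have [n1 [n01 Hn1]] : exists n1, (n0 <= n1)%N /\ forall n, (n1 <= n)%N -> C * (2 ^+ n)
  `^ (2^-1 - kap) <= e1 * Num.sqrt (2 ^+ n).
  have l2 : 0 < ln (2 : R) by rewrite ln_gt0// ltr1n.
  exists (maxn n0 (Num.truncn (ln (Num.max C 1 / e1) / (kap * ln 2))).+1); split;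
    first exact: leq_maxl.
  move=> n; rewrite geq_max => /andP[_ nn].
  have C1 : 0 < Num.max C 1 by rewrite lt_max ltr01 orbT.
  rewrite -powR12_sqrt ?exprn_ge0// powRD; last by rewrite expf_neq0 ?implybT.
  rewrite mulrCA mulrC; apply: ler_wpM2r; first exact: powR_ge0.
  apply: (@le_trans _ _ (Num.max C 1 * (2 ^+ n) `^ (- kap))).
    by apply: ler_wpM2r; [exact: powR_ge0|rewrite le_max lexx].
  rewrite powRN ler_pdivrMr ?powR_gt0 ?exprn_gt0// mulrC -ler_pdivrMr//.
  rewrite -[leLHS]lnK ?posrE ?divr_gt0// /powR expf_eq0/= (negbTE (_ : 2 != 0)) ?andbF// ler_expR.
  rewrite (_ : ln (2 ^+ n) = n%:R * ln 2); last by rewrite lnXn// mulr_natl.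
  rewrite mulrCA -ler_pdivrMr ?mulr_gt0//.
  by rewrite (le_trans (ltW (truncnS_gt _)))// ler_nat.
(* The constant 3 closes the induction: 3 + 1 = 3 * (4/3) and 4/3 <= sqrt 2. *)
have IN n : (n1 <= n)%N -> I n <= I n1 + 3 * e1 * Num.sqrt (2 ^+ n).
  elim: n => [|n IH].
    by rewrite leqn0 => /eqP ->; rewrite lerDl mulr_ge0 ?sqrtr_ge0// mulr_ge0// ltW.
  rewrite leq_eqVlt => /predU1P[->|].
    by rewrite lerDl mulr_ge0 ?sqrtr_ge0// mulr_ge0// ltW.
  rewrite ltnS => nn; rewrite IS (le_trans (lerD (IH nn) (HC _ (leq_trans n01 nn))))//.
  rewrite -addrA lerD2l (le_trans (lerD (lexx _) (Hn1 _ nn)))//.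
  rewrite exprS sqrtrM//; have := sqrtr_ge0 (2 ^+ n : R); set z := Num.sqrt (2 ^+ n) => z0.
  have -> : 3 * e1 * z + e1 * z = (4 / 3) * (3 * e1 * z) by field.
  have -> : 3 * e1 * (Num.sqrt 2 * z) = Num.sqrt 2 * (3 * e1 * z) by ring.
  by apply: ler_wpM2r => //; rewrite mulr_ge0// mulr_ge0// ltW.
pose A := `|x0| + `|b 1| + I n1.
have A0 : 0 <= A by rewrite addr_ge0// addr_ge0.
exists (Num.max (2 ^+ n1) ((A / (e / 2)) ^+ 2)) => t; rewrite ge_max => /andP[tn tA].
have t1 : 1 <= t := le_trans (p1 n1) tn.
have t0 : 0 <= t := le_trans ler01 t1.
have [n nn /andP[nt tn1]] := geometric_bracket (ltr1n R 2) tn.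
have h1 : `|x t - b t| <= `|x0| + `|b 1| + I n.+1.
  have := path_increment_norm hx (lexx 1) t1; have [_ [x1 _]] := hx; rewrite x1.
  set J := Rintegral _ _ _ => hJ.
  have JI : J <= I n.+1.
    rewrite /I (drift_norm_split hx (lexx 1) t1 (ltW tn1)) lerDl.
    by apply: Rintegral_ge0.
  have -> : x t - b t = (x t - x0 - (b t - b 1)) + x0 - b 1 by ring.
  rewrite (le_trans (ler_normB _ _))// (le_trans (lerD (ler_normD _ _) (lexx _)))//.
  lra.
apply: (le_trans h1).
have h2 : A <= e / 2 * Num.sqrt t.
  rewrite mulrC -ler_pdivrMr ?divr_gt0//.
  have z0 : 0 <= A / (e / 2) by rewrite !divr_ge0// ltW.
  by rewrite -[leLHS]ger0_norm// -sqrtr_sqr ler_wsqrtr.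
have h3 : Num.sqrt (2 ^+ n.+1) <= 2 * Num.sqrt t.
  rewrite -[X in X * _]ger0_norm// -sqrtr_sqr -sqrtrM ?sqr_ge0// ler_wsqrtr// exprS expr2.
  by rewrite -mulrA ler_pM2l// (le_trans nt)// ler_peMl// ler1n.
have := IN _ (leqW nn); have : 0 <= Num.sqrt t by exact: sqrtr_ge0.
rewrite /A in h2; move: h2 h3; set s1 := Num.sqrt t; set s3 := Num.sqrt (2 ^+ n.+1) => h2 h3 h4 h5.
have h6 : 3 * e1 * s3 <= e / 2 * s1.
  have -> : e / 2 * s1 = 3 * e1 * (2 * s1) by rewrite /e1; field.
  by apply: ler_wpM2l => //; rewrite mulr_ge0// ltW.
lra.
Qed.
End path_bounds.

Section lebesgue_constants.
Variable R : realType.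

Lemma lebesgue_integrable_cst (s t K : R) :
  (@lebesgue_measure R).-integrable `]s, t] (EFin \o (fun=> K)).
Proof.
apply/integrableP; split; first exact/measurable_EFinP.
rewrite [X in (X < _)%E](_ : _ = \int[lebesgue_measure]_(x in `]s, t]) (cst (`|K|)%:E x))%E//.
rewrite integral_cst//= lebesgue_measure_itv/=.
by case: ifP => _; rewrite ?mule0 ?ltry// -EFinD -EFinM ltry.
Qed.

Lemma Rintegral_lebesgue_cst (s t K : R) : s <= t ->
  \int[lebesgue_measure]_(u in `]s, t]) K = K * (t - s).
Proof.
move=> st; rewrite Rintegral_cst//= lebesgue_measure_itv/= lte_fin.
by case: ltP => h //=; rewrite (_ : t = s) ?subrr//; apply/eqP; rewrite eq_le h st.
Qed.

Lemma Rintegral_norm_cst_bound (f : R -> R) (s t K : R) : s <= t ->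
  (@lebesgue_measure R).-integrable `]s, t] (EFin \o (fun u => `|f u|)) ->
  (forall u, s < u <= t -> `|f u| <= K) ->
  \int[lebesgue_measure]_(u in `]s, t]) `|f u| <= K * (t - s).
Proof.
move=> st i fK; rewrite -Rintegral_lebesgue_cst//.
apply: le_Rintegral => //; exact: lebesgue_integrable_cst.
Qed.
End lebesgue_constants.

(** * The drift over dyadic blocks when the exponent is nonnegative *)

Section nonneg_exponent.
Variables (R : realType) (rho alpha beta : R).
Implicit Types (x b : R -> R).

(** From ln (ln t) <= ln t = ln (t^c) / c <= t^c / c: the iterated logarithm costs an arbitrarily
    small power. *)
Lemma lil_le_powR (c t : R) : 0 < c -> expR 1 <= t ->
  lil t <= Num.sqrt (2 / c) * t `^ ((1 + c) / 2).
Proof.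
move=> c0 et; have t0 : 0 < t := lt_le_trans (expR_gt0 1) et.
have l1 := ln_ge1 et; have l0 := ln_ge0 l1.
have hl (y : R) : 0 < y -> ln y <= y.
  by move=> y0; have := @le_ln1Dx R (y - 1); rewrite addrCA subrr addr0; lra.
have h : ln (ln t) <= t `^ c / c.
  apply: (le_trans (hl _ (lt_le_trans ltr01 l1))).
  by rewrite ler_pdivlMr// mulrC -ln_powR hl// powR_gt0.
have -> : t `^ ((1 + c) / 2) = Num.sqrt (t * t `^ c).
  by rewrite powRrM powR12_sqrt ?powR_ge0// powRD ?(gt_eqF t0) ?implybT// powRr1// ltW.
have c2 : 0 <= 2 / c by rewrite divr_ge0// ltW.
rewrite -sqrtrM//; apply: ler_wsqrtr.
have -> : 2 / c * (t * t `^ c) = 2 * t * (t `^ c / c) by ring.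
by rewrite ler_pM2l// mulr_gt0.
Qed.

Lemma blocks_nonneg_exponent x b (x0 M : R) : rho <= 0 -> 0 <= alpha -> alpha + 1 < 2 * beta ->
  path_solution rho alpha beta x b x0 ->
  {within `[0, +oo[, continuous b} ->
  (forall t, M <= t -> `|b t| <= 2 * lil t) ->
  exists C kap n0, 0 < kap /\ forall n, (n0 <= n)%N ->
     \int[lebesgue_measure]_(u in `](2 ^+ n), (2 ^+ n.+1)]) `|drift rho alpha beta u (x u)|
       <= C * (2 ^+ n) `^ (2^-1 - kap).
Proof.
move=> rho0 a0 ab hx cb bM.
pose kap := beta - (alpha + 1) / 2.
have kap0 : 0 < kap by rewrite /kap; lra.
(* With |x t| of order t^p and p = (1 + c)/2, the block has exponent p alpha - beta + 1 = 1/2 - kap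
   + alpha c / 2. The choice gives alpha c <= kap, hence at most 1/2 - kap/2. *)
pose c := kap / (alpha + 1).
have c0 : 0 < c by rewrite divr_gt0//; lra.
have ac : alpha * c <= kap.
  by rewrite /c mulrCA ler_piMr ?(ltW kap0)// ler_pdivrMr//; lra.
pose p := (1 + c) / 2.
have p0 : 0 <= p by rewrite /p divr_ge0// addr_ge0// ltW.
pose M1 := Num.max M (expR 1).
have M11 : 1 <= M1 by rewrite le_max (le_trans _ (expR_ge1Dx 1)) ?orbT// lerDl.
have cb1 : {within `[1, M1], continuous (fun t => `|b t - b 1|)}.
  move/subspace_continuousP: cb => cb; apply/subspace_continuousP => t;
    rewrite /= in_itv/= => /andP[t1 tM].
  apply: cvg_norm; apply: cvgB; last exact: cvg_cst.
  have t0 : `[0, +oo[%classic t by rewrite /= in_itv/= andbT (le_trans ler01).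
  apply: cvg_trans (cb t t0); apply: cvg_app; apply: within_subset => //.
  by move=> u /=; rewrite !in_itv/= andbT => /andP[u1 _]; rewrite (le_trans ler01).
have [c1 c1M K0P] := EVT_max M11 cb1.
(* [excursion_bound] requires control of b from time 1 on, so K combines the maximum over the
   initial segment with the growth constant valid after M1. *)
pose K := `|b c1 - b 1| + 2 * Num.sqrt (2 / c) + `|b 1|.
have s0 := sqrtr_ge0 (2 / c).
have K0 : 0 <= K by rewrite /K !addr_ge0// mulr_ge0.
have bK t : 1 <= t -> `|b t - b 1| <= K * t `^ p.
  move=> t1; have tp1 : 1 <= t `^ p by rewrite -[leLHS](powRr0 t) ler_powR.
  have [tM|Mt] := leP t M1.
    apply: (le_trans (K0P t _)); first by rewrite in_itv/= t1.
    by rewrite -[leLHS]mulr1; apply: ler_pM => //; rewrite /K -addrA lerDl addr_ge0// mulr_ge0.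
  have tM0 : M <= t by rewrite (le_trans _ (ltW Mt))// /M1 le_max lexx.
  have te : expR 1 <= t by rewrite (le_trans _ (ltW Mt))// /M1 le_max lexx orbT.
  have h1 := bM t tM0; have h2 := lil_le_powR c0 te; rewrite -/p in h2.
  rewrite (le_trans (ler_normB _ _))//.
  have h3 : `|b 1| <= `|b 1| * t `^ p by rewrite ler_peMr.
  have h4 : 0 <= `|b c1 - b 1| * t `^ p by rewrite mulr_ge0// powR_ge0.
  have -> : K * t `^ p = `|b c1 - b 1| * t `^ p + 2 * (Num.sqrt (2 / c) * t `^ p) + `|b 1| * t `^ p.
    by rewrite /K; ring.
  apply: lerD => //; rewrite (le_trans h1)// (le_trans (_ : _ <= 2 * (Num.sqrt (2 / c)
    * t `^ p)))//; last by rewrite lerDr.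
  by rewrite ler_pM2l.
pose K2 := `|x0| + 2 * K.
have K20 : 0 <= K2 by rewrite addr_ge0// mulr_ge0.
have xK t : 1 <= t -> `|x t| <= K2 * t `^ p.
  move=> t1; have tp1 : 1 <= t `^ p by rewrite -[leLHS](powRr0 t) ler_powR.
  have t0 : 0 <= t := le_trans ler01 t1.
  have h := excursion_bound rho0 hx t1 (M := K * t `^ p).
  apply: (le_trans (h _)).
    move=> s /andP[s1 st]; rewrite (le_trans (bK s s1))//; apply: ler_wpM2l => //.
    by apply: ge0_ler_powR => //; rewrite nnegrE// (le_trans ler01).
  by rewrite [leRHS]mulrDl -mulrA lerD2r ler_peMr.
exists (`|rho| * (K2 `^ alpha * 2 `^ (p * alpha))), (kap / 2), 0%N; split;
  first by rewrite divr_gt0.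
move=> n _; set T : R := 2 ^+ n.
have T1 : 1 <= T by rewrite exprn_ege1// ler1n.
have T0 : 0 < T by exact: lt_le_trans T1.
have TS : 2 ^+ n.+1 = 2 * T :> R by rewrite exprS.
have T2 : T <= 2 * T by rewrite ler_peMl ?ler1n// ltW.
rewrite TS.
apply: le_trans (Rintegral_norm_cst_bound (K := `|rho| * ((K2 * (2 * T) `^ p) `^ alpha)
  * T `^ (- beta)) T2 (drift_norm_integrable hx _ T1) _) _.
  move=> u /andP[Tu uT]; rewrite /drift.
  have u1 : 1 <= u by rewrite (le_trans T1)// ltW.
  have u0 : 0 < u by exact: lt_le_trans u1.
  rewrite !normrM normfV (ger0_norm (powR_ge0 _ _)) (ger0_norm (powR_ge0 _ _)).
  apply: ler_pM; rewrite ?invr_ge0 ?mulr_ge0 ?powR_ge0//.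
    apply: ler_pM; rewrite ?mulr_ge0 ?powR_ge0//.
      by rewrite ler_piMr// normr_sg; case: (_ != 0).
    apply: ge0_ler_powR; rewrite ?nnegrE ?mulr_ge0 ?powR_ge0//.
    apply: (le_trans (xK u u1)); apply: ler_wpM2l => //.
    by apply: ge0_ler_powR => //; rewrite nnegrE; [exact: ltW|rewrite mulr_ge0// ltW].
  rewrite powRN lef_pV2 ?posrE ?powR_gt0//.
  apply: ge0_ler_powR; rewrite ?nnegrE; [by move: ab a0; lra|exact: ltW|exact: ltW|exact: ltW].
have -> : 2 * T - T = T by ring.
rewrite (@powRM _ K2) ?powR_ge0// -powRrM (@powRM _ 2) ?(ltW T0)//.
rewrite -!mulrA; apply: ler_wpM2l => //; apply: ler_wpM2l; first exact: powR_ge0.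
apply: ler_wpM2l; first exact: powR_ge0.
rewrite -[X in _ * (_ * X)](powRr1 (ltW T0)) -!powRD ?(gt_eqF T0) ?implybT//.
by apply: ler_powR => //; rewrite /p /kap; move: ac; rewrite /kap; nra.
Qed.
End nonneg_exponent.

(** * Discrete occupation estimate *)

Lemma norm_le1Dsqr (R : realType) (v : R) : `|v| <= 1 + v ^+ 2.
Proof. by rewrite -(real_normK (num_real v)); have := normr_ge0 v; nra. Qed.

Section limit_lemmas.
Context d (Omega : measurableType d) (R : realType) (P : probability Omega R).

(** The limsup set lies in the exceptional null set, so the probabilities of the tail unions, which
    contain the A n, decrease to 0. *)
Lemma probability_eventually0 (A : nat -> set Omega) : (forall n, measurable (A n)) ->
  {ae P, forall w, exists n0, forall n, (n0 <= n)%N -> ~ A n w} ->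
  forall e : R, 0 < e -> exists n0, forall n, (n0 <= n)%N -> fine (P (A n)) <= e.
Proof.
move=> mA [N [mN PN HN]] e e0.
have mL : measurable (lim_sup_set A).
  by apply: bigcap_measurable; [exists 0%N|move=> k _; exact: bigcup_measurable].
have L0 : P (lim_sup_set A) = 0%E.
  apply/eqP; rewrite eq_le measure_ge0 andbT.
  have -> : (0 = P N)%E by rewrite PN.
  apply: le_measure; rewrite ?inE// => w Lw; apply: HN => /= -[n0 h].
  by have [n /= nn An] := Lw n0 I; exact: h An.
have mU n : measurable (\bigcup_(k in [set k | (n <= k)%N]) A k) by exact: bigcup_measurable.
have : P (\bigcup_(k in [set k | (n <= k)%N]) A k) @[n --> \oo] --> (0 : \bar R)%E.
  suff <- : P (lim_sup_set A) = 0%E by exact: lim_sup_set_cvg P A mA (le_lt_trans (probability_le1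
    P (mU 0%N)) (ltry 1)).
  exact: L0.
move=> /fine_cvgP[_ /cvgrPdist_le/(_ e e0)[n0 _ h]].
exists n0 => n nn; have := h n nn; rewrite /= sub0r normrN ger0_norm ?fine_probability_ge0//.
apply: le_trans; apply: le_fine_probability; [exact: mA|exact: mU|].
by move=> w Aw; exists n => /=.
Qed.

(* A substitute for Fatou's lemma when V is not bounded below: a bound on the second moments
   gives uniform integrability. *)
Lemma liminf_expectation (V : nat -> Omega -> R) (C : R) :
  (forall n, measurable_fun setT (V n)) ->
  (forall n, P.-integrable setT (EFin \o (fun w => V n w ^+ 2))) ->
  (forall n, \int[P]_w (V n w ^+ 2) <= C) ->
  {ae P, forall w, forall e, 0 < e -> exists n0, forall n, (n0 <= n)%N -> - e <= V n w} ->
  forall e : R, 0 < e -> exists n0, forall n, (n0 <= n)%N -> - e <= \int[P]_w V n w.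
Proof.
move=> mV iV2 VC aeV e e0.
have C0 : 0 <= C by apply: (le_trans _ (VC 0%N)); apply: Rintegral_ge0 => w _; exact: sqr_ge0.
pose A n := V n @^-1` `]-oo, - (e / 2)[.
have mA n : measurable (A n) by rewrite -[X in measurable X]setTI; exact: mV.
have eA : {ae P, forall w, exists n0, forall n, (n0 <= n)%N -> ~ A n w}.
  have e2 : 0 < e / 2 by rewrite divr_gt0.
  apply: filterS aeV => w /(_ _ e2)[n0 h]; exists n0 => n /h.
  by rewrite /A /= in_itv/= ltNge => ->.
pose dl := e / (8 * (C + 1)).
have C1 : 0 < C + 1 by rewrite ltr_wpDl.
have dl0 : 0 < dl by rewrite divr_gt0// mulr_gt0.
have dlC : dl * C <= e / 8.
  have -> : e / 8 = dl * (C + 1) by rewrite /dl; field; rewrite gt_eqF.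
  by rewrite ler_pM2l// lerDl.
have dle0 : 0 < dl * e by rewrite mulr_gt0.
have [n0 h] := probability_eventually0 mA eA dle0; exists n0 => n /h PA.
have i1 : P.-integrable setT (EFin \o (fun w => dl * V n w ^+ 2)) by exact: integrable_realZ.
have i2 : P.-integrable setT (EFin \o (fun w => (4 * dl)^-1 * \1_(A n) w)).
  apply: integrable_realZ; apply: (@bounded_integrable _ _ _ _ _ 1); first exact: measurable_indic.
  by move=> w; rewrite indicE; case: (_ \in _); rewrite ?normr1 ?normr0.
have iV : P.-integrable setT (EFin \o V n).
  apply: (dominated_integrable (Z := fun w => 1 + V n w ^+ 2)) => //.
    by move=> w; exact: norm_le1Dsqr.
  by apply: integrable_realD => //; exact: integrable_realcst.
(* On A n, completing the square gives V >= - dl V^2 - 1 / (4 dl); off A n, V >= - e / 2. In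
   expectation the losses are e / 2, dl C <= e / 8, and P (A n) / (4 dl) <= e / 4. *)
have H : \int[P]_w (- (e / 2) - (dl * V n w ^+ 2 + (4 * dl)^-1 * \1_(A n) w)) <= \int[P]_w V n w.
  apply: le_Rintegral => //.
    by apply: integrable_realB; [exact: integrable_realcst|exact: integrable_realD].
  move=> w _; rewrite indicE; case: (boolP (w \in A n)) => [_|]; rewrite ?mulr1 ?mulr0.
    have -> : - (e / 2) - (dl * V n w ^+ 2 + (4 * dl)^-1) = V n w - (e / 2)
      - (dl * V n w ^+ 2 + V n w + (4 * dl)^-1) by ring.
    have -> : dl * V n w ^+ 2 + V n w + (4 * dl)^-1 = (2 * dl * V n w + 1) ^+ 2 / (4 * dl).
      by field; rewrite gt_eqF.
    have : 0 <= (2 * dl * V n w + 1) ^+ 2 / (4 * dl) by rewrite divr_ge0 ?sqr_ge0// mulr_ge0// ltW.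
    by move: (_ / (4 * dl)) => z; lra.
  rewrite notin_setE /A /= in_itv/= => /negP; rewrite -leNgt => hV.
  have : 0 <= dl * V n w ^+ 2 by rewrite mulr_ge0 ?sqr_ge0// ltW.
  by move: (dl * _) => z; lra.
apply: le_trans H; rewrite RintegralB//; [|exact: integrable_realcst|exact: integrable_realD].
rewrite RintegralD// Rintegral_realcst RintegralZl// RintegralZl//; last first.
  apply: (@bounded_integrable _ _ _ _ _ 1); first exact: measurable_indic.
  by move=> w; rewrite indicE; case: (_ \in _); rewrite ?normr1 ?normr0.
have -> : \int[P]_w (\1_(A n) w) = fine (P (A n)).
  by rewrite /Rintegral integral_indic// setIT.
have h1 : dl * \int[P]_w (V n w ^+ 2) <= e / 8 by rewrite (le_trans _ dlC)// ler_pM2l.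
have h2 : (4 * dl)^-1 * fine (P (A n)) <= e / 4.
  have -> : e / 4 = (4 * dl)^-1 * (dl * e) by field; rewrite gt_eqF.
  by apply: ler_wpM2l => //; rewrite invr_ge0 mulr_ge0// ltW.
by move: h1 h2; move: (dl * _) ((4 * dl)^-1 * _) => z1 z2; lra.
Qed.
End limit_lemmas.

Section gaussian_walk.
Context d (Omega : measurableType d) (R : realType) (P : probability Omega R).

(** The lower moments are interpolated from the fourth: y^2 <= h/2 + y^4 / (2 h) gives 64.5 <= 65,
    and |y|^3 <= (s/2) y^2 + y^4 / (2 s), with s = sqrt h, gives 96.5 <= 100. *)
Lemma gaussian_moments (Y : Omega -> R) (h : R) : 0 < h -> gaussian P Y (Num.sqrt h) ->
  [/\ P.-integrable setT (EFin \o Y), P.-integrable setT (EFin \o (fun w => Y w ^+ 2)),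
      P.-integrable setT (EFin \o (fun w => `|Y w| ^+ 3))
        & P.-integrable setT (EFin \o (fun w => Y w ^+ 4))] /\
  [/\ \int[P]_w Y w = 0, \int[P]_w (Y w ^+ 2) <= 65 * h,
      \int[P]_w (`|Y w| ^+ 3) <= 100 * (h * Num.sqrt h) & \int[P]_w (Y w ^+ 4) <= 128 * h ^+ 2].
Proof.
move=> h0 gY; have s0 : 0 < Num.sqrt h by rewrite sqrtr_gt0.
have [i4 m4] := gaussian_moment4 s0 gY; have [mY _] := gY.
have s2 : Num.sqrt h ^+ 2 = h by rewrite sqr_sqrtr// ltW.
have s4 : Num.sqrt h ^+ 4 = h ^+ 2 by rewrite -[4%N]/(2 * 2)%N exprM s2.
rewrite s4 in m4.
have iD (k l : R) : P.-integrable setT (EFin \o (fun w => k + l * Y w ^+ 4)).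
  by apply: integrable_realD; [exact: integrable_realcst|exact: integrable_realZ].
have b2 w : Y w ^+ 2 <= h / 2 + (2 * h)^-1 * Y w ^+ 4.
  rewrite -subr_ge0 (_ : _ - _ = (Y w ^+ 2 - h) ^+ 2 / (2 * h)); last by field; rewrite gt_eqF.
  by rewrite divr_ge0 ?sqr_ge0// mulr_ge0// ltW.
have i2 : P.-integrable setT (EFin \o (fun w => Y w ^+ 2)).
  apply: (dominated_integrable (Z := fun w => h / 2 + (2 * h)^-1 * Y w ^+ 4)) => //.
    exact: measurable_funX.
  by move=> w; rewrite ger0_norm ?sqr_ge0.
have m2 : \int[P]_w (Y w ^+ 2) <= 65 * h.
  apply: (@le_trans _ _ (\int[P]_w (h / 2 + (2 * h)^-1 * Y w ^+ 4))).
    by apply: le_Rintegral => // w _; exact: b2.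
  rewrite RintegralD//; [|exact: integrable_realcst|exact: integrable_realZ].
  rewrite Rintegral_realcst RintegralZl//.
  have : (2 * h)^-1 * \int[P]_w (Y w ^+ 4) <= (2 * h)^-1 * (128 * h ^+ 2).
    by apply: ler_wpM2l => //; rewrite invr_ge0 mulr_ge0// ltW.
  have -> : (2 * h)^-1 * (128 * h ^+ 2) = 64 * h by field; rewrite gt_eqF.
  by move: (_^-1 * _) => z; lra.
set s := Num.sqrt h in s0 s2 s4 *.
have b3 w : `|Y w| ^+ 3 <= s / 2 * Y w ^+ 2 + (2 * s)^-1 * Y w ^+ 4.
  have -> : Y w ^+ 4 = `|Y w| ^+ 4 by rewrite -normrX ger0_norm// -[4%N]/(2 * 2)%N exprM sqr_ge0.
  have -> : Y w ^+ 2 = `|Y w| ^+ 2 by rewrite -normrX ger0_norm// sqr_ge0.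
  rewrite -subr_ge0 (_ : _ - _ = `|Y w| ^+ 2 * (`|Y w| - s) ^+ 2 / (2 * s)); last by field;
    rewrite gt_eqF.
  by apply: divr_ge0; rewrite mulr_ge0// ?sqr_ge0// ltW.
have iE : P.-integrable setT (EFin \o (fun w => s / 2 * Y w ^+ 2 + (2 * s)^-1 * Y w ^+ 4)).
  by apply: integrable_realD; exact: integrable_realZ.
have i3 : P.-integrable setT (EFin \o (fun w => `|Y w| ^+ 3)).
  apply: (dominated_integrable (Z := fun w => s / 2 * Y w ^+ 2 + (2 * s)^-1 * Y w ^+ 4)) => //.
    by apply: measurable_funX; exact: measurableT_comp.
  by move=> w; rewrite normrX normr_id.
have i1 : P.-integrable setT (EFin \o Y).
  apply: (dominated_integrable (Z := fun w => 1 + Y w ^+ 2)) => //.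
    by move=> w; exact: norm_le1Dsqr.
  by apply: integrable_realD => //; exact: integrable_realcst.
split; split => //.
- exact: gaussian_mean s0 gY i1.
- apply: (@le_trans _ _ (\int[P]_w (s / 2 * Y w ^+ 2 + (2 * s)^-1 * Y w ^+ 4))).
    by apply: le_Rintegral => // w _; exact: b3.
  rewrite RintegralD//; [|exact: integrable_realZ|exact: integrable_realZ].
  rewrite !RintegralZl//.
  have h1 : s / 2 * \int[P]_w (Y w ^+ 2) <= s / 2 * (65 * h).
    by apply: ler_wpM2l => //; rewrite divr_ge0// ltW.
  have h2 : (2 * s)^-1 * \int[P]_w (Y w ^+ 4) <= (2 * s)^-1 * (128 * h ^+ 2).
    by apply: ler_wpM2l => //; rewrite invr_ge0 mulr_ge0// ltW.
  apply: (le_trans (lerD h1 h2)).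
  rewrite -{2}s2 (_ : (2 * s)^-1 * (128 * (s ^+ 2) ^+ 2) = 64 * (s ^+ 2 * s)); last by field;
    rewrite gt_eqF.
  rewrite s2; have : 0 <= h * s by rewrite mulr_ge0// ltW.
  by rewrite [s / 2 * _](_ : _ = (65 / 2) * (h * s)); [move: (h * s) => z; lra|field].
Qed.

Lemma indep_expectation (G : set (set Omega)) (U Y : Omega -> R) (phi : R -> R) :
  G `<=` measurable -> indep_of P G Y -> measurable_fun setT Y -> rv_measurable_wrt G U ->
  measurable_fun setT phi ->
  P.-integrable setT (EFin \o U) -> P.-integrable setT (EFin \o (phi \o Y)) ->
  P.-integrable setT (EFin \o (fun w => U w * phi (Y w))) /\
  \int[P]_w (U w * phi (Y w)) = (\int[P]_w U w) * \int[P]_w phi (Y w).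
Proof.
move=> Gm ind mY mU mphi iU iY; apply: indep_mul => //.
- by move=> _ C mC; rewrite setTI; apply: Gm; exact: mU.
- exact: measurableT_comp.
- move=> A C mA mC; rewrite (_ : (fun x => phi (Y x)) @^-1` C = Y @^-1` (phi @^-1` C))//.
  apply: ind; first exact: mU.
  by rewrite -[X in measurable X]setTI; exact: mphi.
Qed.

Variables (G : nat -> set (set Omega)) (x y : nat -> Omega -> R) (h : R).
Hypotheses (h0 : 0 < h) (sG : forall i, sigma_algebra setT (G i))
  (Gm : forall i, G i `<=` measurable)
  (Gle : forall i, G i `<=` G i.+1) (xG : forall i, rv_measurable_wrt (G i) (x i))
  (yG : forall i, rv_measurable_wrt (G i.+1) (y i))
  (yind : forall i, indep_of P (G i) (y i)) (yg : forall i, gaussian P (y i) (Num.sqrt h)).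

Lemma rvmM i (U V : Omega -> R) : rv_measurable_wrt (G i) U -> rv_measurable_wrt (G i) V ->
  rv_measurable_wrt (G i) (fun w => U w * V w).
Proof.
move=> mU mV; apply: (@rvm_comp2 _ _ _ _ _ _ (fun p => p.1 * p.2)) => //.
by apply: measurable_funM; [exact: measurable_fst|exact: measurable_snd].
Qed.

Lemma rvmD i (U V : Omega -> R) : rv_measurable_wrt (G i) U -> rv_measurable_wrt (G i) V ->
  rv_measurable_wrt (G i) (fun w => U w + V w).
Proof.
move=> mU mV; apply: (@rvm_comp2 _ _ _ _ _ _ (fun p => p.1 + p.2)) => //.
by apply: measurable_funD; [exact: measurable_fst|exact: measurable_snd].
Qed.

Let rvm_meas i (U : Omega -> R) : rv_measurable_wrt (G i) U -> measurable_fun setT U.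
Proof. by move=> mU _ C mC; rewrite setTI; apply: Gm; exact: mU. Qed.

Let ym i : measurable_fun setT (y i). Proof. by case: (yg i). Qed.

(** Orthogonality of martingale increments: the past sum times f (x k) is measurable with respect to
    G k, so its product with the independent centred y k has mean zero and the second moments add
    up. *)
Lemma martingale_transform_moment (f : R -> R) (L : R)
  k : measurable_fun setT f -> (forall u, `|f u| <= L) ->
  [/\ rv_measurable_wrt (G k) (fun w => \sum_(i < k) f (x i w) * y i w),
   P.-integrable setT (EFin \o (fun w => (\sum_(i < k) f (x i w) * y i w) ^+ 2)) &
   \int[P]_w ((\sum_(i < k) f (x i w) * y i w) ^+ 2) <= k%:R * (L ^+ 2 * (65 * h))].
Proof.
move=> mf fL; elim: k => [|k [IH1 IH2 IH3]].
  have E : (fun w : Omega => (\sum_(i < 0) f (x i w) * y i w)) = fun=> 0 by apply/funext => w;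
    rewrite big_ord0.
  rewrite E; split.
  - move=> C mC; rewrite preimage_cst; case: ifP => _; last by case: (sG 0%N).
    by rewrite -setC0; apply: (sigma_algebraC (sG 0%N)); case: (sG 0%N).
  - by under [X in EFin \o X]eq_fun do rewrite big_ord0 expr0n; exact: integrable_realcst.
  - under eq_Rintegral do rewrite big_ord0 expr0n; by rewrite Rintegral_realcst mul0r.
pose M w := \sum_(i < k) f (x i w) * y i w.
have fx : rv_measurable_wrt (G k) (fun w => f (x k w)) by exact: (rvm_comp mf (xG k)).
have [[iy iy2 _ _] [m1 m2 _ _]] := gaussian_moments h0 (yg k).
have mM := rvm_meas IH1.
have iM : P.-integrable setT (EFin \o M).
  apply: (dominated_integrable (Z := fun w => 1 + M w ^+ 2)) => //.
    by move=> w; exact: norm_le1Dsqr.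
  by apply: integrable_realD => //; exact: integrable_realcst.
have iMf : P.-integrable setT (EFin \o (fun w => M w * f (x k w))).
  apply: (dominated_integrable (Z := fun w => L * `|M w|)) => //.
  - by apply: measurable_funM => //; exact: rvm_meas fx.
  - by move=> w; rewrite normrM mulrC; apply: ler_wpM2r.
  - by apply: integrable_realZ; have := integrable_norm iM.
have [iMy EMy] := indep_expectation (@Gm k) (@yind k) (@ym k) (rvmM IH1 fx)
  (@measurable_id _ _ setT) iMf iy.
rewrite m1 mulr0 in EMy.
have L0 : 0 <= L by apply: le_trans (fL 0).
have bf2 w : (f (x k w)) ^+ 2 <= L ^+ 2.
  by rewrite -[leLHS]ger0_norm ?sqr_ge0// normrX lerXn2r// nnegrE.
have if2y2 : P.-integrable setT (EFin \o (fun w => (f (x k w)) ^+ 2 * y k w ^+ 2)).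
  apply: (dominated_integrable (Z := fun w => L ^+ 2 * y k w ^+ 2)).
  - by apply: measurable_funM; apply: measurable_funX => //; exact: rvm_meas fx.
  - move=> w; rewrite ger0_norm; first by apply: ler_wpM2r => //; exact: sqr_ge0.
    by rewrite mulr_ge0 ?sqr_ge0.
  - exact: integrable_realZ.
have E w : (\sum_(i < k.+1) f (x i w) * y i w) ^+ 2 =
    (M w ^+ 2 + 2 * ((M w * f (x k w)) * y k w)) + (f (x k w)) ^+ 2 * y k w ^+ 2.
  by rewrite big_ord_recr/= -/(M w); ring.
have iA : P.-integrable setT (EFin \o (fun w => M w ^+ 2 + 2 * ((M w * f (x k w)) * y k w))).
  by apply: integrable_realD => //; exact: integrable_realZ.
split.
- have -> : (fun w => \sum_(i < k.+1) f (x i w) * y i w) = (fun w => M w + f (x k w) * y k w).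
    by apply/funext => w; rewrite big_ord_recr.
  apply: rvmD; first by move=> C mC; apply: Gle; exact: IH1.
  by apply: rvmM => //; move=> C mC; apply: Gle; exact: fx.
- by under [X in EFin \o X]eq_fun do rewrite E; exact: integrable_realD.
- under eq_Rintegral do rewrite E.
  rewrite RintegralD// RintegralD//; last exact: integrable_realZ.
  rewrite RintegralZl// EMy mulr0 addr0 -natr1 mulrDl mul1r; apply: lerD => //.
  apply: (@le_trans _ _ (\int[P]_w (L ^+ 2 * y k w ^+ 2))).
    apply: le_Rintegral => //; first exact: integrable_realZ.
    by move=> w _; apply: ler_wpM2r => //; exact: sqr_ge0.
  by rewrite RintegralZl//; apply: ler_wpM2l => //; exact: sqr_ge0.
Qed.
End gaussian_walk.

Lemma sqr_sum_le (R : realType) n (a : nat -> R) :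
  (\sum_(i < n) a i) ^+ 2 <= n%:R * \sum_(i < n) a i ^+ 2.
Proof.
elim: n => [|n IH]; first by rewrite !big_ord0 expr0n mul0r.
rewrite !big_ord_recr/=; case: n IH => [|n] IH.
  by rewrite !big_ord0 !add0r mul1r.
set S := \sum_(i < _) a i in IH *; set T := \sum_(i < _) _ in IH *.
have n0 : 0 < n.+1%:R :> R by rewrite ltr0n.
rewrite -[n.+2%:R]natr1; set m : R := n.+1%:R in IH n0 *.
have : 0 <= (S - m * a n.+1) ^+ 2 / m by rewrite divr_ge0 ?sqr_ge0// ltW.
have -> : (S - m * a n.+1) ^+ 2 / m = S ^+ 2 / m - 2 * S * a n.+1 + m * a n.+1 ^+ 2.
  by field; rewrite gt_eqF.
have : S ^+ 2 / m <= T by rewrite ler_pdivrMr// mulrC.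
have -> : (S + a n.+1) ^+ 2 = S ^+ 2 + 2 * S * a n.+1 + a n.+1 ^+ 2 by ring.
have -> : (m + 1) * (T + a n.+1 ^+ 2) = m * T + T + m * a n.+1 ^+ 2 + a n.+1 ^+ 2 by ring.
by move: IH; clearbody S T m; lra.
Qed.

Section walk_sum.
Context d (Omega : measurableType d) (R : realType) (P : probability Omega R).
Variables (G : nat -> set (set Omega)) (x y : nat -> Omega -> R) (h : R).
Hypotheses (h0 : 0 < h) (sG : forall i, sigma_algebra setT (G i))
  (Gm : forall i, G i `<=` measurable)
  (Gle : forall i, G i `<=` G i.+1) (xG : forall i, rv_measurable_wrt (G i) (x i))
  (yG : forall i, rv_measurable_wrt (G i.+1) (y i))
  (yind : forall i, indep_of P (G i) (y i)) (yg : forall i, gaussian P (y i) (Num.sqrt h)).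
Variables (f f1 g : R -> R) (L c1 c2 c : R).
Hypotheses (mf : measurable_fun setT f) (mf1 : measurable_fun setT f1) (mg : measurable_fun setT g)
  (f1L : forall u, `|f1 u| <= L) (f2 : forall u v, `|f (u + v) - f u - f1 u * v| <= L * v ^+ 2)
  (f3 : forall u v, (c1 * g u - c2) * v ^+ 2 / 2 - L * `|v| ^+ 3 <= f (u + v) - f u - f1 u * v)
  (gL : forall u, 0 <= g u <= L) (c10 : 0 <= c1) (c20 : 0 <= c2)
  (hc : forall Y s, 0 < s -> gaussian P Y s -> c * s ^+ 2 <= \int[P]_w (Y w ^+ 2)).

Let L0 : 0 <= L. Proof. exact: le_trans (f1L 0). Qed.
Let xm i : measurable_fun setT (x i).
Proof. by move=> _ C mC; rewrite setTI; apply: (@Gm i); exact: xG. Qed.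
Let ym i : measurable_fun setT (y i). Proof. by case: (yg i). Qed.

(** Each term moves x i by the independent increment alone. The sum does not telescope, since x i.+1
    also contains the drift; that discrepancy is treated path by path. *)
Let N n w := \sum_(i < n) (f (x i w + y i w) - f (x i w)).

Lemma walk_sum_measurable n : measurable_fun setT (N n).
Proof.
apply: measurable_sum => i; apply: measurable_funB; apply: measurableT_comp => //.
exact: measurable_funD.
Qed.

(** N is a martingale transform plus a Taylor remainder of size L times the sum of the y^2, squared
    by Cauchy-Schwarz. When n h is fixed the bound does not depend on the mesh, as
    [liminf_expectation] demands. *)
Lemma walk_sum_moment2 n :
  P.-integrable setT (EFin \o (fun w => N n w ^+ 2)) /\
  \int[P]_w (N n w ^+ 2) <= 2 * (n%:R * (L ^+ 2 * (65 * h)))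
    + 2 * (L ^+ 2 * (n%:R * (n%:R * (128 * h ^+ 2)))).
Proof.
have [_ iM EM] := martingale_transform_moment h0 sG Gm Gle xG yG yind yg n mf1 f1L.
set M := fun w => \sum_(i < n) f1 (x i w) * y i w.
have i4 i : (i < n)%N -> P.-integrable setT (EFin \o (fun w => y i w ^+ 4)).
  by move=> _; have [[]] := gaussian_moments h0 (yg i).
have iS4 := integrable_realsum i4.
have bN w : N n w ^+ 2 <= 2 * M w ^+ 2 + 2 * (L ^+ 2 * (n%:R * \sum_(i < n) y i w ^+ 4)).
  pose r := N n w - M w.
  have hr : `|r| <= L * \sum_(i < n) y i w ^+ 2.
    rewrite /r /N /M -sumrB (le_trans (ler_norm_sum _ _ _))// mulr_sumr; apply: ler_sum => i _.
    exact: f2.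
  have hr2 : r ^+ 2 <= L ^+ 2 * (n%:R * \sum_(i < n) y i w ^+ 4).
    rewrite -(real_normK (num_real r)).
    apply: (@le_trans _ _ ((L * \sum_(i < n) y i w ^+ 2) ^+ 2)).
      by rewrite lerXn2r// nnegrE// (le_trans (normr_ge0 r)).
    rewrite exprMn; apply: ler_wpM2l; first exact: sqr_ge0.
    apply: (le_trans (sqr_sum_le n (fun i => y i w ^+ 2))).
    by apply: ler_wpM2l => //; apply: ler_sum => i _; rewrite -exprM.
  have -> : N n w = M w + r by rewrite /r; ring.
  have : 0 <= (M w - r) ^+ 2 by exact: sqr_ge0.
  have -> : (M w - r) ^+ 2 = 2 * M w ^+ 2 + 2 * r ^+ 2 - (M w + r) ^+ 2 by ring.
  by move: hr2; move: (L ^+ 2 * _) ((M w + r) ^+ 2) (r ^+ 2) (M w ^+ 2) => z1 z2 z3 z4; lra.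
have iE : P.-integrable setT (EFin \o (fun w => 2 * M w ^+ 2 + 2 * (L ^+ 2 * (n%:R * \sum_(i < n)
  y i w ^+ 4)))).
  by apply: integrable_realD; do ?apply: integrable_realZ.
have iN : P.-integrable setT (EFin \o (fun w => N n w ^+ 2)).
  apply: dominated_integrable iE; first by apply: measurable_funX; exact: walk_sum_measurable.
  by move=> w; rewrite ger0_norm ?sqr_ge0.
split=> //.
apply: (@le_trans _ _ (\int[P]_w (2 * M w ^+ 2 + 2 * (L ^+ 2 * (n%:R * \sum_(i < n) y i w ^+ 4))))).
  by apply: le_Rintegral => // w _.
rewrite RintegralD//; do ?apply: integrable_realZ => //.
rewrite !RintegralZl//; do ?apply: integrable_realZ => //.
apply: lerD; first by rewrite ler_pM2l.
rewrite ler_pM2l//; apply: ler_wpM2l; first exact: sqr_ge0.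
apply: ler_wpM2l => //; rewrite (@Rintegral_realsum _ _ _ _ n (fun i w => y i w ^+ 4))//.
have -> (K : R) : n%:R * K = \sum_(i < n) K by rewrite sumr_const card_ord mulr_natl.
apply: ler_sum => i _.
by have [_ []] := gaussian_moments h0 (yg i).
Qed.

Lemma walk_sum_integrable n : P.-integrable setT (EFin \o N n).
Proof.
have [i2 _] := walk_sum_moment2 n.
apply: (dominated_integrable (Z := fun w => 1 + N n w ^+ 2)).
- exact: walk_sum_measurable.
- by move=> w; exact: norm_le1Dsqr.
- by apply: integrable_realD => //; exact: integrable_realcst.
Qed.

Lemma walk_g_integrable i : P.-integrable setT (EFin \o (fun w => g (x i w))).
Proof.
apply: (@bounded_integrable _ _ _ _ _ L); first exact: measurableT_comp.
by move=> w; rewrite ger0_norm; have /andP[] := gL (x i w).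
Qed.

(** Expectation of the lower Taylor bound term by term: the first-order term has mean zero, the g
    term factors by independence and is at least c h times the mean of g, and the cubic term is of
    order h^(3/2), negligible after summation. *)
Lemma walk_sum_expectation n :
  c1 / 2 * (c * h) * \sum_(i < n) \int[P]_w g (x i w)
  - n%:R * (c2 / 2 * (65 * h) + L * (100 * (h * Num.sqrt h))) <= \int[P]_w N n w.
Proof.
pose A i w := f1 (x i w) * y i w.
pose D i w := g (x i w) * y i w ^+ 2.
pose T i w := A i w + c1 / 2 * D i w - (c2 / 2 * y i w ^+ 2 + L * `|y i w| ^+ 3).
have hs : h = Num.sqrt h ^+ 2 by rewrite sqr_sqrtr// ltW.
have f1x i : rv_measurable_wrt (G i) (fun w => f1 (x i w)) by exact: (rvm_comp mf1 (xG i)).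
have gx i : rv_measurable_wrt (G i) (fun w => g (x i w)) by exact: (rvm_comp mg (xG i)).
have HA i : P.-integrable setT (EFin \o A i) /\ \int[P]_w A i w = 0.
  have [[iy _ _ _] [m1 _ _ _]] := gaussian_moments h0 (yg i).
  have if1 : P.-integrable setT (EFin \o (fun w => f1 (x i w))).
    by apply: (@bounded_integrable _ _ _ _ _ L) => //; exact: measurableT_comp.
  have [iA EA] := indep_expectation (@Gm i) (@yind i) (@ym i) (f1x i) (@measurable_id _ _ setT) if1 iy.
  by rewrite EA m1 mulr0.
have HD i : P.-integrable setT (EFin \o D i) /\ c * h * \int[P]_w g (x i w) <= \int[P]_w D i w.
  have [[_ iy _ _] _] := gaussian_moments h0 (yg i).
  have [iD ED] := indep_expectation (@Gm i) (@yind i) (@ym i) (gx i) (exprn_measurable 2)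
    (walk_g_integrable i) iy.
  split => //; rewrite /D ED mulrC; apply: ler_wpM2l.
    by apply: Rintegral_ge0 => w _; have /andP[] := gL (x i w).
  by rewrite {1}hs; apply: hc; rewrite ?sqrtr_gt0.
have HB i : P.-integrable setT (EFin \o (fun w => c2 / 2 * y i w ^+ 2 + L * `|y i w| ^+ 3)) /\
   \int[P]_w (c2 / 2 * y i w ^+ 2 + L * `|y i w| ^+ 3) <= c2 / 2 * (65 * h)
     + L * (100 * (h * Num.sqrt h)).
  have [[_ i2 i3 _] [_ m2 m3 _]] := gaussian_moments h0 (yg i).
  split; first by apply: integrable_realD; exact: integrable_realZ.
  rewrite RintegralD; [|by []|exact: integrable_realZ|exact: integrable_realZ].
  rewrite !RintegralZl//; apply: lerD; apply: ler_wpM2l => //.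
  by rewrite divr_ge0.
have iAD i : P.-integrable setT (EFin \o (fun w => A i w + c1 / 2 * D i w)).
  by apply: integrable_realD; [case: (HA i)|apply: integrable_realZ; case: (HD i)].
have iT i : P.-integrable setT (EFin \o T i).
  by apply: integrable_realB => //; case: (HB i).
have ET i : c1 / 2 * (c * h) * \int[P]_w g (x i w) - (c2 / 2 * (65 * h)
  + L * (100 * (h * Num.sqrt h))) <= \int[P]_w T i w.
  have [iA EA] := HA i; have [iD ED] := HD i; have [iB EB] := HB i.
  rewrite /T RintegralB// RintegralD//; last exact: integrable_realZ.
  rewrite RintegralZl// EA add0r; apply: lerB => //.
  by rewrite -mulrA; apply: ler_wpM2l => //; rewrite divr_ge0.
apply: (@le_trans _ _ (\int[P]_w \sum_(i < n) T i w)).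
  rewrite Rintegral_realsum//.
  have -> (K : R) : n%:R * K = \sum_(i < n) K by rewrite sumr_const card_ord mulr_natl.
  rewrite mulr_sumr -sumrB.
  by apply: ler_sum => i _; exact: ET.
apply: le_Rintegral => //.
- by apply: integrable_realsum => i _; exact: iT.
- exact: walk_sum_integrable.
- move=> w _; apply: ler_sum => i _; rewrite /T /A /D.
  have := f3 (x i w) (y i w).
  have -> : (c1 * g (x i w) - c2) * y i w ^+ 2 / 2 = c1 / 2 * (g (x i w) * y i w ^+ 2)
    - c2 / 2 * y i w ^+ 2 by field.
  by move: (c1 / 2 * _) (c2 / 2 * _) (L * _) (f1 _ * _) (f _) (f _) => z1 z2 z3 z4 z5 z6; lra.
Qed.
End walk_sum.

(** * The change-of-variables inequality along a single path *)

Section path_riemann.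
Variables (R : realType) (rho alpha beta : R).

(** The location of z is expressed by balls: one containing p and q contains z. This avoids any case
    distinction on the order of p and q. *)
Lemma mvt_between (f f1 : R -> R) (p q : R) : (forall u : R, is_derive u 1 f (f1 u)) ->
  exists2 z, f p - f q = f1 z * (p - q) & forall m r,
    `|p - m| <= r -> `|q - m| <= r -> `|z - m| <= r.
Proof.
move=> df.
have cf u v : {within `[u, v], continuous f}.
  apply: continuous_subspaceT => w; apply: differentiable_continuous.
  by apply/derivable1_diffP; have [] := df w.
have key u v : u < v -> exists2 z, f v - f u = f1 z * (v - u)
  & forall m r, `|v - m| <= r -> `|u - m| <= r -> `|z - m| <= r.
  move=> uv; have [z /[!in_itv]/= /andP[uz zv] E] := MVT uv (fun w _ => df w) (cf u v).
  exists z => // m r; rewrite !ler_norml => /andP[h1 h2] /andP[h3 h4]; apply/andP; split.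
    by rewrite (le_trans h3)// lerD2r ltW.
  by rewrite (le_trans _ h2)// lerD2r ltW.
case: (ltgtP p q) => [pq|qp|->].
- have [z E H] := key _ _ pq; exists z; last by move=> m r h1 h2; exact: H.
  by rewrite -opprB E -mulrN opprB.
- by have [z E H] := key _ _ qp; exists z.
- by exists q => //; rewrite !subrr mulr0.
Qed.

Variables (x b : R -> R) (x0 : R).
Hypothesis hx : path_solution rho alpha beta x b x0.
Notation mu s := (drift rho alpha beta s (x s)).
Variables (f f1 g : R -> R) (L k : R).
Hypotheses (df : forall u : R, is_derive u 1 f (f1 u)) (f01 : forall u, 0 <= f u <= 1)
  (f1L : forall u v, `|f1 u - f1 v| <= L * `|u - v|)
  (gL : forall u v, `|g u - g v| <= L * `|u - v|) (k0 : 0 <= k).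

(* f (x s + (b t - b s)) differs from f (x t) by f1 times the drift over the cell; since
   |f1| * |drift| <= k * g, the singularity of the drift is cancelled by f1. *)
Lemma cell_bound (s t w : R) : 1 <= s -> s <= t -> 0 <= w ->
  (forall u, s <= u <= t -> `|x u - x s| <= w) -> `|b t - b s| <= w ->
  (forall r u, s <= r <= t -> `|f1 u| * `|drift rho alpha beta r u| <= k * g u) ->
  f (x s + (b t - b s)) - f (x t) <= k * g (x s) * (t - s) + k * L * w * (t - s)
    + 2 * L * w * \int[lebesgue_measure]_(u in `]s, t]) `|mu u|.
Proof.
move=> s1 st w0 xw bw fg.
have L0 : 0 <= L by have := f1L 1 0; rewrite subr0 normr1 mulr1; exact: le_trans.
have [z -> zw] := mvt_between (x s + (b t - b s)) (x t) df.
have zs : `|z - x s| <= w.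
  by apply: zw; [rewrite addrAC subrr add0r|apply: xw; rewrite st lexx].
have -> : x s + (b t - b s) - x t = - \int[lebesgue_measure]_(u in `]s, t]) mu u.
  by have := path_increment hx s1 st; move: (Rintegral _ _ _) => I; lra.
have E : \int[lebesgue_measure]_(u in `]s, t]) (- f1 z * mu u)
  = - f1 z * \int[lebesgue_measure]_(u in `]s, t]) mu u.
  by apply: RintegralZl => //; exact: (drift_integrable hx t s1).
rewrite mulrN -mulNr -E.
apply: (@le_trans _ _ (\int[lebesgue_measure]_(u in `]s, t]) (k * (g (x s) + L * w)
  + 2 * L * w * `|mu u|))).
  apply: le_Rintegral => //.
  - exact: (integrableZl _ (- f1 z) (drift_integrable hx t s1)).
  - have mI : measurable (`]s, t]%classic : set (measurableTypeR R)) by exact: measurable_itv.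
    have iZ := integrableZl mI (2 * L * w) (drift_norm_integrable hx t s1).
    exact: (integrableD mI (lebesgue_integrable_cst s t (k * (g (x s) + L * w))) iZ).
  move=> u /=; rewrite in_itv/= => /andP[su ut].
  have sut : s <= u <= t by rewrite ut ltW.
  rewrite (le_trans (ler_norm _))// normrM normrN.
  (* z and x u are both within w of x s, so f1 may be evaluated at x u, the point where the drift is
     taken, at a cost of 2 L w; only there does [fg] cancel the singularity. *)
  have hz : `|f1 z| <= `|f1 (x u)| + 2 * L * w.
    have -> : f1 z = f1 (x u) + (f1 z - f1 (x u)) by ring.
    rewrite (le_trans (ler_normD _ _))// lerD2l (le_trans (f1L _ _))//.
    rewrite [2 * L]mulrC -mulrA; apply: ler_wpM2l => //.
    have -> : z - x u = (z - x s) - (x u - x s) by ring.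
    by rewrite (le_trans (ler_normB _ _))// mulr2n mulrDl mul1r lerD// xw.
  apply: (le_trans (ler_wpM2r (normr_ge0 _) hz)); rewrite mulrDl lerD2r.
  apply: (le_trans (fg u (x u) sut)); apply: ler_wpM2l => //.
  have h := gL (x u) (x s); rewrite -lerBlDl (le_trans (ler_norm _))// (le_trans h)//.
  by apply: ler_wpM2l => //; exact: xw.
rewrite RintegralD//.
- rewrite Rintegral_lebesgue_cst// RintegralZl//; last exact: (drift_norm_integrable hx t s1).
  by rewrite le_eqVlt; apply/orP; left; apply/eqP; ring.
- exact: lebesgue_integrable_cst.
- exact: (integrableZl _ (2 * L * w) (drift_norm_integrable hx t s1)).
Qed.

Variables (a e : R).
Hypotheses (a1 : 1 <= a) (ae : a < e) (cb : {within `[0, +oo[, continuous b})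
  (fg : forall r u, a <= r <= e -> `|f1 u| * `|drift rho alpha beta r u| <= k * g u).

Let h n : R := (e - a) / n.+1%:R.
Let t n i : R := a + i%:R * h n.

(** Summing [cell_bound] leaves a telescoping sum of f, at most 1, and errors proportional to the
    oscillation w over a cell. They vanish with the mesh because the drift has finite total
    variation V on the path. *)
Lemma path_sum_liminf eps : 0 < eps -> exists n0, forall n, (n0 <= n)%N ->
  - eps <= 1 + k * (h n * \sum_(i < n.+1) g (x (t n i)))
   - \sum_(i < n.+1) (f (x (t n i) + (b (t n i.+1) - b (t n i))) - f (x (t n i))).
Proof.
move=> eps0.
have ea0 : 0 < e - a by rewrite subr_gt0.
have L0 : 0 <= L by have := f1L 1 0; rewrite subr0 normr1 mulr1; exact: le_trans.
pose V := \int[lebesgue_measure]_(u in `]a, e]) `|mu u|.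
have V0 : 0 <= V by exact: Rintegral_ge0.
pose K := k * L * (e - a) + 2 * L * V + 1.
have K0 : 0 < K by rewrite /K ltr_wpDl// addr_ge0// !mulr_ge0// ltW.
pose w := eps / K.
have w0 : 0 < w by rewrite divr_gt0.
have sub1 : `[a, e]%classic `<=` `[1, +oo[%classic.
  by move=> u /=; rewrite !in_itv/= andbT => /andP[au _]; rewrite (le_trans a1).
have sub0 : `[a, e]%classic `<=` `[0, +oo[%classic.
  by move=> u /=; rewrite !in_itv/= andbT => /andP[au _];
    rewrite (le_trans _ au)// (le_trans ler01).
have cx : {within `[a, e], continuous x} by apply: continuous_subspaceW sub1 _; case: hx.
have cb' : {within `[a, e], continuous b} by exact: continuous_subspaceW sub0 _.
have [d1 d10 D1] := segment_unif_continuous cx w0.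
have [d2 d20 D2] := segment_unif_continuous cb' w0.
pose d := Num.min d1 d2.
have d0 : 0 < d by rewrite lt_min d10.
exists (Num.truncn ((e - a) / d)) => n nn.
have n1 : 0 < n.+1%:R :> R by rewrite ltr0n.
have h0 : 0 < h n by rewrite divr_gt0.
have hd : h n < d.
  by rewrite /h ltr_pdivrMr// mulrC -ltr_pdivrMr// (lt_le_trans (truncnS_gt _))// ler_nat ltnS.
have tS i : t n i.+1 - t n i = h n by rewrite /t -natr1; ring.
have tn : t n n.+1 = e by rewrite /t /h mulrCA divff ?gt_eqF// mulr1 addrC subrK.
have tle i j : (i <= j)%N -> t n i <= t n j.
  by move=> ij; rewrite /t lerD2l ler_pM2r// ler_nat.
have t0 : t n 0 = a by rewrite /t mul0r addr0.
have at' i : a <= t n i by rewrite -t0 tle.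
have te i : (i <= n.+1)%N -> t n i <= e by move=> ?; rewrite -tn tle.
have t1 i : 1 <= t n i := le_trans a1 (at' i).
have tnext i : t n i <= t n i.+1 by exact: tle.
pose W i := \int[lebesgue_measure]_(u in `](t n i), (t n i.+1)]) `|mu u|.
have WV m : \sum_(i < m) W i = \int[lebesgue_measure]_(u in `]a, (t n m)]) `|mu u|.
  elim: m => [|m IH]; first by rewrite big_ord0 t0 set_itv_ge ?bnd_simp// Rintegral_set0.
  by rewrite big_ord_recr/= IH (drift_norm_split hx a1 (at' m) (tnext m)).
have cell i : (i < n.+1)%N ->
  f (x (t n i) + (b (t n i.+1) - b (t n i))) - f (x (t n i.+1)) <=
  k * g (x (t n i)) * h n + k * L * w * h n + 2 * L * w * W i.
  move=> ni; rewrite -(tS i); apply: cell_bound => //; first exact: ltW.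
  - move=> u /andP[tu ut]; apply/ltW/D1.
    + by rewrite at' te// ltnW.
    + by rewrite (le_trans (at' i))// (le_trans ut)// te.
    + rewrite ger0_norm ?subr_ge0// (le_lt_trans (_ : _ <= h n))//; first by rewrite -(tS i) lerD2r.
      by rewrite (lt_le_trans hd)// ge_min lexx.
  - apply/ltW/D2.
    + by rewrite at' te// ltnW.
    + by rewrite at' te.
    + by rewrite tS gtr0_norm// (lt_le_trans hd)// ge_min lexx orbT.
  - move=> r u /andP[tr rt]; apply: fg; rewrite (le_trans (at' i))// (le_trans rt)// te//.
have tele m : \sum_(i < m) (f (x (t n i.+1)) - f (x (t n i))) = f (x (t n m)) - f (x a).
  elim: m => [|m IH]; first by rewrite big_ord0 t0 subrr.
  by rewrite big_ord_recr/= IH; ring.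
have S1 : \sum_(i < n.+1) (f (x (t n i) + (b (t n i.+1) - b (t n i))) - f (x (t n i.+1))) <=
   k * (h n * \sum_(i < n.+1) g (x (t n i))) + k * L * w * (e - a) + 2 * L * w * V.
  apply: (@le_trans _ _ (\sum_(i < n.+1) (k * g (x (t n i))
    * h n + k * L * w * h n + 2 * L * w * W i))).
    by apply: ler_sum => i _; exact: cell.
  rewrite !big_split/=.
  have -> : \sum_(i < n.+1) k * g (x (t n i)) * h n = k * (h n * \sum_(i < n.+1) g (x (t n i))).
    by rewrite !mulr_sumr; apply: eq_bigr => i _; ring.
  have -> : \sum_(i < n.+1) k * L * w * h n = k * L * w * (e - a).
    by rewrite sumr_const card_ord -mulr_natl /h; field; rewrite gt_eqF.
  by rewrite -mulr_sumr WV tn.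
have S2 : \sum_(i < n.+1) (f (x (t n i) + (b (t n i.+1) - b (t n i))) - f (x (t n i))) =
  \sum_(i < n.+1) (f (x (t n i) + (b (t n i.+1) - b (t n i))) - f (x (t n i.+1)))
    + (f (x (t n n.+1)) - f (x a)).
  by rewrite -tele -big_split/=; apply: eq_bigr => i _; ring.
rewrite S2.
have F : f (x (t n n.+1)) - f (x a) <= 1.
  by have /andP[_ ?] := f01 (x (t n n.+1)); have /andP[? _] := f01 (x a); lra.
have wK : k * L * w * (e - a) + 2 * L * w * V <= eps.
  have -> : eps = w * K by rewrite /w divfK// gt_eqF.
  have -> : k * L * w * (e - a) + 2 * L * w * V = w * (k * L * (e - a) + 2 * L * V) by ring.
  by rewrite ler_pM2l// /K lerDl.
by move: S1 F wK; move: (\sum_(i < n.+1) _) (k * (h n * _)) (k * L * w * _) (2 * L * w * V)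
  (_ - f (x a)) => z1 z2 z3 z4 z5; lra.
Qed.
End path_riemann.

Section occupation.
Context d (Omega : measurableType d) (R : realType) (P : probability Omega R)
  (F : R -> set (set Omega)) (B X : R -> Omega -> R) (rho alpha beta x0 : R).
Hypotheses (hF : is_filtration F) (hB : is_F_brownian P F B)
  (adX : forall t, 1 <= t -> rv_measurable_wrt (F t) (X t))
  (aeX : {ae P, forall w, path_solution rho alpha beta (X ^~ w) (B ^~ w) x0}).
Variables (f f1 g : R -> R) (L k c1 c2 c a e : R).
Hypotheses (df : forall u : R, is_derive u 1 f (f1 u)) (f01 : forall u, 0 <= f u <= 1)
  (mf : measurable_fun setT f) (mf1 : measurable_fun setT f1) (mg : measurable_fun setT g)
  (f1b : forall u, `|f1 u| <= L)
  (f1L : forall u v, `|f1 u - f1 v| <= L * `|u - v|)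
  (gL : forall u v, `|g u - g v| <= L * `|u - v|) (gb : forall u, 0 <= g u <= L)
  (f3 : forall u v, (c1 * g u - c2) * v ^+ 2 / 2 - L * `|v| ^+ 3 <= f (u + v) - f u - f1 u * v)
  (k0 : 0 <= k) (c10 : 0 <= c1) (c20 : 0 <= c2)
  (hc : forall Y s, 0 < s -> gaussian P Y s -> c * s ^+ 2 <= \int[P]_w (Y w ^+ 2))
  (a1 : 1 <= a) (ae : a < e) (kc : k <= c1 * c / 4)
  (fg : forall r u, a <= r <= e -> `|f1 u| * `|drift rho alpha beta r u| <= k * g u).

Let h n : R := (e - a) / n.+1%:R.
Let t n i : R := a + i%:R * h n.

(* Ito's formula for f (X), with telescoping sums over a grid: the increments of B give at least
   c1 * c / 2 times the occupation sum of g, the drift takes away at most half of it, and the sum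
   of the increments of f along the path is at most 1 because 0 <= f <= 1. *)
Lemma occupation_discrete : exists n0, forall n, (n0 <= n)%N ->
  c1 * c / 4 * \int[P]_w (h n * \sum_(i < n.+1) g (X (t n i) w)) <= 3 + c2 * 65 / 2 * (e - a).
Proof.
have ea0 : 0 < e - a by rewrite subr_gt0.
have L0 : 0 <= L by exact: le_trans (f1b 0).
have n1 n : 0 < n.+1%:R :> R by rewrite ltr0n.
have h0 n : 0 < h n by rewrite divr_gt0.
have nh n : n.+1%:R * h n = e - a by rewrite /h mulrC divfK// gt_eqF.
have tS n i : t n i.+1 - t n i = h n by rewrite /t -natr1; ring.
have tlt n i : t n i < t n i.+1 by rewrite -subr_gt0 tS.
have ta n i : a <= t n i by rewrite /t lerDl mulr_ge0// ltW.
have t1 n i : 1 <= t n i := le_trans a1 (ta n i).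
have t0 n i : 0 <= t n i := le_trans ler01 (t1 n i).
have sF s : sigma_algebra setT (F s) by case: hF.
have mF s : F s `<=` measurable by case: hF => _ [].
have leF s u : s <= u -> F s `<=` F u by case: hF => _ [_]; exact.
pose G n i := F (t n i).
pose y n i w := B (t n i.+1) w - B (t n i) w.
have adB u : 0 <= u -> rv_measurable_wrt (F u) (B u) by case: hB => hh _; exact: hh.
have Gle n i : G n i `<=` G n i.+1 by apply: leF; exact: ltW.
have xG n i : rv_measurable_wrt (G n i) (X (t n i)) by exact: adX.
have yG n i : rv_measurable_wrt (G n i.+1) (y n i).
  apply: (rvm_sub hF (adB _ (t0 n i.+1))); exact: (rvm_le hF (ltW (tlt n i)) (adB _ (t0 n i))).
have yind n i : indep_of P (G n i) (y n i) by exact: (brownian_indep hB (t0 n i) (tlt n i)).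
have yg n i : gaussian P (y n i) (Num.sqrt (h n)).
  by rewrite -(tS n i); exact: (brownian_increment hF hB (t0 n i) (tlt n i)).
have f2 u v : `|f (u + v) - f u - f1 u * v| <= L * v ^+ 2.
  have [z E Hz] := mvt_between (u + v) u df.
  have zu : `|z - u| <= `|v| by apply: Hz; rewrite ?subrr ?normr0// addrAC subrr add0r.
  rewrite E addrAC subrr add0r -mulrBl normrM -(real_normK (num_real v)) expr2 mulrA.
  apply: ler_wpM2r => //; apply: (le_trans (f1L z u)); exact: ler_wpM2l.
pose N n w := \sum_(i < n.+1) (f (X (t n i) w + y n i w) - f (X (t n i) w)).
pose J n w := h n * \sum_(i < n.+1) g (X (t n i) w).
(* Its lower limit is nonnegative on almost every path by [path_sum_liminf]; a second moment bound
   transfers this to the expectation. *)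
pose V n w := 1 + k * J n w - N n w.
have mX n i : measurable_fun setT (X (t n i)) by move=> _ C mC; rewrite setTI;
  exact: mF (xG n i _ mC).
have iX n i : P.-integrable setT (EFin \o (fun w => g (X (t n i) w))).
  apply: (@bounded_integrable _ _ _ _ _ L).
    exact: (measurableT_comp mg (mX n i)).
  by move=> w; rewrite ger0_norm; have /andP[] := gb (X (t n i) w).
have iJ n : P.-integrable setT (EFin \o J n).
  by apply: integrable_realZ; exact: (integrable_realsum (f := fun i w => g (X (t n i) w))).
have EJ n : \int[P]_w J n w = h n * \sum_(i < n.+1) \int[P]_w g (X (t n i) w).
  rewrite /J RintegralZl//; last exact: (integrable_realsum (f := fun i w => g (X (t n i) w))).
  by rewrite (Rintegral_realsum (f := fun i w => g (X (t n i) w))).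
have J0 n w : 0 <= J n w.
  rewrite /J mulr_ge0 ?(ltW (h0 n))//; apply: sumr_ge0 => i _.
  by have /andP[] := gb (X (t n i) w).
have JL n w : J n w <= L * (e - a).
  rewrite /J -(nh n) mulrCA [_ * h n]mulrC mulrCA; apply: ler_wpM2l; first exact: ltW.
  rewrite -[n.+1 in leRHS]card_ord mulr_natl -sumr_const; apply: ler_sum => i _.
  by have /andP[] := gb (X (t n i) w).
have mN n : measurable_fun setT (N n).
  have my i : measurable_fun setT (y n i) by case: (yg n i).
  apply: measurable_sum => i; apply: measurable_funB; last exact: (measurableT_comp mf (mX n i)).
  exact: (measurableT_comp mf (measurable_funD (mX n i) (my i))).
have [N2i N2b] : (forall n, P.-integrable setT (EFin \o (fun w => N n w ^+ 2))) /\
   (forall n, \int[P]_w (N n w ^+ 2) <= 130 * L ^+ 2 * (e - a) + 256 * L ^+ 2 * (e - a) ^+ 2).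
  have H n := walk_sum_moment2 (h0 n) (fun i => sF (t n i)) (fun i => mF (t n i)) (Gle n) (xG n)
    (yG n) (yind n) (yg n) mf mf1 f1b f2 n.+1.
  split=> n; have [i2 b2] := H n; first exact: i2.
  apply: (le_trans b2); rewrite -(nh n).
  by rewrite le_eqVlt; apply/orP; left; apply/eqP; ring.
have iN n : P.-integrable setT (EFin \o N n).
  apply: (dominated_integrable (Z := fun w => 1 + N n w ^+ 2)) => //; first by move=> w;
    exact: norm_le1Dsqr.
  by apply: integrable_realD => //; exact: integrable_realcst.
(* C and K depend on L, hence on eta, but they only influence how large n must be; the final bound
   is free of L. *)
pose C := 130 * L ^+ 2 * (e - a) + 256 * L ^+ 2 * (e - a) ^+ 2.
pose K := 1 + k * (L * (e - a)).
have K0 : 0 <= K by rewrite /K addr_ge0// !mulr_ge0// ltW.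
have mV n : measurable_fun setT (V n).
  apply: measurable_funB => //; apply: measurable_funD => //; apply: measurable_funM => //.
  apply: measurable_funM => //; apply: measurable_sum => i; exact: (measurableT_comp mg (mX n i)).
have Vb n w : V n w ^+ 2 <= 2 * K ^+ 2 + 2 * N n w ^+ 2.
  set p := 1 + k * J n w.
  have p0 : 0 <= p by rewrite /p addr_ge0// mulr_ge0.
  have pK : p <= K by rewrite /p /K lerD2l; apply: ler_wpM2l.
  have pK2 : p ^+ 2 <= K ^+ 2 by rewrite lerXn2r// nnegrE.
  have : 0 <= (p + N n w) ^+ 2 by exact: sqr_ge0.
  rewrite (_ : V n w = p - N n w)//.
  have -> : (p + N n w) ^+ 2 = 2 * p ^+ 2 + 2 * N n w ^+ 2 - (p - N n w) ^+ 2 by ring.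
  by move: pK2; move: (p ^+ 2) (K ^+ 2) (N n w ^+ 2) ((p - _) ^+ 2) => z1 z2 z3 z4; lra.
have iE n : P.-integrable setT (EFin \o (fun w => 2 * K ^+ 2 + 2 * N n w ^+ 2)).
  by apply: integrable_realD; [exact: integrable_realcst|exact: integrable_realZ].
have V2i n : P.-integrable setT (EFin \o (fun w => V n w ^+ 2)).
  apply: dominated_integrable (iE n); first exact: measurable_funX.
  by move=> w; rewrite ger0_norm ?sqr_ge0.
have V2b n : \int[P]_w (V n w ^+ 2) <= 2 * K ^+ 2 + 2 * C.
  apply: (@le_trans _ _ (\int[P]_w (2 * K ^+ 2 + 2 * N n w ^+ 2))).
    by apply: le_Rintegral => // w _.
  rewrite RintegralD//; [|exact: integrable_realcst|exact: integrable_realZ].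
  by rewrite Rintegral_realcst RintegralZl// lerD2l ler_pM2l.
have aeV : {ae P, forall w, forall eps, 0 < eps -> exists n0, forall n,
  (n0 <= n)%N -> - eps <= V n w}.
  have cB : {ae P, forall w, cont_path B w} by case: hB => _ [_ []].
  apply: filterS2 aeX cB => w hw cw eps eps0.
  exact: (path_sum_liminf hw df f01 f1L gL k0 a1 ae cw fg eps0).
have [n0 HV] := liminf_expectation mV V2i V2b aeV ltr01.
have [n2 Hn2] : exists n2, forall n, (n2 <= n)%N -> 100 * L * (e - a) * Num.sqrt (h n) <= 1.
  pose q := 100 * L * (e - a) + 1.
  have q0 : 0 < q by rewrite /q ltr_wpDl// !mulr_ge0// ltW.
  exists (Num.truncn ((e - a) * q ^+ 2)) => n nn.
  have hq : h n <= (q^-1) ^+ 2.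
    rewrite /h ler_pdivrMr// exprVn mulrC ler_pdivlMr ?exprn_gt0//.
    by rewrite (le_trans (ltW (truncnS_gt _)))// ler_nat ltnS.
  have sq : Num.sqrt (h n) <= q^-1.
    by rewrite -[leRHS]gtr0_norm ?invr_gt0// -sqrtr_sqr ler_wsqrtr.
  apply: (@le_trans _ _ (q * q^-1)); last by rewrite divff// gt_eqF.
  by apply: ler_pM => //; rewrite ?sqrtr_ge0// ?lerDl// !mulr_ge0// ltW.
(* The 3 in the bound is 1 for the range of f, 1 for the slack in the lower limit, and 1 for the
   cubic remainder controlled by [n2]. *)
exists (maxn n0 n2) => n; rewrite geq_max => /andP[/HV + /Hn2 +].
rewrite RintegralB//; last by apply: integrable_realD;
  [exact: integrable_realcst|exact: integrable_realZ].
rewrite RintegralD//; [|exact: integrable_realcst|exact: integrable_realZ].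
rewrite Rintegral_realcst RintegralZl//.
have := walk_sum_expectation (h0 n) (fun i => sF (t n i)) (fun i => mF (t n i)) (Gle n) (xG n)
  (yG n) (yind n) (yg n) mf mf1 mg f1b f2 f3 gb c10 c20 hc n.+1.
rewrite -/(N n) -/(J n).
have -> : c1 / 2 * (c * h n) * \sum_(i < n.+1) \int[P]_w g (X (t n i) w)
  = c1 * c / 2 * \int[P]_w J n w.
  by rewrite EJ; ring.
have -> : n.+1%:R * (c2 / 2 * (65 * h n) + L * (100 * (h n * Num.sqrt (h n)))) =
   c2 * 65 / 2 * (e - a) + 100 * L * (e - a) * Num.sqrt (h n).
  by rewrite -(nh n); field.
have J00 : 0 <= \int[P]_w J n w by exact: Rintegral_ge0.
have kJ : k * \int[P]_w J n w <= c1 * c / 4 * \int[P]_w J n w by exact: ler_wpM2r.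
rewrite (_ : c1 * c / 2 * \int[P]_w J n w = c1 * c / 4 * \int[P]_w J n w + c1 * c / 4 * \int[P]_w J
  n w); last by field.
move: kJ; rewrite -/(J n); move: (k * _) (c1 * c / 4 * _) (c2 * 65 / 2 * _) (100 * L * _ * _)
  => z1 z2 z3 z4.
have -> : \int[P]_x (N n x) = \int[P]_w N n w by [].
by move: (Rintegral _ _ _) => z5; lra.
Qed.
End occupation.

(** * The test function *)

Lemma is_derive_sqrD_powR (R : realType) (eta p z : R) : 0 < eta ->
  is_derive z 1 (fun z : R => (z ^+ 2 + eta) `^ p) (2 * p * z * (z ^+ 2 + eta) `^ (p - 1)).
Proof.
move=> e0.
have q0 : 0 < z ^+ 2 + eta by rewrite ltr_wpDl// sqr_ge0.
have dq : is_derive z 1 (fun z : R => z ^+ 2 + eta) (2 * z).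
  have := is_deriveD (is_deriveX 2 (is_derive_id z (1:R))) (is_derive_cst eta z (1:R)).
  by move=> H; apply: is_derive_eq H _; rewrite /= /GRing.scale/= expr1; ring.
have := @is_derive1_comp R (fun u : R => u `^ p) (fun z : R => z ^+ 2 + eta)
  z _ _ (is_derive1_powR p q0) dq.
by move=> H; apply: is_derive_eq H _; ring.
Qed.

Lemma lipschitz_of_derive (R : realType) (f f1 : R -> R) (L u v : R) :
  (forall u : R, is_derive u 1 f (f1 u)) -> (forall u, `|f1 u| <= L) ->
  `|f u - f v| <= L * `|u - v|.
Proof.
move=> df f1L; have [z -> _] := mvt_between u v df.
by rewrite normrM; apply: ler_wpM2r.
Qed.

(** With the quadratic part removed, the mean value theorem is used twice: h v - h 0 = (f2 z - m) (y
    v), where y lies between 0 and v. So y v >= 0, and the lower bound on f2 at z is moved to u at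
    the price c1 L |v|. *)
Lemma taylor2_lower (R : realType) (f f1 f2 g : R -> R) (L c1 c2 u v : R) :
  (forall u : R, is_derive u 1 f (f1 u)) -> (forall u : R, is_derive u 1 f1 (f2 u)) ->
  (forall u v, `|g u - g v| <= L * `|u - v|) -> 0 <= c1 ->
  (forall u, c1 * g u - c2 <= f2 u) ->
  (c1 * g u - c2) * v ^+ 2 / 2 - c1 * L * `|v| ^+ 3 <= f (u + v) - f u - f1 u * v.
Proof.
move=> df df1 gL c10 f2c.
have L0 : 0 <= L by have := gL 1 0; rewrite subr0 normr1 mulr1; exact: le_trans.
set m := c1 * g u - c2.
pose h y := f (u + y) - f1 u * y - m / 2 * y ^+ 2.
have dh (y : R) : is_derive y 1 h (f1 (u + y) - f1 u - m * y).
  have d1 : is_derive y 1 (fun y => f (u + y)) (f1 (u + y)).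
    have dsh : is_derive y 1 (fun y => u + y) 1.
      have H := is_deriveD (is_derive_cst u y (1:R)) (is_derive_id y (1:R)).
      by apply: is_derive_eq H _; rewrite add0r.
    have := @is_derive1_comp R f (fun y => u + y) y _ _ (df (u + y)) dsh.
    by rewrite mulr1.
  have := is_deriveB (is_deriveB d1 (is_deriveZ (f1 u) (is_derive_id y (1:R))))
    (is_deriveZ (m / 2) (is_deriveX 2 (is_derive_id y (1:R)))).
  by move=> H; apply: is_derive_eq H _; rewrite /GRing.scale/= expr1; field.
have [y E Hy] := mvt_between v 0 dh.
have yv : `|y| <= `|v|.
  by have := Hy 0 `|v|; rewrite !subr0 normr0; apply.
have yv0 : 0 <= y * v.
  have : `|y - v| <= `|v| by apply: Hy; rewrite ?subrr ?normr0// sub0r normrN.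
  case: (lerP 0 v) => v0.
    by rewrite (ger0_norm v0) ler_norml => /andP[h1 _]; apply: mulr_ge0 => //; lra.
  by rewrite (ltr0_norm v0) ler_norml => /andP[_ h1]; apply: mulr_le0; lra.
have [z E1 Hz] := mvt_between (u + y) u df1.
have zu : `|z - u| <= `|v|.
  apply: Hz; last by rewrite subrr normr0.
  by rewrite addrC addKr.
have fz : m - c1 * L * `|v| <= f2 z.
  apply: (le_trans _ (f2c z)); rewrite /m.
  have : g u - g z <= L * `|v|.
    rewrite (le_trans (ler_norm _))// distrC (le_trans (gL z u))//; exact: ler_wpM2l.
  move=> /(ler_wpM2l c10); rewrite mulrBr mulrA; move: (c1 * _) (c1 * _) (c1 * _ * _) => a b c; lra.
have : - (c1 * L * `|v| ^+ 3) <= h v - h 0.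
  rewrite E subr0 E1 (_ : u + y - u = y); last by rewrite addrC addKr.
  rewrite (_ : _ * v = (f2 z - m) * (y * v)); last by ring.
  have a0 : 0 <= c1 * L * `|v| by rewrite !mulr_ge0.
  have b0 : y * v <= `|v| ^+ 2.
    rewrite (le_trans (ler_norm _))// normrM expr2; exact: ler_wpM2r.
  apply: (@le_trans _ _ (- (c1 * L * `|v|) * (y * v))).
    by rewrite mulNr lerN2 exprS [leRHS]mulrA; exact: ler_wpM2l.
  by apply: ler_wpM2r => //; move: fz; move: (c1 * L * _) => a; lra.
rewrite /h addr0 mulr0 subr0 expr0n/= mulr0 subr0.
have -> : m * v ^+ 2 / 2 = m / 2 * v ^+ 2 by field.
by move: (c1 * L * _) (m / 2 * _) (f1 u * v) (f _) (f _) => z1 z2 z3 z4 z5; lra.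
Qed.
(* f is the test function, f1 its derivative, and c1 * g - c2 a lower bound for its second
   derivative, expressed as a Taylor estimate. *)
Definition test_triple (R : realType) (f f1 g : R -> R) (L c1 c2 : R) : Prop :=
  [/\ forall u : R, is_derive u 1 f (f1 u), forall u, 0 <= f u <= 1,
      forall u, 0 <= g u <= L & forall u, `|f1 u| <= L] /\
  [/\ forall u v, `|f1 u - f1 v| <= L * `|u - v|,
      forall u v, `|g u - g v| <= L * `|u - v| &
      forall u v, (c1 * g u - c2) * v ^+ 2 / 2 - L * `|v| ^+ 3 <= f (u + v) - f u - f1 u * v].

(** Each derivative in u brings a factor 1/s, so for s >= 1 the same L serves while the second-order
    constants are divided by s^2; with s = sqrt T this is the division by T. *)
Lemma test_triple_scale (R : realType) (f f1 g : R -> R) (L c1 c2 s : R) : 1 <= s ->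
  test_triple f f1 g L c1 c2 ->
  test_triple (fun u => f (u / s)) (fun u => f1 (u / s) / s) (fun u => g (u / s)) L (c1 / s ^+ 2)
    (c2 / s ^+ 2).
Proof.
move=> s1 [[df f01 gb f1b] [f1L gL f3]].
have s0 : 0 < s by exact: lt_le_trans s1.
have L0 : 0 <= L by exact: le_trans (f1b 0).
have si1 : s^-1 <= 1 by rewrite invf_le1.
have nd (u : R) : `|u / s| <= `|u|.
  by rewrite normrM normfV (gtr0_norm s0) ger_pMr_le1//
    || rewrite normrM normfV (gtr0_norm s0) ler_piMr.
have nL u v : L * `|u / s - v / s| <= L * `|u - v| by apply: ler_wpM2l => //; rewrite -mulrBl.
split; split => //.
- move=> u; have dq : is_derive u 1 (fun z : R => z / s) s^-1.
    have := is_deriveZ s^-1 (is_derive_id u (1:R)); rewrite /GRing.scale/= mulr1 => H.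
    by rewrite (_ : (fun z => z / s) = s^-1 \*: id)//; apply/funext => z; rewrite mulrC.
  exact: (@is_derive1_comp R f (fun z => z / s) u _ _ (df _) dq).
- move=> u; rewrite (le_trans _ (f1b (u / s)))// normrM normfV (gtr0_norm s0) ler_piMr//.
- move=> u v; rewrite -mulrBl normrM normfV (gtr0_norm s0) (le_trans _ (nL u v))//.
  by rewrite (le_trans _ (f1L _ _))// ler_piMr.
- by move=> u v; exact: le_trans (gL _ _) (nL _ _).
- move=> u v; have := f3 (u / s) (v / s); rewrite -mulrDl.
  have -> : f1 (u / s) * (v / s) = f1 (u / s) / s * v by field; rewrite gt_eqF.
  apply: le_trans; apply: lerB; last first.
    by apply: ler_wpM2l => //; apply: lerXn2r; rewrite ?nnegrE.
  by rewrite le_eqVlt; apply/orP; left; apply/eqP; field; rewrite gt_eqF.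
Qed.

(* With q = z^2 + eta, f = 1 - exp (- q^(alpha/2 + 1)) is a bounded regularization of
   |z|^(alpha + 2), whose second derivative behaves like |z|^alpha near 0. *)
Section test_function.
Variables (R : realType) (alpha : R).
Hypotheses (al1 : -1 < alpha) (al0 : alpha < 0).

Definition smooth_abs_powR (eta z : R) : R := (z ^+ 2 + eta) `^ (alpha / 2).

Variable eta : R.
Hypotheses (e0 : 0 < eta) (e1 : eta <= 1).
Let q z : R := z ^+ 2 + eta.
Notation g := (smooth_abs_powR eta).
Let Y z : R := q z `^ (alpha / 2 + 1).
Let f z : R := 1 - expR (- Y z).
Let f1 z : R := (alpha + 2) * (z * g z) * expR (- Y z).
(** In the last factor, alpha < 0 and z^2 / q <= 1 make the first two terms at least 1 + alpha > 0;
    the third is at most (alpha + 2) Y, which is small near 0. *)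
Let f2 z : R := (alpha + 2) * g z * expR (- Y z) * (1 + alpha * (z ^+ 2 / q z) - (alpha + 2)
  * (z ^+ 2 * g z)).

Let q0 z : 0 < q z. Proof. by rewrite ltr_wpDl// sqr_ge0. Qed.
Let qn z : q z != 0. Proof. by rewrite gt_eqF. Qed.
Let g0 z : 0 < g z. Proof. by rewrite powR_gt0 ?q0. Qed.
Let Yg z : Y z = q z * g z.
Proof. by rewrite /Y powRD ?qn ?implybT// powRr1 ?(ltW (q0 z))// mulrC. Qed.
Let Y0 z : 0 < Y z. Proof. exact: powR_gt0. Qed.
Let eY0 z : 0 < expR (- Y z). Proof. exact: expR_gt0. Qed.
Let eY1 z : expR (- Y z) <= 1. Proof. by rewrite -expR0 ler_expR oppr_le0 (ltW (Y0 z)). Qed.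
Let YeY z : Y z * expR (- Y z) <= 1.
Proof.
rewrite expRN ler_pdivrMr ?expR_gt0// mul1r (le_trans _ (expR_ge1Dx _))//.
by rewrite lerDr.
Qed.
Let zgY z : z ^+ 2 * g z <= Y z.
Proof. by rewrite Yg ler_pM2r// /q lerDl (ltW e0). Qed.
Let zg0 z : 0 <= z ^+ 2 * g z. Proof. by rewrite mulr_ge0 ?sqr_ge0// (ltW (g0 z)). Qed.
Let zq z : 0 <= z ^+ 2 / q z <= 1.
Proof. by rewrite divr_ge0 ?sqr_ge0 ?(ltW (q0 z))//= ler_pdivrMr// mul1r /q lerDl (ltW e0). Qed.
Let gG a z : 0 < a -> a <= q z -> g z <= a `^ (alpha / 2).
Proof.
move=> a0 aq; rewrite /smooth_abs_powR -/(q z) (_ : alpha / 2 = - (- alpha / 2)); last by field.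
rewrite !powRN lef_pV2 ?posrE ?powR_gt0//.
apply: ge0_ler_powR; rewrite ?nnegrE ?(ltW a0) ?(ltW (q0 z))//.
by move: al0; lra.
Qed.
Let G : R := eta `^ (alpha / 2).
Let gG1 z : g z <= G. Proof. by apply: gG => //; rewrite lerDr sqr_ge0. Qed.

Let dg (z : R) : is_derive z 1 g (alpha * z * g z / q z).
Proof.
have := is_derive_sqrD_powR (alpha / 2) z e0.
move=> H; apply: is_derive_eq H _.
rewrite -/(q z) powRB ?qn ?implybT// powRr1 ?(ltW (q0 z))//.
by rewrite /smooth_abs_powR -/(q z); field; exact: qn.
Qed.

Let dY (z : R) : is_derive z 1 Y ((alpha + 2) * (z * g z)).
Proof.
have := is_derive_sqrD_powR (alpha / 2 + 1) z e0.
by move=> H; apply: is_derive_eq H _; rewrite addrK /smooth_abs_powR; field.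
Qed.

Let dE (z : R) : is_derive z 1 (fun z => expR (- Y z)) (- (alpha + 2) * (z * g z) * expR (- Y z)).
Proof.
have := @is_derive1_comp R expR (fun z => - Y z) z _ _ (is_derive_expR _) (is_deriveN (dY z)).
by move=> H; apply: is_derive_eq H _; ring.
Qed.

Let df (z : R) : is_derive z 1 f (f1 z).
Proof.
have := is_deriveB (is_derive_cst (1 : R) z (1:R)) (dE z).
by move=> H; apply: is_derive_eq H _; rewrite /f1; ring.
Qed.

Let df1 (z : R) : is_derive z 1 f1 (f2 z).
Proof.
have := is_deriveM (is_deriveZ (alpha + 2) (is_deriveM (is_derive_id z (1:R)) (dg z))) (dE z).
move=> H; apply: is_derive_eq H _; rewrite /f2 /GRing.scale/=.
rewrite -[_ *: (id * g) z]/((alpha + 2) * (z * g z)) mulr1.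
by move: (expR _) (g z) (qn z) => E g'; move: (q z) => Q Q0; field.
Qed.

Let c1 : R := (alpha + 2) * expR (- 1) * ((1 + alpha) / 2).

(* Near 0 (q <= y0^2) the bracket in f2 is at least (1 + alpha) / 2; away from 0, g is bounded. *)
Lemma test_function_lower (y0 z : R) : 0 < y0 -> y0 <= 1 -> (alpha + 2) * y0 <= (1 + alpha) / 2 ->
  c1 * g z - (c1 + (alpha + 2) ^+ 2) * (y0 ^+ 2) `^ (alpha / 2) <= f2 z.
Proof.
move=> y00 y01 hy.
have a2 : 0 < alpha + 2 by move: al1; lra.
have c10 : 0 <= c1 by rewrite /c1 !mulr_ge0 ?expR_ge0 ?(ltW a2)//; move: al1; lra.
have /andP[z0 z1] := zq z.
have az : 1 + alpha <= 1 + alpha * (z ^+ 2 / q z).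
  by move: z1; move: (_ / _) al0 => u; nra.
have G0 : 0 <= (y0 ^+ 2) `^ (alpha / 2) by exact: powR_ge0.
case: (lerP (q z) (y0 ^+ 2)) => hq.
  have q1 : q z <= 1 by rewrite (le_trans hq)// expr_le1// ltW.
  (* For q <= 1 the exponent alpha/2 + 1 >= 1/2 gives Y <= sqrt q <= y0, which keeps the negative
     term of f2 below (1 + alpha)/2. *)
  have Yy : Y z <= y0.
    apply: (@le_trans _ _ (q z `^ 2^-1)).
      by apply: ger_powR; [rewrite q0|move: al1; lra].
    rewrite powR12_sqrt ?(ltW (q0 z))// -[leRHS](ger0_norm (ltW y00)) -sqrtr_sqr ler_wsqrtr//.
  apply: (@le_trans _ _ (c1 * g z)).
    by rewrite gerBl mulr_ge0// addr_ge0// sqr_ge0.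
  have -> : c1 * g z = (alpha + 2) * g z * expR (- 1) * ((1 + alpha) / 2) by rewrite /c1; ring.
  have p0 : 0 <= (alpha + 2) * g z by rewrite mulr_ge0 ?(ltW a2) ?(ltW (g0 z)).
  rewrite /f2; apply: ler_pM.
  - by rewrite mulr_ge0// expR_ge0.
  - by move: al1; lra.
  - by apply: ler_wpM2l => //; rewrite ler_expR lerN2 (le_trans Yy).
  - have : (alpha + 2) * (z ^+ 2 * g z) <= (1 + alpha) / 2.
      apply: (le_trans _ hy); apply: ler_wpM2l; [exact: ltW|exact: le_trans (zgY z) _].
    by move: az; move: ((alpha + 2) * _) (alpha * _) => u v; lra.
have gG' := gG (exprn_gt0 2 y00) (ltW hq).
apply: (@le_trans _ _ (- (alpha + 2) ^+ 2 * g z)).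
  have h1 : c1 * g z <= c1 * (y0 ^+ 2) `^ (alpha / 2) by exact: ler_wpM2l.
  have h2 : (alpha + 2) ^+ 2 * g z <= (alpha + 2) ^+ 2 * (y0 ^+ 2) `^ (alpha / 2).
    by apply: ler_wpM2l => //; exact: sqr_ge0.
  by move: h1 h2; move: c1 ((alpha + 2) ^+ 2) (g z) (_ `^ _) => a b c d; lra.
have -> : f2 z = (alpha + 2) * g z * expR (- Y z) * (1 + alpha * (z ^+ 2 / q z)) - (alpha + 2)
  ^+ 2 * g z * (z ^+ 2 * g z * expR (- Y z)).
  by rewrite /f2; ring.
have h1 : 0 <= (alpha + 2) * g z * expR (- Y z) * (1 + alpha * (z ^+ 2 / q z)).
  rewrite !mulr_ge0 ?expR_ge0 ?(ltW a2) ?(ltW (g0 z))//; apply: (le_trans _ az).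
  by move: al1; lra.
have h2 : (alpha + 2) ^+ 2 * g z * (z ^+ 2 * g z * expR (- Y z)) <= (alpha + 2) ^+ 2 * g z.
  apply: ler_piMr; first by rewrite mulr_ge0 ?sqr_ge0 ?(ltW (g0 z)).
  by apply: le_trans (YeY z); rewrite ler_pM2r.
by move: h1 h2; rewrite mulNr; move: (_ * _) (_ * _) (_ * _) => a b c; lra.
Qed.

(** The factor z in f1 compensates the singularity, leaving |z|^(1 + alpha) <= 1 + Y <= exp(Y),
    which the exponential in f1 cancels; finally alpha + 2 <= 2. *)
Lemma test_function_f1_bound z : `|f1 z| * `|z| `^ alpha <= 2 * g z.
Proof.
have a2 : 0 < alpha + 2 by move: al1; lra.
rewrite /f1 !normrM (ger0_norm (ltW a2)) (ger0_norm (ltW (g0 z))) (ger0_norm (ltW (eY0 z))).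
have -> : (alpha + 2) * (`|z| * g z) * expR (- Y z) * `|z| `^ alpha =
  (alpha + 2) * g z * (`|z| * `|z| `^ alpha * expR (- Y z)) by ring.
have zz : `|z| * `|z| `^ alpha = `|z| `^ (1 + alpha).
  rewrite powRD ?powRr1//.
  by apply/implyP => /eqP h; move: al1; lra.
have zY : `|z| `^ (1 + alpha) <= 1 + Y z.
  case: (lerP `|z| 1) => h.
    rewrite (@le_trans _ _ 1)//; last by rewrite lerDl (ltW (Y0 z)).
    rewrite [leRHS](_ : 1 = 1 `^ (1 + alpha)); last by rewrite powR1.
    apply: ge0_ler_powR; rewrite ?nnegrE//.
    by move: al1; lra.
  rewrite (@le_trans _ _ (Y z))//; last by rewrite lerDr.
  apply: (@le_trans _ _ (`|z| `^ (2 * (alpha / 2 + 1)))).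
    by apply: ler_powR; [exact: ltW|lra].
  rewrite powRrM; apply: ge0_ler_powR; rewrite ?nnegrE ?powR_ge0 ?(ltW (q0 z))//.
    by move: al1; lra.
  by rewrite powR_mulrn// real_normK ?num_real// lerDl ltW.
have E1 : `|z| * `|z| `^ alpha * expR (- Y z) <= 1.
  rewrite zz expRN ler_pdivrMr ?expR_gt0// mul1r (le_trans zY)//; exact: expR_ge1Dx.
apply: (@le_trans _ _ ((alpha + 2) * g z)).
  by apply: ler_piMr => //; rewrite mulr_ge0 ?(ltW a2) ?(ltW (g0 z)).
by rewrite ler_pM2r//; move: al0; lra.
Qed.


Let f2b z : `|f2 z| <= 8 * G.
Proof.
have a2 : 0 < alpha + 2 by move: al1; lra.
have G0 : 0 <= G by exact: powR_ge0.
have /andP[z0 z1] := zq z.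
have h1 : `|1 + alpha * (z ^+ 2 / q z)| <= 1.
  by rewrite ler_norml; move: z0 z1 al0 al1; move: (_ / _) => u h1 h2 h3 h4; apply/andP; split; nra.
have h2 : z ^+ 2 * g z * expR (- Y z) <= 1 by apply: le_trans (YeY z); rewrite ler_pM2r.
have h3 : 0 <= z ^+ 2 * g z * expR (- Y z) by rewrite mulr_ge0 ?(ltW (eY0 z)).
rewrite /f2 -mulrA normrM (ger0_norm (mulr_ge0 (ltW a2) (ltW (g0 z)))) mulrBr.
have h4 : `|expR (- Y z) * (1 + alpha * (z ^+ 2 / q z)) - expR (- Y z) * ((alpha + 2)
  * (z ^+ 2 * g z))| <= 3.
  rewrite (le_trans (ler_normB _ _))// (_ : 3 = 1 * 1 + 2 * 1); last by ring.
  apply: lerD.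
    by rewrite normrM; apply: ler_pM => //; rewrite ger0_norm ?(ltW (eY0 z)).
  rewrite (_ : _ * _ = (alpha + 2) * (z ^+ 2 * g z * expR (- Y z))); last by ring.
  rewrite normrM (ger0_norm (ltW a2)) (ger0_norm h3); apply: ler_pM => //; first exact: ltW.
  by move: al0; lra.
apply: (@le_trans _ _ (2 * G * 3)); last by move: G0; lra.
apply: ler_pM => //; first by rewrite mulr_ge0 ?(ltW a2) ?(ltW (g0 z)).
apply: ler_pM; [exact: ltW|exact: ltW|by move: al0; lra|exact: gG1].
Qed.

Let f1b z : `|f1 z| <= 2 * (G + 1).
Proof.
have a2 : 0 < alpha + 2 by move: al1; lra.
have h : `|z| * g z <= g z + Y z.
  apply: (@le_trans _ _ ((1 + z ^+ 2) * g z)); last by rewrite mulrDl mul1r lerD2l.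
  by rewrite ler_pM2r//; exact: norm_le1Dsqr.
rewrite /f1 !normrM (ger0_norm (ltW a2)) (ger0_norm (ltW (g0 z))) (ger0_norm (ltW (eY0 z))).
rewrite -mulrA; apply: ler_pM; rewrite ?(ltW a2)//.
- by rewrite !mulr_ge0 ?(ltW (g0 z)) ?(ltW (eY0 z)).
- by move: al0; lra.
apply: (@le_trans _ _ ((g z + Y z) * expR (- Y z))); first by rewrite ler_pM2r.
rewrite mulrDl lerD//.
by apply: le_trans (gG1 z); rewrite ler_piMr// ltW.
Qed.

Let dgb z : `|alpha * z * g z / q z| <= G / eta.
Proof.
have h : `|z| / q z <= eta^-1.
  rewrite ler_pdivrMr// mulrC ler_pdivlMr//.
  have := norm_le1Dsqr z; rewrite /q -(real_normK (num_real z)); have := normr_ge0 z.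
  by move: e0 e1; move: (`|z|) => u; nra.
rewrite !normrM normfV (ger0_norm (ltW (g0 z))) (ger0_norm (ltW (q0 z))).
have -> : `|alpha| * `|z| * g z / q z = `|alpha| * (g z * (`|z| / q z)) by ring.
rewrite -[leRHS]mul1r; apply: ler_pM => //.
- by rewrite !mulr_ge0 ?invr_ge0// ltW.
- by rewrite ler_norml; move: al0 al1; lra.
- apply: ler_pM => //; first exact: ltW.
  by rewrite mulr_ge0 ?invr_ge0// ltW.
Qed.

Lemma test_function (y0 : R) : 0 < y0 -> y0 <= 1 -> (alpha + 2) * y0 <= (1 + alpha) / 2 ->
  exists L, test_triple f f1 g L c1 ((c1 + (alpha + 2) ^+ 2) * (y0 ^+ 2) `^ (alpha / 2)).
Proof.
move=> y00 y01 hy.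
have G0 : 0 <= G by exact: powR_ge0.
have c10 : 0 <= c1 by rewrite /c1 !mulr_ge0 ?expR_ge0//; move: al1; lra.
have Ge0 : 0 <= G / eta by rewrite divr_ge0// ltW.
(* The sum of all bounds at once; G = eta^(alpha/2) and G / eta blow up as eta tends to 0. *)
pose L := 8 * G + 2 + G / eta + c1 * (G / eta).
have cG : 0 <= c1 * (G / eta) by rewrite mulr_ge0.
have hL1 : 8 * G <= L by rewrite /L -!addrA lerDl !addr_ge0.
have hL2 : G / eta <= L by rewrite /L [_ + G / eta]addrC -!addrA lerDl !addr_ge0// mulr_ge0.
have hL3 : c1 * (G / eta) <= L by rewrite /L lerDr !addr_ge0// mulr_ge0.
have gL u v : `|g u - g v| <= G / eta * `|u - v| := lipschitz_of_derive u v dg dgb.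
exists L; split; split.
- exact: df.
- by move=> u; rewrite /f subr_ge0 eY1 gerBl (ltW (eY0 u)).
- move=> u; rewrite (ltW (g0 u)) (le_trans (gG1 u))//= (le_trans _ hL1)//.
  by move: G0; lra.
- move=> u; rewrite (le_trans (f1b u))// /L -addrA ler_wpDr ?addr_ge0//.
  by move: G0; lra.
- move=> u v; rewrite (le_trans (lipschitz_of_derive u v df1 f2b))//.
  exact: ler_wpM2r.
- by move=> u v; rewrite (le_trans (gL u v))//; exact: ler_wpM2r.
- move=> u v; have H := taylor2_lower u v df df1 gL c10 (fun z => test_function_lower z y00 y01 hy).
  apply: le_trans H; rewrite lerB//.
  by apply: ler_wpM2r => //; rewrite exprn_ge0.
Qed.
End test_function.

(* The constants c1 and c2 do not depend on eta, only L does. *)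
Lemma smooth_abs_powR_test (R : realType) (alpha : R) : -1 < alpha -> alpha < 0 ->
  exists c1 c2, [/\ 0 < c1, 0 <= c2 & forall eta, 0 < eta -> eta <= 1 ->
    exists f f1 L, test_triple f f1 (smooth_abs_powR alpha eta) L c1 c2 /\
      forall z, `|f1 z| * `|z| `^ alpha <= 2 * smooth_abs_powR alpha eta z].
Proof.
move=> al1 al0.
have a2 : 0 < alpha + 2 by lra.
have a1 : 0 < 1 + alpha by lra.
pose y0 := (1 + alpha) / 2 / (alpha + 2).
have y00 : 0 < y0 by rewrite !divr_gt0.
have y01 : y0 <= 1 by rewrite /y0 ler_pdivrMr//; lra.
have hy : (alpha + 2) * y0 <= (1 + alpha) / 2 by rewrite /y0 mulrC divfK// gt_eqF.
pose c1 := (alpha + 2) * expR (- 1) * ((1 + alpha) / 2).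
have c10 : 0 < c1 by rewrite !mulr_gt0// expR_gt0.
exists c1, ((c1 + (alpha + 2) ^+ 2) * (y0 ^+ 2) `^ (alpha / 2)); split => //.
  by rewrite mulr_ge0 ?powR_ge0// addr_ge0 ?sqr_ge0// ltW.
move=> eta e0 e1; have [L H] := test_function al1 al0 e0 e1 y00 y01 hy.
by do 3 eexists; split; [exact: H|exact: test_function_f1_bound].
Qed.

(** * Drift over dyadic blocks when the exponent is negative *)

Lemma lipschitz_measurable (R : realType) (g : R -> R) (L : R) :
  (forall u v, `|g u - g v| <= L * `|u - v|) -> continuous g /\ measurable_fun setT g.
Proof.
move=> gL; suff cg : continuous g by split => //; exact: continuous_measurable_fun.
have L0 : 0 <= L by have := gL 1 0; rewrite subr0 normr1 mulr1; exact: le_trans.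
move=> u; apply/cvgrPdist_le => e e0.
have L1 : 0 < L + 1 by rewrite ltr_wpDl.
near=> v; rewrite (le_trans (gL u v))// (@le_trans _ _ ((L + 1) * (e / (L + 1))))//; last first.
  by rewrite mulrC divfK// gt_eqF.
apply: ler_pM => //; first by rewrite lerDl.
by near: v; apply: cvgr_dist_le; [exact: cvg_id|rewrite divr_gt0].
Unshelve. all: by end_near. Qed.

Lemma riemann_sum_lower (R : realType) (f : R -> R) (a e : R) : a < e ->
  {within `[a, e], continuous f} -> forall eps, 0 < eps -> exists n0, forall n, (n0 <= n)%N ->
  \int[lebesgue_measure]_(u in `]a, e]) f u - eps <=
  (e - a) / n.+1%:R * \sum_(i < n.+1) f (a + i%:R * ((e - a) / n.+1%:R)).
Proof.
move=> ae cf eps eps0.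
have ea0 : 0 < e - a by rewrite subr_gt0.
pose w := eps / (e - a).
have w0 : 0 < w by rewrite divr_gt0.
have [dl dl0 D] := segment_unif_continuous cf w0.
exists (Num.truncn ((e - a) / dl)) => n nn.
set h := (e - a) / n.+1%:R.
have n1 : 0 < n.+1%:R :> R by rewrite ltr0n.
have h0 : 0 < h by rewrite divr_gt0.
have hd : h < dl.
  by rewrite /h ltr_pdivrMr// mulrC -ltr_pdivrMr// (lt_le_trans (truncnS_gt _))// ler_nat ltnS.
pose t i : R := a + i%:R * h.
have tS i : t i.+1 - t i = h by rewrite /t -natr1; ring.
have tn : t n.+1 = e by rewrite /t /h mulrCA divff ?gt_eqF// mulr1 addrC subrK.
have tle i j : (i <= j)%N -> t i <= t j by move=> ij; rewrite /t lerD2l ler_pM2r// ler_nat.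
have t0 : t 0 = a by rewrite /t mul0r addr0.
have at' i : a <= t i by rewrite -t0 tle.
have te i : (i <= n.+1)%N -> t i <= e by move=> ?; rewrite -tn tle.
have fi u v : a <= u -> v <= e -> (@lebesgue_measure R).-integrable `]u, v] (EFin \o f).
  move=> au ve; apply: (@integrableS _ _ _ lebesgue_measure `[a, e]%classic) => //.
    by move=> z /=; rewrite !in_itv/= => /andP[uz zv]; rewrite (le_trans au (ltW uz)) (le_trans zv).
  by apply: continuous_compact_integrable => //; exact: segment_compact.
have S m : (m <= n.+1)%N -> \int[lebesgue_measure]_(u in `]a, (t m)]) f u <= h * \sum_(i < m)
  (f (t i) + w).
  elim: m => [_|m IH mn]; first by rewrite big_ord0 t0 set_itv_ge ?bnd_simp// Rintegral_set0 mulr0.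
  have -> : \int[lebesgue_measure]_(u in `]a, (t m.+1)]) f u =
     \int[lebesgue_measure]_(u in `]a, (t m)]) f u + \int[lebesgue_measure]_(u in `](t m),
       (t m.+1)]) f u.
    rewrite -(@Rintegral_itvB _ _ (BRight a) (BRight (t m.+1)) (t m)) ?bnd_simp ?tle//;
      first by rewrite addrC subrK.
    by apply: fi => //; exact: te.
  rewrite big_ord_recr/= mulrDr; apply: lerD; first exact: (IH (ltnW mn)).
  apply: (@le_trans _ _ (\int[lebesgue_measure]_(u in `](t m), (t m.+1)]) (f (t m) + w))).
    apply: le_Rintegral => //; [by apply: fi => //; exact: te|exact: lebesgue_integrable_cst|].
    move=> u /=; rewrite in_itv/= => /andP[tu ut].
    have : `|f (t m) - f u| < w.
      apply: D.
      - by rewrite (le_trans (at' m) (ltW tu)) (le_trans ut)// te.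
      - by rewrite at' te// ltnW.
      - rewrite distrC ger0_norm ?subr_ge0 ?(ltW tu)// (le_lt_trans _ hd)// -(tS m) lerD2r//.
    by rewrite ltr_norml => /andP[h1 _]; lra.
  by rewrite Rintegral_lebesgue_cst ?tle// tS mulrC.
have := S n.+1 (leqnn _); rewrite tn big_split/= mulrDr sumr_const card_ord -mulr_natl.
have -> : h * (n.+1%:R * w) = eps by rewrite /h /w; field; rewrite !gt_eqF.
by rewrite lerBlDr.
Qed.

(** Truncating phi m at F gives functions dominated by F that converge to F, so dominated
    convergence applies although phi m itself is only bounded below in the limit. *)
Lemma integral_liminf (R : realType) (a e : R) (F : R -> R) (phi : nat -> R -> R) (K : R) :
  (@lebesgue_measure R).-integrable `]a, e] (EFin \o F) -> (forall s, 0 <= F s) ->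
  (forall m, (@lebesgue_measure R).-integrable `]a, e] (EFin \o phi m))
    -> (forall m s, 0 <= phi m s) ->
  (forall s, a < s <= e -> forall eps, 0 < eps -> exists m0, forall m,
    (m0 <= m)%N -> F s - eps <= phi m s) ->
  K < \int[lebesgue_measure]_(s in `]a, e]) F s ->
  exists m0, forall m, (m0 <= m)%N -> K < \int[lebesgue_measure]_(s in `]a, e]) phi m s.
Proof.
move=> iF F0 iphi phi0 lim KF.
pose psi m s := Num.min (phi m s) (F s).
have mI : measurable (`]a, e]%classic : set (measurableTypeR R)) by exact: measurable_itv.
have mF : measurable_fun `]a, e] F by apply/measurable_EFinP; exact: measurable_int iF.
have mphi m : measurable_fun `]a, e] (phi m) by apply/measurable_EFinP;
  exact: (measurable_int lebesgue_measure (iphi m)).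
have mpsi m : measurable_fun `]a, e] (EFin \o psi m).
  by apply/measurable_EFinP; exact: measurable_minr.
have psi0 m s : 0 <= psi m s by rewrite /psi le_min phi0 F0.
have psiF m s : `|psi m s| <= F s by rewrite ger0_norm// /psi ge_min lexx orbT.
have ipsi m : (@lebesgue_measure R).-integrable `]a, e] (EFin \o psi m).
  by apply: (le_integrable mI (mpsi m) _ iF) => s _ /=; rewrite lee_fin (ger0_norm (F0 s)).
have mFE : measurable_fun `]a, e] (EFin \o F) by exact: (measurable_int lebesgue_measure iF).
have H1 : {ae (@lebesgue_measure R), forall s, `]a, e]%classic s -> (EFin \o psi m)
  s @[m --> \oo] --> (EFin \o F) s}.
  apply: aeW => s /=; rewrite in_itv/= => /lim hs; apply: cvg_EFin; first by apply: nearW.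
  apply/cvgrPdist_le => eps eps0; have [m0 Hm] := hs _ eps0.
  exists m0 => // m /= /Hm h1.
  rewrite ger0_norm; last by rewrite subr_ge0 ge_min lexx orbT.
  by rewrite lerBlDl -lerBlDr le_min h1/= lerBlDr lerDl ltW.
have H2 : {ae (@lebesgue_measure R), forall s (n : nat), `]a, e]%classic s -> (`|(EFin \o psi n)
  s| <= (EFin \o F) s)%E}.
  by apply: aeW => s n _ /=; rewrite lee_fin.
have [_ _] := @dominated_convergence _ _ _ (@lebesgue_measure R) `]a, e]%classic mI
   (fun m => EFin \o psi m) (EFin \o F) (EFin \o F) mpsi mFE H1 iF H2.
rewrite -(fineK (integrable_fin_num mI iF)) => /fine_cvgP[_ C].
  have e0 : 0 < \int[lebesgue_measure]_(s in `]a, e]) F s - K by rewrite subr_gt0.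
  have /cvgrPdist_lt/(_ _ e0)[m0 _ Hm] := C.
  exists m0 => m /Hm /=; rewrite -/(Rintegral _ _ _) -/(Rintegral _ _ _) ltr_norml => /andP[_ h].
  apply: (@lt_le_trans _ _ (\int[lebesgue_measure]_(s in `]a, e]) psi m s)).
    by move: h; rewrite /Rintegral; lra.
  apply: le_Rintegral => // s _; by rewrite ge_min lexx.
Qed.

(** The event is an increasing union of tail intersections, each contained in some A n with n >=
    n0. *)
Lemma probability_liminf_le d (Omega : measurableType d) (R : realType) (P : probability Omega R)
  (A : nat -> set Omega) (c : R) n0 : (forall n, measurable (A n)) ->
  (forall n, (n0 <= n)%N -> (P (A n) <= c%:E)%E) ->
  measurable [set w | exists n1, forall n, (n1 <= n)%N -> A n w] /\
  (P [set w | exists n1, forall n, (n1 <= n)%N -> A n w] <= c%:E)%E.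
Proof.
move=> mA Ac.
pose B N := \bigcap_(n in [set n | (N <= n)%N]) A n.
have mB N : measurable (B N) by apply: bigcap_measurable => //; exists N => /=.
have -> : [set w | exists n1, forall n, (n1 <= n)%N -> A n w] = \bigcup_N B N.
  by apply/seteqP; split=> w [N]; [move=> h; exists N|move=> _ h; exists N].
have mU : measurable (\bigcup_N B N) by exact: bigcup_measurable.
split => //.
have nB : nondecreasing_seq B.
  by move=> i j ij; apply/subsetPset => w Bw n /= jn; apply: Bw => /=; exact: leq_trans jn.
have C := @nondecreasing_cvg_mu _ _ _ P B mB mU nB.
rewrite -(cvg_lim _ C)//; apply: lime_le; first by apply/cvg_ex; eexists; exact: C.
apply: nearW => N /=; apply: (le_trans _ (Ac (maxn N n0) (leq_maxr _ _))).
apply: le_measure; rewrite ?inE// => w Bw; apply: Bw => /=; exact: leq_maxl.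
Qed.
Lemma powR_exprn (R : realType) (x p : R) n : 0 <= x -> (x ^+ n) `^ p = (x `^ p) ^+ n.
Proof. by move=> x0; rewrite -(powR_mulrn n x0) -(powR_mulrn n (powR_ge0 x p)); exact: powRAC. Qed.

(** The scaling of the drift: |u|^alpha = T^(alpha/2) |u / sqrt T|^alpha and r^(-beta) <= T^(-beta).
    The resulting exponent alpha/2 - beta is -1/2 - kap. *)
Lemma norm_drift_le (R : realType) (rho alpha beta T r u : R) : 1 <= T -> T <= r -> 0 <= beta ->
  `|drift rho alpha beta r u| <= `|rho| * T `^ (alpha / 2 - beta) * `|u / Num.sqrt T| `^ alpha.
Proof.
move=> T1 Tr b0; have T0 : 0 < T by exact: lt_le_trans T1.
have r0 : 0 < r by exact: lt_le_trans Tr.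
have s0 : 0 < Num.sqrt T by rewrite sqrtr_gt0.
have E : `|u| `^ alpha = T `^ (alpha / 2) * `|u / Num.sqrt T| `^ alpha.
  have -> : T `^ (alpha / 2) = Num.sqrt T `^ alpha.
    by rewrite -powR12_sqrt ?(ltW T0)// -powRrM mulrC.
  rewrite -powRM ?(ltW s0)// normrM normfV (gtr0_norm s0) mulrCA divff ?mulr1//.
  by rewrite gt_eqF.
move: (`|u / _| `^ _) E (powR_ge0 `|u / Num.sqrt T| alpha) => v E v0.
rewrite /drift !normrM normfV (ger0_norm (powR_ge0 _ _)) (ger0_norm (powR_ge0 _ _)) E.
rewrite powRB ?(gt_eqF T0) ?implybT//.
have -> : `|rho| * (T `^ (alpha / 2) / T `^ beta) * v =
  `|rho| * (T `^ (alpha / 2) * v) / T `^ beta by ring.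
apply: ler_pM; rewrite ?invr_ge0 ?powR_ge0 ?mulr_ge0 ?powR_ge0//.
  apply: ler_wpM2r; first by rewrite mulr_ge0 ?powR_ge0.
  by rewrite ler_piMr// normr_sg; case: (_ != 0).
by rewrite lef_pV2 ?posrE ?powR_gt0//; apply: ge0_ler_powR; rewrite ?nnegrE// ltW.
Qed.

Lemma smooth_abs_powR_cvg (R : realType) (alpha z eps : R) : z != 0 -> 0 < eps ->
  exists m0, forall m, (m0 <= m)%N -> `|z| `^ alpha - eps <= smooth_abs_powR alpha m.+1%:R^-1 z.
Proof.
move=> z0 e0.
have q0 : 0 < z ^+ 2 by rewrite exprn_even_gt0.
have c : {for z ^+ 2, continuous (fun q : R => q `^ (alpha / 2))}.
  by apply: differentiable_continuous; apply/derivable1_diffP;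
    have [] := is_derive1_powR (alpha / 2) q0.
have /cvgrPdist_le/(_ _ e0)/nbhs_ballP[d /= d0 Hd] := c.
exists (Num.truncn d^-1) => m mm.
have := Hd (z ^+ 2 + m.+1%:R^-1); rewrite /ball/= opprD addNKr normrN ger0_norm ?invr_ge0//.
have md : m.+1%:R^-1 < d.
  rewrite invf_plt ?posrE// (lt_le_trans (truncnS_gt _))// ler_nat ltnS//.
move=> /(_ md); rewrite ler_norml => /andP[_ h].
have E : (z ^+ 2) `^ (alpha / 2) = `|z| `^ alpha.
  by rewrite -(real_normK (num_real z)) -powR_mulrn// -powRrM mulrC divfK.
by rewrite /smooth_abs_powR; move: h; rewrite E; lra.
Qed.

Section occupation_blocks.
Context d (Omega : measurableType d) (R : realType) (P : probability Omega R)
  (F : R -> set (set Omega)) (B X : R -> Omega -> R) (rho alpha beta x0 : R).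
Hypotheses (hF : is_filtration F) (hB : is_F_brownian P F B)
  (adX : forall t, 1 <= t -> rv_measurable_wrt (F t) (X t))
  (aeX : {ae P, forall w, path_solution rho alpha beta (X ^~ w) (B ^~ w) x0})
  (al1 : -1 < alpha) (al0 : alpha < 0) (ab : alpha + 1 < 2 * beta).

(** A left-endpoint Riemann sum over [T, 2 T]; being finite, it is a random variable as soon as each
    X_t is. *)
Definition occupation_sum (T eta : R) n (x : R -> R) : R :=
  T / n.+1%:R * \sum_(i < n.+1) smooth_abs_powR alpha eta (x (T + i%:R * (T / n.+1%:R))
    / Num.sqrt T).

(** [occupation_discrete] on [T, 2 T] with constants c1 / T and c2 / T: the c2 term stays bounded
    over an interval of length T, and dividing by c1 / T yields K T. K and T0 are chosen before eta,
    and only n0 depends on it. *)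
Lemma occupation_sum_bound : exists K T0, [/\ 0 <= K, 1 <= T0 & forall T, T0 <= T ->
  forall eta, 0 < eta -> eta <= 1 -> exists n0, forall n, (n0 <= n)%N ->
  [/\ P.-integrable setT (EFin \o (fun w => occupation_sum T eta n (X ^~ w))),
    forall w, 0 <= occupation_sum T eta n (X ^~ w) &
   \int[P]_w occupation_sum T eta n (X ^~ w) <= K * T]].
Proof.
have [c c0 Hc] := gaussian_moment2_lb P.
have [c1 [c2 [c10 c20 Ht]]] := smooth_abs_powR_test al1 al0.
pose kap := beta - (alpha + 1) / 2.
have kap0 : 0 < kap by rewrite /kap; move: ab; lra.
have b0 : 0 <= beta by move: ab al1; lra.
(* The drift is absorbed when 2 |rho| T^(-1 - kap) <= (c1 / T) c / 4, that is when T^kap >= M; this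
   dictates T0. *)
pose M := 8 * `|rho| / (c1 * c).
have cc : 0 < c1 * c by rewrite mulr_gt0.
have M0 : 0 <= M by rewrite /M divr_ge0 ?mulr_ge0// ltW.
pose K := (3 + c2 * 65 / 2) * 4 / (c1 * c).
exists K, (Num.max 1 (M `^ kap^-1)); split.
- by rewrite /K divr_ge0 ?(ltW cc)// mulr_ge0// addr_ge0// divr_ge0// mulr_ge0.
- by rewrite le_max lexx.
move=> T; rewrite ge_max => /andP[T1 TM] eta e0 e1.
have T0 : 0 < T by exact: lt_le_trans T1.
have kT : M <= T `^ kap.
  have := @ge0_ler_powR R kap (ltW kap0) (M `^ kap^-1) T.
  by rewrite !nnegrE powR_ge0 (ltW T0) -powRrM mulVf ?gt_eqF// powRr1//; apply.
have s1 : 1 <= Num.sqrt T by rewrite -[leLHS]sqrtr1 ler_wsqrtr.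
have s0 : 0 < Num.sqrt T by exact: lt_le_trans s1.
have sT : Num.sqrt T ^+ 2 = T by rewrite sqr_sqrtr// ltW.
have [f [f1 [L [hh f1z]]]] := Ht _ e0 e1.
have := test_triple_scale s1 hh; rewrite sT => -[[df f01 gb f1b] [f1L gL f3]].
set g := smooth_abs_powR alpha eta in gb gL f3 f1z *.
have [_ mg] := lipschitz_measurable gL.
have [_ mf1] := lipschitz_measurable f1L.
have [_ mf] := lipschitz_measurable (fun u v => lipschitz_of_derive u v df f1b).
pose k := 2 * `|rho| * T `^ (- 1 - kap).
have k0 : 0 <= k by rewrite /k !mulr_ge0 ?powR_ge0.
have kc : k <= c1 / T * c / 4.
  rewrite /k powRB ?(gt_eqF T0) ?implybT// powR_inv1 ?(ltW T0)//.
  have -> : 2 * `|rho| * (T^-1 / T `^ kap) = 2 * `|rho| / T / T `^ kap by ring.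
  rewrite ler_pdivrMr ?powR_gt0//.
  have -> : 2 * `|rho| / T = c1 / T * c / 4 * M.
    by rewrite /M; field; rewrite (gt_eqF T0) (gt_eqF c10) (gt_eqF c0).
  by apply: ler_wpM2l => //; rewrite !mulr_ge0 ?invr_ge0// ltW.
have fg r u : T <= r <= T + T -> `|f1 (u / Num.sqrt T)
  / Num.sqrt T| * `|drift rho alpha beta r u| <= k * g (u / Num.sqrt T).
  move=> /andP[Tr _].
  apply: (le_trans (ler_wpM2l (normr_ge0 _) (norm_drift_le rho alpha u T1 Tr b0))).
  rewrite normrM normfV (gtr0_norm s0).
  have E : T `^ (- 1 - kap) = T `^ (alpha / 2 - beta) / Num.sqrt T.
    rewrite -powR12_sqrt ?(ltW T0)// -powRB ?(gt_eqF T0) ?implybT//.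
    by congr (_ `^ _); rewrite /kap; field.
  rewrite /k E.
  have -> : `|f1 (u / Num.sqrt T)| / Num.sqrt T * (`|rho| * T `^ (alpha / 2 - beta)
    * `|u / Num.sqrt T| `^ alpha) =
    `|rho| * (T `^ (alpha / 2 - beta) / Num.sqrt T)
      * (`|f1 (u / Num.sqrt T)| * `|u / Num.sqrt T| `^ alpha) by ring.
  have -> : 2 * `|rho| * (T `^ (alpha / 2 - beta) / Num.sqrt T) * g (u / Num.sqrt T) =
    `|rho| * (T `^ (alpha / 2 - beta) / Num.sqrt T) * (2 * g (u / Num.sqrt T)) by ring.
  apply: ler_wpM2l; last exact: f1z.
  by rewrite !mulr_ge0 ?invr_ge0 ?powR_ge0// ltW.
have TT : T < T + T by rewrite ltrDl.
have [n0 H] := @occupation_discrete _ _ _ P F B X rho alpha beta x0 hF hB adX aeX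
  _ _ _ _ k (c1 / T) (c2 / T) c T (T + T) df f01 mf mf1 mg f1b f1L gL gb f3 k0
  (divr_ge0 (ltW c10) (ltW T0)) (divr_ge0 c20 (ltW T0)) Hc T1 TT kc fg.
exists n0 => n nn; have := H n nn; rewrite /occupation_sum -/g addrK => h.
have mX i : measurable_fun setT (X (T + i%:R * (T / n.+1%:R))).
  have t1 : 1 <= T + i%:R * (T / n.+1%:R).
    by rewrite (le_trans T1)// lerDl mulr_ge0// divr_ge0// ltW.
  by move=> _ C mC; rewrite setTI; case: hF => _ [mF _]; exact: mF (adX t1 mC).
have g0 u : 0 <= g (u / Num.sqrt T) by have /andP[] := gb u.
split.
- apply: integrable_realZ.
  apply: (integrable_realsum (f := fun i w => g (X (T + i%:R * (T / n.+1%:R)) w / Num.sqrt T))) => i _.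
  apply: (@bounded_integrable _ _ _ _ _ L); first exact: (measurableT_comp mg (mX i)).
  by move=> w; rewrite ger0_norm//; have /andP[] := gb (X (T + i%:R * (T / n.+1%:R)) w).
- by move=> w; rewrite mulr_ge0 ?divr_ge0 ?(ltW T0)// sumr_ge0.
- move: h; have -> : 3 + c2 / T * 65 / 2 * T = c1 * c / 4 * K.
    by rewrite /K; field; rewrite (gt_eqF T0) (gt_eqF c10) (gt_eqF c0).
  have -> : c1 / T * c / 4 = c1 * c / 4 / T by ring.
  move=> h; have : c1 * c / 4 * (\int[P]_w (T / n.+1%:R * \sum_(i < n.+1)
    g (X (T + i%:R * (T / n.+1%:R)) w / Num.sqrt T)) / T) <= c1 * c / 4 * K.
    by rewrite mulrA mulrAC.
  by rewrite ler_pM2l ?divr_gt0// ler_pdivrMr.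
Qed.

(* Pathwise double limit, first in the mesh of the grid and then in eta = 1 / (m + 1). *)
Lemma occupation_sum_path (x b : R -> R) (T Lam : R)
  : path_solution rho alpha beta x b x0 -> 1 <= T ->
  Lam < \int[lebesgue_measure]_(u in `]T, (T + T)]) `|drift rho alpha beta u (x u)| ->
  exists m0, forall m, (m0 <= m)%N -> exists n0, forall n, (n0 <= n)%N ->
    Lam < `|rho| * T `^ (alpha / 2 - beta) * occupation_sum T m.+1%:R^-1 n x.
Proof.
move=> hx T1 hL.
have T0 : 0 < T by exact: lt_le_trans T1.
have b0 : 0 <= beta by move: ab al1; lra.
have s0 : 0 < Num.sqrt T by rewrite sqrtr_gt0.
have TT : T < T + T by rewrite ltrDl.
pose A := `|rho| * T `^ (alpha / 2 - beta).
have A0 : 0 <= A by rewrite mulr_ge0 ?powR_ge0.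
pose phi m s := A * smooth_abs_powR alpha m.+1%:R^-1 (x s / Num.sqrt T).
have cphi m : {within `[T, T + T], continuous (phi m)}.
  have [c1 [c2 [_ _ Ht]]] := smooth_abs_powR_test al1 al0.
  have m0 : 0 < m.+1%:R^-1 :> R by rewrite invr_gt0.
  have m1 : m.+1%:R^-1 <= 1 :> R by rewrite invf_le1// ler1n.
  have [f [f1 [L [[_ [_ gL _]] _]]]] := Ht _ m0 m1.
  have [cg _] := lipschitz_measurable gL.
  have cx : {within `[T, T + T], continuous x}.
    have [cx _] := hx; apply: continuous_subspaceW cx.
    by move=> u /=; rewrite !in_itv/= andbT => /andP[Tu _]; exact: le_trans Tu.
  move=> u; apply: cvgMr; apply: (continuous_cvg _ (cg _)).
  by apply: cvgMl; exact: cx.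
have iphi m : (@lebesgue_measure R).-integrable `]T, T + T] (EFin \o phi m).
  apply: (@integrableS _ _ _ lebesgue_measure `[T, T + T]%classic) => //.
    by move=> z /=; rewrite !in_itv/= => /andP[uz ->]; rewrite (ltW uz).
  by apply: continuous_compact_integrable => //; exact: segment_compact.
have phi0 m s : 0 <= phi m s by rewrite mulr_ge0 ?powR_ge0.
have lim s : T < s <= T + T -> forall eps, 0 < eps -> exists m0, forall m, (m0 <= m)%N ->
    `|drift rho alpha beta s (x s)| - eps <= phi m s.
  move=> /andP[Ts _] eps eps0.
  (* At a zero of the path the drift vanishes through its sign factor, so the convergence of the
     regularization is invoked only away from 0. *)
  have [xs0|xs0] := eqVneq (x s) 0.
    exists 0%N => m _; rewrite /drift xs0 sgr0 mulr0 !mul0r normr0 sub0r.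
    by apply: le_trans (phi0 m s); rewrite oppr_le0 ltW.
  have z0 : x s / Num.sqrt T != 0 by rewrite mulf_neq0// invr_eq0 gt_eqF.
  have A1 : 0 < A + 1 by rewrite ltr_wpDl.
  have [m0 H] := smooth_abs_powR_cvg alpha z0 (divr_gt0 eps0 A1).
  exists m0 => m /H h.
  rewrite lerBlDr (le_trans (norm_drift_le rho alpha (x s) T1 (ltW Ts) b0))// -/A -lerBlDr /phi.
  apply: (le_trans _ (ler_wpM2l A0 h)); rewrite mulrBr lerB//.
  have -> : A * (eps / (A + 1)) = eps * (A / (A + 1)) by ring.
  by rewrite ler_piMr ?(ltW eps0)// ler_pdivrMr// mul1r lerDl.
have [m0 H] := integral_liminf (drift_norm_integrable hx (T + T) T1) (fun s => normr_ge0 _)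
  iphi phi0 lim hL.
exists m0 => m /H hm.
pose eps := (\int[lebesgue_measure]_(s in `]T, (T + T)]) phi m s - Lam) / 2.
have eps0 : 0 < eps by rewrite divr_gt0// subr_gt0.
have [n0 Hn] := riemann_sum_lower TT (cphi m) eps0.
exists n0 => n /Hn; rewrite addrK /phi -mulr_sumr mulrCA -/A => h.
by rewrite /occupation_sum; apply: lt_le_trans h; rewrite /eps /phi; move: hm; rewrite /phi; lra.
Qed.

(** Markov's inequality at level T^(1/2 - kap/2) against a mean of order T^(1/2 - kap) leaves
    probabilities of order T^(-kap/2), geometric along T = 2^n and hence summable. *)
Lemma occupation_blocks : {ae P, forall w, exists C kap n0, 0 < kap /\
  forall n, (n0 <= n)%N ->
  \int[lebesgue_measure]_(u in `](2 ^+ n), (2 ^+ n.+1)]) `|drift rho alpha beta u (X u w)|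
    <= C * (2 ^+ n) `^ (2^-1 - kap)}.
Proof.
have [K [T0 [K0 T01 HK]]] := occupation_sum_bound.
pose kap := beta - (alpha + 1) / 2.
have kap0 : 0 < kap by rewrite /kap; move: ab; lra.
pose T n : R := 2 ^+ n.
have T1 n : 1 <= T n by rewrite exprn_ege1// ler1n.
have Tp n : 0 < T n by exact: lt_le_trans (T1 n).
have eta0 m : 0 < m.+1%:R^-1 :> R by rewrite invr_gt0.
have eta1 m : m.+1%:R^-1 <= 1 :> R by rewrite invf_le1// ler1n.
pose A n := `|rho| * T n `^ (alpha / 2 - beta).
have A0 n : 0 <= A n by rewrite mulr_ge0 ?powR_ge0.
pose Lam n := T n `^ (2^-1 - kap / 2).
have Lam0 n : 0 < Lam n by rewrite powR_gt0.
(* The double liminf [E2] of these events is measurable and, by [occupation_sum_path], contains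
   almost every outcome whose block integral exceeds [Lam n]; the integral itself never has to be a
   random variable. *)
pose E n m k := [set w | Lam n < A n * occupation_sum (T n) m.+1%:R^-1 k (X ^~ w)].
pose E1 n m := [set w | exists k1, forall k, (k1 <= k)%N -> E n m k w].
pose E2 n := [set w | exists m1, forall m, (m1 <= m)%N -> E1 n m w].
pose u n := `|rho| * K * (T n `^ (- (kap / 2))).
have mE n m k : measurable (E n m k).
  have [c1 [c2 [_ _ Ht]]] := smooth_abs_powR_test al1 al0.
  have [f [f1 [L [[_ [_ gL _]] _]]]] := Ht _ (eta0 m) (eta1 m).
  have [_ mg] := lipschitz_measurable gL.
  have mX i : measurable_fun setT (X (T n + i%:R * (T n / k.+1%:R))).
    have t1 : 1 <= T n + i%:R * (T n / k.+1%:R).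
      by rewrite (le_trans (T1 n))// lerDl mulr_ge0// divr_ge0// ltW.
    by move=> _ C mC; rewrite setTI; case: hF => _ [mF _]; exact: mF (adX t1 mC).
  have mJ : measurable_fun setT (fun w => A n * occupation_sum (T n) m.+1%:R^-1 k (X ^~ w)).
    apply: measurable_funM => //; apply: measurable_funM => //.
    apply: measurable_sum => i; apply: (measurableT_comp mg); apply: measurable_funM => //.
  have -> : E n m k = (fun w => A n * occupation_sum (T n) m.+1%:R^-1 k (X ^~ w))
    @^-1` `]Lam n, +oo[.
    by apply/seteqP; split => w; rewrite /E/= in_itv/= andbT.
  by rewrite -[X in measurable X]setTI; exact: mJ.
have [N HN] : exists N, forall n, (N <= n)%N -> T0 <= T n.
  exists (Num.truncn T0) => n nn.
  rewrite (le_trans (ltW (truncnS_gt _)))//.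
  apply: (@le_trans _ _ n.+1%:R); first by rewrite ler_nat ltnS.
  by rewrite /T -natrX ler_nat ltn_expl.
have PE n : (N <= n)%N -> forall m, exists k0, forall k, (k0 <= k)%N -> (P (E n m k) <= (u n)%:E)%E.
  move=> nn m; have [k0 Hk] := HK _ (HN _ nn) _ (eta0 m) (eta1 m).
  exists k0 => k /Hk[iJ J0 EJ].
  set J := fun w => occupation_sum (T n) m.+1%:R^-1 k (X ^~ w).
  have h1 : Lam n * fine (P (E n m k)) <= A n * \int[P]_w J w.
    rewrite -RintegralZl//.
    have -> : Lam n * fine (P (E n m k)) = \int[P]_w (Lam n * \1_(E n m k) w).
      rewrite RintegralZl//.
        by rewrite /Rintegral integral_indic// setIT.
      apply: (@bounded_integrable _ _ _ _ _ 1); first exact: measurable_indic.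
      by move=> w; rewrite indicE; case: (_ \in _); rewrite ?normr1 ?normr0.
    apply: le_Rintegral => //.
    + apply: integrable_realZ.
      apply: (@bounded_integrable _ _ _ _ _ 1); first exact: measurable_indic.
      by move=> w; rewrite indicE; case: (_ \in _); rewrite ?normr1 ?normr0.
    + exact: integrable_realZ.
    + move=> w _; rewrite indicE; have [/set_mem Ew|_] := boolP (w \in E n m k).
        by rewrite mulr1 ltW.
      by rewrite mulr0 mulr_ge0// J0.
  rewrite -(probability_fineK P (mE n m k)) lee_fin.
  rewrite -(ler_pM2l (Lam0 n)) (le_trans h1)// (le_trans (ler_wpM2l (A0 n) EJ))//.
  rewrite le_eqVlt; apply/orP; left; apply/eqP.
  rewrite /A /Lam /u.
  have -> : `|rho| * T n `^ (alpha / 2 - beta) * (K * T n)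
    = `|rho| * K * (T n `^ (alpha / 2 - beta) * T n `^ 1).
    by rewrite powRr1 ?(ltW (Tp n))//; ring.
  rewrite [RHS]mulrCA -!powRD ?(gt_eqF (Tp n)) ?implybT//.
  by congr (_ * _ `^ _); rewrite /kap; field.
have mE1 n m : measurable (E1 n m).
  by have [] := @probability_liminf_le _ _ _ P (E n m) 1 0%N (mE n m)
    (fun k _ => probability_le1 P (mE n m k)).
have PE1 n : (N <= n)%N -> forall m, (P (E1 n m) <= (u n)%:E)%E.
  move=> nn m; have [k0 Hk] := PE n nn m.
  by have [] := probability_liminf_le (mE n m) Hk.
have mE2 n : measurable (E2 n).
  by have [] := @probability_liminf_le _ _ _ P (E1 n) 1 0%N (mE1 n)
    (fun k _ => probability_le1 P (mE1 n k)).
have PE2 n : (N <= n)%N -> (P (E2 n) <= (u n)%:E)%E.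
  by move=> nn; have [] := probability_liminf_le (n0 := 0) (mE1 n) (fun m _ => PE1 n nn m).
have u0 n : 0 <= u n by rewrite !mulr_ge0 ?powR_ge0.
pose q : R := 2 `^ (- (kap / 2)).
have q0 : 0 < q by rewrite powR_gt0.
have q1 : q < 1.
  have l2 : 0 < ln (2 : R) by rewrite ln_gt0// ltr1n.
  by rewrite /q /powR pnatr_eq0/= -[ltRHS]expR0 ltr_expR mulNr oppr_lt0 mulr_gt0 ?divr_gt0.
have uq n : u n = `|rho| * K * q ^+ n.
  by rewrite /u /q /T powR_exprn.
have us M : \sum_(n < M) u n <= `|rho| * K / (1 - q).
  under eq_bigr do rewrite uq.
  rewrite -mulr_sumr; apply: ler_wpM2l; first by rewrite mulr_ge0.
  have q1' : 0 < 1 - q by rewrite subr_gt0.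
  rewrite -[leRHS]mul1r ler_pdivlMr// mulrC.
  have -> : (1 - q) * \sum_(i < M) q ^+ i = 1 - q ^+ M by rewrite -opprB mulNr -subrX1 opprB.
  by rewrite gerBl exprn_ge0// ltW.
apply: filterS2 (borel_cantelli_ae mE2 u0 PE2 us) aeX => w [n1 Hn1] hw.
exists 1, (kap / 2), n1; split; first by rewrite divr_gt0.
move=> n nn; rewrite mul1r leNgt; apply/negP => hL; apply: (Hn1 n nn).
have T2 : 2 ^+ n.+1 = T n + T n by rewrite exprS /T mulr_natl mulr2n.
move: hL; rewrite T2 => hL.
exact: (occupation_sum_path hw (T1 n) hL).
Qed.
End occupation_blocks.

(** * Transfer from the Brownian motion to the solution *)

Section asymptotics.
Variables (R : realType) (x b : R -> R).
Hypothesis xb : forall e, 0 < e -> exists M, forall t, M <= t -> `|x t - b t| <= e * Num.sqrt t.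
Hypothesis bl : forall M, exists2 t, M <= t & 2^-1 * lil t <= b t.

Lemma unbounded_above y M : exists2 t, M <= t & y <= x t.
Proof.
have [M1 H1] := xb (ltr01).
(* This makes half of lil t at least (|y| + 1) sqrt t, so that |y| sqrt t >= y remains after the
   deviation from b, at most sqrt t. *)
have [M2 H2] := sqrt_le_lil (2 * (`|y| + 1)).
have [t] := bl (Num.max 1 (Num.max M (Num.max M1 M2))).
rewrite !ge_max => /and4P[t1 Mt /H1 h1 /H2 h2] h; exists t => //.
have s1 : 1 <= Num.sqrt t by rewrite -[leLHS]sqrtr1 ler_wsqrtr.
have ys : `|y| <= `|y| * Num.sqrt t by rewrite ler_peMr.
move: h1; rewrite mul1r ler_norml => /andP[h1 _].
have : 2^-1 * (2 * (`|y| + 1) * Num.sqrt t) <= 2^-1 * lil t by rewrite ler_pM2l.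
have -> : 2^-1 * (2 * (`|y| + 1) * Num.sqrt t) = `|y| * Num.sqrt t + Num.sqrt t by field.
by move: ys h h1 (ler_norm y); move: (`|y| * _) (2^-1 * _) => u v; lra.
Qed.
End asymptotics.

(** The path is above y at some late time and below y at a later one, by the same argument for -x;
    the intermediate value theorem gives a visit in between. *)
Lemma recurrent_path (R : realType) (x b : R -> R) (y M : R) : {within `[1, +oo[, continuous x} ->
  (forall e, 0 < e -> exists M, forall t, M <= t -> `|x t - b t| <= e * Num.sqrt t) ->
  (forall M, exists2 t, M <= t & 2^-1 * lil t <= b t) ->
  (forall M, exists2 t, M <= t & 2^-1 * lil t <= - b t) ->
  exists t, M <= t /\ 1 <= t /\ x t = y.
Proof.
move=> cx xb b1 b2.
have xbN e : 0 < e -> exists M, forall t, M <= t -> `|- x t - - b t| <= e * Num.sqrt t.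
  by move=> /xb[M' H]; exists M' => t /H; rewrite -opprD normrN.
have [t1] := unbounded_above xb b1 y (Num.max 1 M).
rewrite ge_max => /andP[t11 Mt1] y1.
have [t2 t12 y2] := unbounded_above xbN b2 (- y) t1.
rewrite lerN2 in y2.
have c12 : {within `[t1, t2], continuous x}.
  apply: continuous_subspaceW cx => z /=; rewrite !in_itv/= andbT => /andP[h _].
  exact: le_trans h.
have [|c] := IVT t12 c12 (v := y).
  by rewrite ge_min y2 orbT/= le_max y1.
rewrite in_itv/= => /andP[tc _] E; exists c; split; first exact: le_trans tc.
by split => //; exact: le_trans tc.
Qed.

(** The bounds on b are indexed by n so that countably many almost sure events suffice. In each
    direction e is split between 1/(n + 1) and the deviation of x from b, since sqrt t <= lil t
    eventually. *)
Lemma limsup_lil (R : realType) (x b : R -> R) :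
  (forall e, 0 < e -> exists M, forall t, M <= t -> `|x t - b t| <= e * Num.sqrt t) ->
  (forall n, exists M, forall t, M <= t -> b t <= (1 + n.+1%:R^-1) * lil t) ->
  (forall n M, exists2 t, M <= t & (1 - n.+1%:R^-1) * lil t <= b t) ->
  limf_esup (fun t => (x t / lil t)%:E) +oo = 1%E.
Proof.
move=> xb bu bl.
have small e : 0 < e -> exists n, n.+1%:R^-1 <= e :> R.
  move=> e0; exists (Num.truncn e^-1).
  by rewrite invf_ple ?posrE// ltW// truncnS_gt.
have [M0 H0] := sqrt_le_lil (1 : R).
have lil0 t : M0 <= t -> 1 <= t -> 0 < lil t.
  move=> /H0 h t1; apply: lt_le_trans h; rewrite mul1r sqrtr_gt0; exact: lt_le_trans t1.
rewrite limf_esupE; apply/eqP; rewrite eq_le; apply/andP; split.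
- apply/lee_addgt0Pr => e e0.
  have e2 : 0 < e / 2 by rewrite divr_gt0.
  have [M1 H1] := xb _ e2; have [n nn] := small _ e2; have [M2 H2] := bu n.
  apply: ge_ereal_inf; exists (ereal_sup ((fun t => (x t / lil t)%:E) @` `[Num.max (Num.max M0 1)
    (Num.max M1 M2), +oo[)).
    exists (`[Num.max (Num.max M0 1) (Num.max M1 M2), +oo[)%classic => //.
    by apply: filterS (nbhs_pinfty_ge (num_real (Num.max (Num.max M0 1) (Num.max M1 M2)))) => z hz;
      rewrite /= in_itv/= andbT.
  apply: ge_ereal_sup => _ [t /= + <-]; rewrite in_itv/= andbT !ge_max => /andP[/andP[m0 t1]
    /andP[m1 m2]].
  have l0 := lil0 t m0 t1.
  rewrite -EFinD lee_fin ler_pdivrMr//.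
  move: (H1 t m1) (H2 t m2) (H0 t m0); rewrite mul1r ler_norml => /andP[_ h1] h2 h3.
  have h4 : e / 2 * Num.sqrt t <= e / 2 * lil t by rewrite ler_pM2l.
  have h5 : n.+1%:R^-1 * lil t <= e / 2 * lil t by rewrite ler_pM2r.
  have -> : (1 + e) * lil t = lil t + e / 2 * lil t + e / 2 * lil t by field.
  move: h2; rewrite mulrDl mul1r.
  by move: h1 h4 h5; move: (_ * lil t) (e / 2 * lil t) (e / 2 * _) => u v w; lra.
- apply: le_ereal_inf_tmp => _ [V [M [_ MV]] <-].
  apply/lee_addgt0Pr => e e0.
  have e2 : 0 < e / 2 by rewrite divr_gt0.
  have [M1 H1] := xb _ e2; have [n nn] := small _ e2.
  (* M + 1 rather than M: a neighbourhood of +oo is only known to contain the t strictly above M. *)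
  have [t] := bl n (Num.max (Num.max M0 1) (Num.max M1 (M + 1))).
  rewrite !ge_max => /andP[/andP[m0 t1] /andP[m1 m2]] hb.
  have l0 := lil0 t m0 t1.
  apply: (@le_trans _ _ ((x t / lil t)%:E + e%:E)%E); last first.
    rewrite leeD2r//; apply: ereal_sup_ubound; exists t => //; apply: MV.
    by rewrite (lt_le_trans _ m2)// ltrDl.
  rewrite -EFinD lee_fin -lerBlDr ler_pdivlMr//.
  move: (H1 t m1) (H0 t m0); rewrite mul1r ler_norml => /andP[h1 _] h3.
  have h4 : e / 2 * Num.sqrt t <= e / 2 * lil t by rewrite ler_pM2l.
  have h5 : n.+1%:R^-1 * lil t <= e / 2 * lil t by rewrite ler_pM2r.
  have -> : (1 - e) * lil t = lil t - e / 2 * lil t - e / 2 * lil t by field.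
  move: hb; rewrite mulrBl mul1r.
  by move: h1 h4 h5; move: (_ * lil t) (e / 2 * lil t) (e / 2 * _) => u v w; lra.
Qed.

Lemma normal_cdf_lipschitz (R : realType) (a b : R) : a <= b ->
  (normal_prob 0 1 (`]-oo, b]%classic : set R) <= normal_prob 0 1 (`]-oo, a]%classic : set R)
    + (normal_peak 1 * (b - a))%:E)%E.
Proof.
move=> ab.
have mp A : measurable_fun A (EFin \o (normal_pdf 0 1) : R -> \bar R).
  by apply/measurable_EFinP; apply: measurable_funTS; exact: measurable_normal_pdf.
have -> : (`]-oo, b]%classic : set R) = `]-oo, a] `|` `]a, b].
  apply/seteqP; split => z /=; rewrite !in_itv/=.
    by move=> zb; case: (leP z a) => h; [left|right].
  by case=> [za|/andP[//]]; exact: le_trans ab.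
rewrite measureU//; first last.
  by apply/seteqP; split => // z /= []; rewrite !in_itv/= => za /andP[az _];
    move: (lt_le_trans az za); rewrite ltxx.
rewrite leeD2l// /normal_prob.
apply: (@le_trans _ _ (\int[lebesgue_measure]_(x in `]a, b]) (cst (normal_peak 1)%:E x)))%E.
  apply: ge0_le_integral => //.
  - by move=> z _; rewrite lee_fin normal_pdf_ge0.
  - exact: mp.
  - by move=> z _; rewrite lee_fin normal_pdf_ub ?oner_neq0.
rewrite integral_cst//= lebesgue_measure_itv/= lte_fin; case: ltP => h.
  by rewrite -EFinD -EFinM.
by rewrite mule0 lee_fin mulr_ge0 ?normal_peak_ge0// subr_ge0.
Qed.

Section solution.
Context d (Omega : measurableType d) (R : realType) (P : probability Omega R)
  (F : R -> set (set Omega)) (B X : R -> Omega -> R) (rho alpha beta x0 : R).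
Hypotheses (rho0 : rho <= 0) (al1 : -1 < alpha) (ab : alpha + 1 < 2 * beta)
  (hF : is_filtration F) (hB : is_F_brownian P F B) (hX : is_solution P F B X rho alpha beta x0).

Let adX t : 1 <= t -> rv_measurable_wrt (F t) (X t). Proof. by case: hX => h _; exact: h. Qed.

Let aeX : {ae P, forall w, path_solution rho alpha beta (X ^~ w) (B ^~ w) x0}.
Proof. by case: hX. Qed.

Let mX t : 1 <= t -> measurable_fun setT (X t).
Proof. by move=> t1 _ C mC; rewrite setTI; case: hF => _ [mF _]; exact: mF (adX t1 mC). Qed.

Lemma solution_little_o : {ae P, forall w, forall e, 0 < e ->
  exists M, forall t, M <= t -> `|X t w - B t w| <= e * Num.sqrt t}.
Proof.
suff : {ae P, forall w, exists C kap n0, 0 < kap /\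
  forall n, (n0 <= n)%N ->
  \int[lebesgue_measure]_(u in `](2 ^+ n), (2 ^+ n.+1)]) `|drift rho alpha beta u (X u w)|
    <= C * (2 ^+ n) `^ (2^-1 - kap)}.
  apply: filterS2 aeX => w hw [C [kap [n0 [kap0 H]]]].
  exact: (blocks_little_o hw kap0 H).
have [al0|al0] := leP 0 alpha; last exact: (occupation_blocks hF hB adX aeX al1 al0 ab).
have cB : {ae P, forall w, cont_path B w} by case: hB => _ [_ []].
have u1 := lil_upper hF hB ltr01.
have u2 := lil_upper hF (brownian_opp hB) ltr01.
apply: filterS2 (filterI u1 u2) (filterI aeX cB) => w [[M1 H1] [M2 H2]] [hw cw].
apply: (@blocks_nonneg_exponent _ _ _ _ _ _ x0 (Num.max M1 M2) rho0 al0 ab hw cw) => t;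
  rewrite ge_max => /andP[/H1 h1 /H2 h2].
by rewrite ler_norml lerNl h1 h2.
Qed.

Lemma solution_recurrent y : {ae P, forall w, forall M : R, exists t,
  M <= t /\ 1 <= t /\ X t w = y}.
Proof.
have e2 : 0 < 2^-1 :> R by rewrite invr_gt0.
have l1 := lil_lower hF hB e2.
have l2 := lil_lower hF (brownian_opp hB) e2.
have h2 : 1 - 2^-1 = 2^-1 :> R by field.
rewrite h2 in l1 l2.
apply: filterS3 (filterI l1 l2) solution_little_o aeX => w [w1 w2] wo [cw _] M.
exact: (recurrent_path y M cw wo w1 w2).
Qed.

Lemma solution_lil : {ae P, forall w,
  limf_esup (fun t => (X t w / lil t)%:E) +oo = 1%E}.
Proof.
have n0 n : 0 < n.+1%:R^-1 :> R by rewrite invr_gt0.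
have u1 : {ae P, forall w, forall n, exists M, forall t, M <= t -> B t w <= (1 + n.+1%:R^-1) * lil t}.
  by apply: ae_foralln => n; exact: (lil_upper hF hB (n0 n)).
have l1 : {ae P, forall w, forall n, forall M, exists2 t, M <= t & (1 - n.+1%:R^-1)
  * lil t <= B t w}.
  by apply: ae_foralln => n; exact: (lil_lower hF hB (n0 n)).
apply: filterS3 solution_little_o u1 l1 => w wo w1 w2.
exact: (limsup_lil wo w1 w2).
Qed.

Let measurable_deviation t v : 1 <= t -> measurable [set w | v < `|X t w - B t w|].
Proof.
move=> t1; rewrite (_ : [set w | _] = (fun w => `|X t w - B t w|) @^-1` `]v, +oo[); last first.
  by apply/seteqP; split => w /=; rewrite in_itv/= andbT.
have mD : measurable_fun setT (fun w => `|X t w - B t w|).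
  apply: measurableT_comp => //; apply: measurable_funB; first exact: mX.
  exact: (brownian_measurable hF hB (le_trans ler01 t1)).
by rewrite -[X in measurable X]setTI; exact: mD.
Qed.

(* The times are uncountable, so the a.s. statement is used along a sequence of counterexamples. *)
Lemma solution_in_probability dl eps : 0 < dl -> 0 < eps -> exists2 T, 1 <= T & forall t, T <= t ->
  fine (P [set w | dl * Num.sqrt t < `|X t w - B t w|]) <= eps.
Proof.
move=> dl0 e0; apply: contrapT => H.
have /choice[t Ht] : forall n : nat, exists t,
  n.+1%:R <= t /\ eps < fine (P [set w | dl * Num.sqrt t < `|X t w - B t w|]).
  move=> n; apply: contrapT => Hn; apply: H; exists n.+1%:R; first by rewrite ler1n.
  by move=> t nt; rewrite leNgt; apply/negP => h; apply: Hn; exists t.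
pose A n := [set w | dl * Num.sqrt (t n) < `|X (t n) w - B (t n) w|].
have t1 n : 1 <= t n by rewrite (le_trans _ (proj1 (Ht n)))// ler1n.
have mA n : measurable (A n) by exact: measurable_deviation.
have aeA : {ae P, forall w, exists n0, forall n, (n0 <= n)%N -> ~ A n w}.
  apply: filterS solution_little_o => w /(_ _ dl0)[M HM].
  exists (Num.truncn M) => n nn; apply/negP; rewrite -leNgt; apply: HM.
  rewrite (le_trans (ltW (truncnS_gt _)))// (le_trans _ (proj1 (Ht n)))// ler_nat ltnS//.
have [n0 Hn0] := probability_eventually0 mA aeA e0.
by have := lt_le_trans (proj2 (Ht n0)) (Hn0 n0 (leqnn _)); rewrite ltxx.
Qed.

Lemma brownian_marginal t z : 0 < t ->
  P [set w | B t w / Num.sqrt t <= z] = normal_prob 0 1 (`]-oo, z]%classic : set R).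
Proof.
move=> t0; have s0 : 0 < Num.sqrt t by rewrite sqrtr_gt0.
have [_ law] := brownian_gaussian hF hB t0.
rewrite (_ : [set w | _] = B t @^-1` `]-oo, Num.sqrt t * z]); last first.
  by apply/seteqP; split => w /=; rewrite in_itv/= ler_pdivrMr// mulrC.
rewrite law// normal_prob_scale//; apply: congr1.
by apply/seteqP; split => w /=; rewrite !in_itv/= ler_pM2l.
Qed.

(** Slutsky's argument: outside an event of probability at most e/2, X_t / sqrt t is within dl of
    B_t / sqrt t, which is exactly standard normal. The distribution function at y is thus enclosed
    between the normal one at y - dl and y + dl, and the Lipschitz bound makes each shift cost at
    most e/2. *)
Lemma solution_clt y : (fun t => P [set w | X t w / Num.sqrt t <= y]) @ +oo
  --> normal_prob 0 1 (`]-oo, y]%classic : set R).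
Proof.
have mS (Y : R -> Omega -> R) t z : measurable_fun setT (Y t)
  -> measurable [set w | Y t w / Num.sqrt t <= z].
  move=> mY; rewrite (_ : [set w | _] = (fun w => Y t w / Num.sqrt t) @^-1` `]-oo, z]); last first.
    by apply/seteqP; split => w /=; rewrite in_itv.
  by rewrite -[X in measurable X]setTI; apply: (measurable_funM mY (measurable_cst _)).
have mE (z : R) : measurable (`]-oo, z]%classic : set R) by exact: measurable_itv.
pose Phi z := fine (normal_prob 0 1 (`]-oo, z]%classic : set R)).
have ff z : normal_prob 0 1 (`]-oo, z]%classic : set R) = (Phi z)%:E.
  exact: (esym (probability_fineK (normal_prob 0 1) (mE z))).
rewrite (ff y).
have PB t z : 0 < t -> fine (P [set w | B t w / Num.sqrt t <= z]) = Phi z.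
  by move=> t0; rewrite brownian_marginal.
have PhiL z v : z <= v -> Phi v <= Phi z + normal_peak 1 * (v - z).
  by move=> zv; have := normal_cdf_lipschitz zv; rewrite (ff z) (ff v) -EFinD lee_fin.
clearbody Phi.
have near1 : \forall t \near (pinfty_nbhs R), 1 <= t := nbhs_pinfty_ge (num_real 1).
apply/fine_cvgP; split.
  apply: filterS near1 => t t1; rewrite fin_num_measure//.
  by apply: mS; exact: mX.
apply/cvgrPdist_le => e e0.
pose c := normal_peak 1 + 1 : R.
have c0 : 0 < c by rewrite ltr_wpDl// normal_peak_ge0.
pose dl := e / (2 * c).
have dl0 : 0 < dl by rewrite divr_gt0// mulr_gt0.
have e2 : 0 < e / 2 by rewrite divr_gt0.
have [T T1 HT] := solution_in_probability dl0 e2.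
have lip z : Phi (z + dl) <= Phi z + e / 2.
  have := PhiL z (z + dl); rewrite lerDl (ltW dl0) => /(_ isT).
  rewrite [z + dl - z]addrAC subrr add0r => h; apply: (le_trans h); rewrite lerD2l.
  apply: (@le_trans _ _ (c * dl)); first by rewrite ler_pM2r// lerDl.
  by rewrite /dl le_eqVlt; apply/orP; left; apply/eqP; field; rewrite gt_eqF.
apply: filterS (nbhs_pinfty_ge (num_real T)) => t Tt.
have t1 := le_trans T1 Tt; have t0 : 0 < t by exact: lt_le_trans t1.
have s0 : 0 < Num.sqrt t by rewrite sqrtr_gt0.
have mXt := mX t1; have mBt := brownian_measurable hF hB (ltW t0).
pose A := [set w | dl * Num.sqrt t < `|X t w - B t w|].
have mA : measurable A by exact: measurable_deviation.
have PA : fine (P A) <= e / 2 := HT t Tt.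
have cover (S1 S2 : set Omega) : measurable S1 -> measurable S2 -> S1 `<=` S2 `|` A ->
    fine (P S1) <= fine (P S2) + e / 2.
  move=> m1 m2 sub; apply: (@le_trans _ _ (fine (P S2) + fine (P A))); last by rewrite lerD2l.
  rewrite -lee_fin EFinD !probability_fineK//.
  apply: (le_trans _ (measureU2 P m2 mA)); apply: le_measure; rewrite ?inE//; exact: measurableU.
have h1 : fine (P [set w | X t w / Num.sqrt t <= y]) <= Phi (y + dl) + e / 2.
  rewrite -(PB t _ t0); apply: cover; [exact: mS|exact: mS|] => w /= hx.
  have [h|h] := leP `|X t w - B t w| (dl * Num.sqrt t); last by right.
  left; move: hx; rewrite !ler_pdivrMr// mulrDl => hx.
  by move: h; rewrite ler_norml => /andP[h _]; lra.
have h2 : Phi (y - dl) <= fine (P [set w | X t w / Num.sqrt t <= y]) + e / 2.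
  rewrite -(PB t _ t0); apply: cover; [exact: mS|exact: mS|] => w /= hx.
  have [h|h] := leP `|X t w - B t w| (dl * Num.sqrt t); last by right.
  left; move: hx; rewrite !ler_pdivrMr// mulrBl => hx.
  by move: h; rewrite ler_norml => /andP[_ h]; lra.
have l1 := lip y; have := lip (y - dl); rewrite subrK => l2.
rewrite ler_norml; apply/andP; split; move: h1 h2 l1 l2 => /=;
  move: (fine (P _)) (Phi _) (Phi _) (Phi _) => u v w z; lra.
Qed.
End solution.

Theorem theorem4p6 (d : measure_display) (Omega : measurableType d)
  (R : realType) (P : probability Omega R)
  (F : R -> set (set Omega)) (B X : R -> Omega -> R)
  (rho alpha beta x0 : R) :
  rho <= 0 -> -1 < alpha -> alpha + 1 < 2 * beta -> 0 <= x0 ->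
  is_filtration F -> is_F_brownian P F B ->
  is_solution P F B X rho alpha beta x0 ->
  (* recurrence in R *)
  (forall x : R, {ae P, forall w, forall M : R,
       exists t, M <= t /\ 1 <= t /\ X t w = x}) /\
  (* X_t / sqrt t converges in distribution to N(0,1) *)
  (forall y : R,
     (fun t => P [set w | X t w / Num.sqrt t <= y]) @ +oo
       --> normal_prob 0 1 `]-oo, y]) /\
  (* law of the iterated logarithm *)
  {ae P, forall w,
     limf_esup (fun t => (X t w / Num.sqrt (2 * t * ln (ln t)))%:E) +oo = 1%E}.
Proof.
move=> rho0 al1 ab _ hF hB hX; split; [|split].
- exact: (solution_recurrent rho0 al1 ab hF hB hX).
- exact: (solution_clt rho0 al1 ab hF hB hX).
- exact: (solution_lil rho0 al1 ab hF hB hX).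
Qed.
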